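(* Let $\alpha\in[1,2]$, let $M=S^2$, and let $\{M_t=X(M,t)\}_{0\le t<T}$ be a smooth, strictly convex solution in $\mathbb{R}^3$ of the flow equation $$\frac{\partial X}{\partial t}=-K^{\alpha/2}\nu .$$ Then for every $t\in[0,T)$, $$\sup_{x\in M}\frac{(r_1(x,t)-r_2(x,t))^2}{(r_1(x,t)r_2(x,t))^{\alpha}}\le \sup_{x\in M}\frac{(r_1(x,0)-r_2(x,0))^2}{(r_1(x,0)r_2(x,0))^{\alpha}} .$$
   Context: A solution of the flow is a smooth family of embeddings $X(\cdot,t):S^2\to\mathbb{R}^3$, $t\in[0,T)$. $K$ denotes the Gauss curvature and $\nu$ the outer unit normal of the evolving surface $M_t=X(S^2,t)$. Strictly convex means that both principal curvatures $\kappa_1,\kappa_2$ (positive for round spheres) are positive everywhere. $r_1(x,t)$ and $r_2(x,t)$ are the principal radii of curvature of $M_t$ at the point labelled by $x$, i.e. $r_i=1/\kappa_i$. *)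

(* Defs.v *)
From HB Require Import structures.
From mathcomp Require Import all_boot all_order all_algebra.
From mathcomp Require Import all_classical all_reals all_analysis.
Set Implicit Arguments.
Unset Strict Implicit.
Unset Printing Implicit Defensive.
Import Order.TTheory GRing.Theory Num.Theory.
Import numFieldNormedType.Exports.
Local Open Scope classical_set_scope.
Local Open Scope ring_scope.

(* C^k on an open set U of a finite-dimensional space: all directional
   derivatives are C^(k-1), which there is equivalent to the Frechet derivative
   being C^(k-1). *)
Fixpoint Ck (R : realType) (V W : normedModType R) (k : nat) (U : set V)
    (f : V -> W) : Prop :=
  match k with
  | 0 => forall p, U p -> {for p, continuous f}
  | k'.+1 => (forall p, U p -> differentiable f p) /\
             (forall v, Ck k' U ('D_v f))
  end.

(* Smoothness on an arbitrary subset D of a finite-dimensional space: local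
   extendability to smooth maps on open sets. For D = S^2 x [0, T) this is
   smoothness on the manifold with boundary S^2 x [0, T). *)
Definition smooth_on (R : realType) (V W : normedModType R) (D : set V)
    (f : V -> W) : Prop :=
  forall p, D p -> exists (U : set V) (F : V -> W),
    [/\ open U, U p, forall k, Ck k U F &
        forall q, D q -> U q -> f q = F q].

(* The library norm on 'rV[R]_3 is the sup norm, hence an explicit Euclidean
   inner product. *)
Definition dot (R : realType) (u v : 'rV[R]_3) : R :=
  \sum_(i < 3) u ord0 i * v ord0 i.

Definition enorm (R : realType) (u : 'rV[R]_3) : R := Num.sqrt (dot u u).

Definition sphere2 (R : realType) : set 'rV[R]_3 := [set x | dot x x = 1].

Definition tangent (R : realType) (x : 'rV[R]_3) : set 'rV[R]_3 :=
  [set v | dot x v = 0].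

(* For x in S^2 and v tangent to S^2 at x, h |-> (x + h v) / |x + h v| is a
   curve on S^2 with velocity v at h = 0, so this is the differential at x,
   applied to v, of the restriction of f to S^2; values of f off the sphere do
   not matter. *)
Definition sphere_diff (R : realType) (f : 'rV[R]_3 -> 'rV[R]_3)
    (x v : 'rV[R]_3) : 'rV[R]_3 :=
  'D_v (fun y => f ((enorm y)^-1 *: y)) x.

(* A smooth immersion which is a homeomorphism onto its image, g being the
   continuous inverse. *)
Definition sphere_embedding (R : realType) (f : 'rV[R]_3 -> 'rV[R]_3) : Prop :=
  [/\ smooth_on (@sphere2 R) f,
      forall x v, sphere2 x -> tangent x v -> sphere_diff f x v = 0 -> v = 0 &
      exists g : 'rV[R]_3 -> 'rV[R]_3,
        {within f @` @sphere2 R, continuous g} /\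
        (forall x, sphere2 x -> g (f x) = x)].

(* Points of the unbounded component(s) of the complement of S; a point of S has
   an empty, hence bounded, component. *)
Definition exterior (R : realType) (S : set 'rV[R]_3) : set 'rV[R]_3 :=
  [set p | ~ bounded_set (connected_component (~` S) p)].

Definition outer_unit_normal (R : realType) (f nu : 'rV[R]_3 -> 'rV[R]_3) :
    Prop :=
  forall x, sphere2 x ->
    [/\ dot (nu x) (nu x) = 1,
        forall v, tangent x v -> dot (nu x) (sphere_diff f x v) = 0 &
        \forall s \near 0^'+, exterior (f @` @sphere2 R) (f x + s *: nu x)].

(* Eigenvalues, with multiplicity, of the Weingarten map df(v) |-> dnu(v) of the
   tangent plane, on an orthonormal basis df(v1), df(v2) of principal
   directions. With nu the outer normal, both are 1 for the unit sphere. *)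
Definition principal_curvatures (R : realType) (f nu : 'rV[R]_3 -> 'rV[R]_3)
    (x : 'rV[R]_3) (k1 k2 : R) : Prop :=
  exists v1 v2 : 'rV[R]_3,
    let e1 := sphere_diff f x v1 in
    let e2 := sphere_diff f x v2 in
    [/\ tangent x v1 /\ tangent x v2,
        [/\ dot e1 e1 = 1, dot e2 e2 = 1 & dot e1 e2 = 0],
        sphere_diff nu x v1 = k1 *: e1 &
        sphere_diff nu x v2 = k2 *: e2].

Definition gauss_curvature (R : realType) (k1 k2 : R) : R := k1 * k2.

(* [0, T), with T = +oo allowed. *)
Definition time_interval (R : realType) (T : \bar R) : set R :=
  [set t | 0 <= t /\ (t%:E < T)%E].

(* The limit is taken inside [0, T), so it is a right derivative at t = 0. *)
Definition has_time_derivative (R : realType) (T : \bar R)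
    (f : R -> 'rV[R]_3) (t : R) (l : 'rV[R]_3) : Prop :=
  (s - t)^-1 *: (f s - f t) @[s --> within (time_interval T) t^'] --> l.

Definition roundness (R : realType) (alpha r1 r2 : R) : R :=
  (r1 - r2) ^+ 2 / (r1 * r2) `^ alpha.

Definition sup_roundness (R : realType) (alpha : R) (r1 r2 : 'rV[R]_3 -> R) :
    \bar R :=
  ereal_sup [set (roundness alpha (r1 x) (r2 x))%:E | x in @sphere2 R].

(* Main.v *)
(* Let sigma be the support function of the surface, restricted to the plane of
   normals (p1, p2, 1) and regarded as a function of (p1, p2, t). The flow
   becomes d sigma / dt = - (det D^2 sigma)^(-alpha/2) mu^(1/2 - alpha) with
   mu = 1 + p1^2 + p2^2, and the roundness becomes
   Q = (tr^2 - 4 mu det) det^(-alpha) mu^(1 - 2 alpha), where det and tr are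
   the determinant of D^2 sigma and its trace against I + p p^T. At a spatial
   maximum of Q with Q > 0 choose the frame so that p = 0 and D^2 sigma is
   diagonal: d(ln Q)/dt is then the linearized elliptic operator applied to
   ln Q, which is nonpositive, plus a quadratic form in the third derivatives
   of sigma, and the vanishing of the gradient of Q makes this form nonpositive
   when 1 <= alpha <= 2. The maximum principle concludes.

   The Gauss map need not be inverted: the vector fields dual to (p1, p2, t) are
   defined by the inverse Jacobian matrix, and they commute because their
   brackets kill p1, p2 and t. *)
Require Import Defs.
From HB Require Import structures.
From mathcomp Require Import all_boot all_order all_algebra.
From mathcomp Require Import all_classical all_reals all_analysis.
From mathcomp Require Import ring lra.
Set Implicit Arguments.
Unset Strict Implicit.
Unset Printing Implicit Defensive.
Import Order.TTheory GRing.Theory Num.Theory.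
Import numFieldNormedType.Exports.
Local Open Scope classical_set_scope.
Local Open Scope ring_scope.

(** * Calculus of smooth maps *)

(** The principal curvatures, principal directions and [nu] are given point by point, the curvatures
    in no fixed order and without regularity; near umbilics no smooth choice need exist. Hence only
    r1 r2 and (r1 + r2)^2, which determine the roundness, are compared with smooth functions, built
    from X and a fixed frame of space. Charts of the sphere are avoided by extending all maps to
    open subsets of R^3 x R, constant along rays. At the point under study two principal directions
    v1, v2 are frozen as constant vectors; derivatives along (v1, 0), (v2, 0), (0, 1) commute by
    Schwarz, and the radial derivative vanishes. Since ln Q is singular at umbilics, it is formed
    only near a maximum with Q > 0; this suffices because the bound to be propagated is nonnegative.
    Elsewhere only continuity of Q is used. The power of mu in the flow comes from K = 1 / (mu^2
    det) and from the factor sqrt mu between sigma and the support function at unit normals. Below,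
    beta = alpha / 2 ranges over [1/2, 1]. *)

Definition smooth (R : realType) (V W : normedModType R) (U : set V)
  (f : V -> W) : Prop := forall k, Ck k U f.

Section Ck_calculus.
Context {R : realType} {V : normedModType R}.

Section general_codomain.
Context {W : normedModType R}.
Implicit Types (f g : V -> W) (U : set V).

Lemma open_near_eq U f g p : open U -> U p -> (forall q, U q -> f q = g q) ->
  \near p, f p = g p.
Proof.
move=> oU Up fg; near=> q; apply: fg; near: q; exact: open_nbhs_nbhs.
Unshelve. all: by end_near. Qed.

Lemma eq_on_derive U f g v p : open U -> U p ->
  (forall q, U q -> f q = g q) -> 'D_v f p = 'D_v g p.
Proof. by move=> oU Up fg; apply: near_eq_derive; exact: open_near_eq fg. Qed.

Lemma near_eq_continuous f g p : (\near p, f p = g p) ->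
  {for p, continuous f} -> {for p, continuous g}.
Proof.
move=> fg cf; rewrite /prop_for /continuous_at -(nbhs_singleton fg).
by apply: cvg_trans cf; apply: near_eq_cvg; apply: filterS fg => q ->.
Qed.

Lemma near_eq_differentiable f g p : (\near p, f p = g p) ->
  differentiable f p -> differentiable g p.
Proof.
move=> fg df.
have dfL := diff_locallyx df.
have cd : continuous ('d f p) by exact: diff_continuous.
apply/diff_locallyP.
have gE : g \o shift p = cst (g p) + 'd f p +o_ 0 id.
  apply/eqaddoP => e e0.
  have /diff_locallyP[_ /eqaddoP/(_ e e0)] := df.
  apply: filter_app.
  have : \forall h \near (0 : V), f (h + p) = g (h + p).
    by have := fg; rewrite (near_shift 0 p) /= subr0.
  apply: filter_app; near=> h => fgh.
  by rewrite /= /cst /= !fctE /= -(nbhs_singleton fg) -fgh.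
by have /= dgE := diff_unique cd gE; rewrite dgE.
Unshelve. all: by end_near. Qed.

(** Derivatives computed by a rule are known only on [U]; this lemma puts them in place of ['D_v f].
    Openness of [U] makes the germs agree at each of its points. *)
Lemma eq_on_Ck k U f g : open U -> (forall q, U q -> f q = g q) ->
  Ck k U f -> Ck k U g.
Proof.
move=> oU; elim: k f g => [|k IH] f g fg /=.
  move=> cf p Up; apply: near_eq_continuous (cf p Up).
  exact: open_near_eq fg.
move=> [df Df]; split => [p Up|v].
  by apply: near_eq_differentiable (df p Up); exact: open_near_eq fg.
by apply: IH (Df v) => q Uq; exact: eq_on_derive fg.
Qed.

Lemma subset_Ck k U U' f : U' `<=` U -> Ck k U f -> Ck k U' f.
Proof.
move=> sub; elim: k f => [|k IH] f /= => [cf p /sub /cf//|[df Df]].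
by split=> [p /sub /df //|v]; exact: IH.
Qed.

Lemma CkS_Ck k U f : Ck k.+1 U f -> Ck k U f.
Proof.
elim: k f => [|k IH] f /= [df Df] => [p Up|].
  exact/differentiable_continuous/df.
by split => // v; exact/IH/Df.
Qed.

Lemma cst_Ck k U (c : W) : Ck k U (cst c).
Proof.
elim: k c => [|k IH] c /= => [p _|]; first exact: cst_continuous.
split=> [p _|v]; first exact: differentiable_cst.
by rewrite (_ : 'D_v _ = cst 0) //; apply/funext => p; rewrite derive_cst.
Qed.

Lemma add_Ck k U f g : open U -> Ck k U f -> Ck k U g -> Ck k U (f + g).
Proof.
move=> oU; elim: k f g => [|k IH] f g /= => [cf cg p Up|[df Df] [dg Dg]].
  by apply: continuousD; [exact: cf|exact: cg].
split=> [p Up|v]; first by apply: differentiableD; [exact: df|exact: dg].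
apply: eq_on_Ck (IH _ _ (Df v) (Dg v)) => // q Uq.
by rewrite deriveD//; apply: diff_derivable; [exact: df|exact: dg].
Qed.

Lemma smooth_differentiable U f p : smooth U f -> U p -> differentiable f p.
Proof. by move=> /(_ 1)[df _]; exact: df. Qed.

Lemma smooth_continuous U f p : smooth U f -> U p -> {for p, continuous f}.
Proof. by move=> sf; apply: (sf 0). Qed.

Lemma smooth_derivable U f v p : smooth U f -> U p -> derivable f p v.
Proof. by move=> sf Up; apply/diff_derivable/(smooth_differentiable sf). Qed.

Lemma smooth_derive U f v : smooth U f -> smooth U ('D_v f).
Proof. by move=> sf k; have [_] := sf k.+1; exact. Qed.

Lemma eq_on_smooth U f g : open U -> (forall q, U q -> f q = g q) ->
  smooth U f -> smooth U g.
Proof. by move=> oU fg sf k; exact: eq_on_Ck fg (sf k). Qed.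

Lemma smooth_subset U U' f : U' `<=` U -> smooth U f -> smooth U' f.
Proof. by move=> sub sf k; exact: subset_Ck (sf k). Qed.

Lemma smooth_cst U (c : W) : smooth U (cst c).
Proof. by move=> k; exact: cst_Ck. Qed.

Lemma smoothD U f g : open U -> smooth U f -> smooth U g -> smooth U (f + g).
Proof. by move=> oU sf sg k; exact: add_Ck. Qed.

End general_codomain.

Implicit Types (f g : V -> R) (U : set V).

Lemma mul_Ck k U f g : open U -> Ck k U f -> Ck k U g -> Ck k U (f * g).
Proof.
move=> oU; elim: k f g => [|k IH] f g => [cf cg p Up|].
  exact: (continuousM (cf p Up) (cg p Up)).
move=> fk gk; have [[df Df] [dg Dg]] := (fk, gk).
split=> [p Up|v]; first by apply: differentiableM; [exact: df|exact: dg].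
apply: (@eq_on_Ck _ _ _ (f * 'D_v g + g * 'D_v f)) => //.
  move=> q Uq; rewrite deriveM//; apply: diff_derivable;
  by [exact: df|exact: dg].
by apply: add_Ck => //; apply: IH; do ?[exact: Df|exact: Dg];
  exact: CkS_Ck.
Qed.

Lemma smoothM U f g : open U -> smooth U f -> smooth U g -> smooth U (f * g).
Proof. by move=> oU sf sg k; exact: mul_Ck. Qed.

Lemma smoothN U f : open U -> smooth U f -> smooth U (- f).
Proof.
move=> oU sf; apply: (@eq_on_smooth _ _ (cst (-1) * f)) => //.
  by move=> q _; rewrite !fctE mulN1r.
by apply: smoothM => //; exact: smooth_cst.
Qed.

Lemma derive_comp1 (phi : R -> R) (dphi : R) f v p :
  is_derive (f p) 1 phi dphi -> differentiable f p ->
  'D_v (phi \o f) p = dphi * 'D_v f p.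
Proof.
move=> [/derivable1_diffP dphif phiE] df.
rewrite deriveE; last exact: differentiable_comp.
rewrite diff_comp//= -(deriveE v df) -[X in 'd phi _ X]mulr1.
by rewrite [LHS]linearZ/= -deriveE// phiE mulrC.
Qed.

(** Bootstrapping: if phi o f is C^j then so is dphi o f, hence so is the derivative (dphi o f) D_v
    f, and phi o f is C^(j+1). The hypothesis on [dphi] is immediate when [dphi] is expressed
    through [phi], as for exp and the inverse. *)
Lemma comp_Ck k U (phi dphi : R -> R) f : open U ->
  (forall p, U p -> is_derive (f p) 1 phi (dphi (f p))) ->
  (forall j, Ck j U (phi \o f) -> Ck j U (dphi \o f)) ->
  smooth U f -> Ck k U (phi \o f).
Proof.
move=> oU phiE sphi sf.
have dphif p : U p -> differentiable phi (f p).
  by move=> /phiE[] /derivable1_diffP.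
elim: k => [|k IH].
  move=> p Up; apply: differentiable_continuous; apply: differentiable_comp.
    exact: smooth_differentiable sf Up.
  exact: dphif.
split=> [p Up|v].
  apply: differentiable_comp; last exact: dphif.
  exact: smooth_differentiable sf Up.
apply: (@eq_on_Ck _ _ _ ((dphi \o f) * 'D_v f)) => //.
  move=> q Uq; rewrite (derive_comp1 _ (phiE q Uq))//.
  exact: smooth_differentiable sf Uq.
by apply: mul_Ck => //; [exact: sphi|have [_] := sf k.+1; apply].
Qed.

Lemma smooth_expR U f : open U -> smooth U f -> smooth U (expR \o f).
Proof.
by move=> oU sf k; apply: (@comp_Ck _ _ _ expR).
Qed.

Lemma smoothV U f : open U -> (forall p, U p -> f p != 0) -> smooth U f ->
  smooth U (fun p => (f p)^-1).
Proof.
move=> oU f0 sf k.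
apply: (@comp_Ck _ _ _ (fun x => - x ^- 2)) => //= [p Up|j Cj].
  apply: DeriveDef; first by apply: derivableV => //; exact: f0.
  by rewrite deriveV ?f0// derive_id [LHS]mulr1.
apply: (@eq_on_Ck _ _ _ (cst (-1) * ((GRing.inv \o f) * (GRing.inv \o f)))) => //.
  by move=> q Uq; rewrite !fctE /= mulN1r expr2 invfM.
by do 2?[apply: mul_Ck => //]; exact: cst_Ck.
Qed.

Lemma smooth_ln U f : open U -> (forall p, U p -> 0 < f p) -> smooth U f ->
  smooth U (@ln R \o f).
Proof.
move=> oU f0 sf k.
apply: (@comp_Ck _ _ _ (fun x => x^-1)) => //= [p Up|j Cj].
  by apply: is_derive1_ln; exact: f0.
by apply: smoothV => // p Up; rewrite gt_eqF// f0.
Qed.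

Lemma smooth_sum n U (f : 'I_n -> V -> R) : open U ->
  (forall i, smooth U (f i)) -> smooth U (fun p => \sum_(i < n) f i p).
Proof.
move=> oU sf.
suff -> : (fun p => \sum_(i < n) f i p) = \sum_(i < n) f i.
  by elim/big_ind: _ => // [|g h sg sh]; [exact: smooth_cst|exact: smoothD].
by apply/funext => p; rewrite fct_sumE.
Qed.

End Ck_calculus.

(** * Directional derivatives: Schwarz, one-sided bounds, second derivative test *)

Section directional_derivatives.
Context {R : realType} {V : normedModType R}.

Lemma is_derive_line (W : normedModType R) (f : V -> W) q v s l :
  is_derive (s *: v + q) v f l -> is_derive s 1 (fun h => f (h *: v + q)) l.
Proof.
have E : (fun h : R => h^-1 *: (((fun h => f (h *: v + q)) \o shift s) (h *: (1:R))
    - f (s *: v + q))) =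
  (fun h : R => h^-1 *: ((f \o shift (s *: v + q)) (h *: v) - f (s *: v + q))).
  by apply/funext => h /=; rewrite [h *: 1]mulr1 scalerDl addrA.
by move=> [fv fl]; split; [rewrite /derivable E|rewrite /derive E].
Qed.

Lemma near_plane (P : set V) p v w : (\forall q \near p, P q) ->
  exists2 h : R, 0 < h & forall a b, 0 <= a <= h -> 0 <= b <= h ->
    P (a *: v + (b *: w + p)).
Proof.
move=> /nbhs_ballP[r /= r0 rP].
have D0 : 0 < `|v| + `|w| + 1 by rewrite ltr_wpDl// addr_ge0.
exists (r / (`|v| + `|w| + 1)); first exact: divr_gt0.
move=> a b /andP[a0 ah] /andP[b0 bh]; apply: rP.
rewrite -ball_normE /= addrA [X in p - X]addrC opprD addrA subrr sub0r normrN.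
apply: le_lt_trans (ler_normD _ _) _; rewrite !normrZ !ger0_norm//.
apply: (@le_lt_trans _ _ (r / (`|v| + `|w| + 1) * (`|v| + `|w|))).
  by rewrite mulrDr lerD// ler_wpM2r.
by rewrite mulrAC ltr_pdivrMr// ltr_pM2l// ltrDl.
Qed.

Lemma near_line (P : set V) p v : (\forall q \near p, P q) ->
  exists2 h : R, 0 < h & forall a, 0 <= a <= h -> P (a *: v + p).
Proof.
move=> /near_plane-/(_ v 0)[h h0 hP]; exists h => // a ah.
by have := hP a 0 ah; rewrite scale0r add0r lexx ltW//; exact.
Qed.

Lemma MVT_line (U : set V) (f : V -> R) q v (h : R) : smooth U f -> 0 < h ->
  (forall a, 0 <= a <= h -> U (a *: v + q)) ->
  exists2 c, 0 < c < h & f (h *: v + q) - f q = h * 'D_v f (c *: v + q).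
Proof.
move=> sf h0 Ua.
pose g (a : R) := f (a *: v + q).
have gd a : 0 <= a <= h -> is_derive a 1 g ('D_v f (a *: v + q)).
  move=> ah; apply: is_derive_line; apply: derivableP.
  by apply: smooth_derivable sf _; exact: Ua.
have [||c ch E] := @MVT R g (fun a => 'D_v f (a *: v + q)) 0 h h0.
- by move=> a; rewrite in_itv /= => /andP[a0 ah]; apply: gd; rewrite !ltW.
- apply: derivable_within_continuous => a; rewrite in_itv /= => ah.
  by have [] := gd a ah.
- exists c; first by move: ch; rewrite in_itv.
  by move: E; rewrite /g scale0r add0r => ->; rewrite subr0 mulrC.
Qed.

Let second_difference (f : V -> R) p v w (h : R) :=
  f (h *: v + (h *: w + p)) - f (h *: v + p) - f (h *: w + p) + f p.

(** The mean value theorem is applied twice: along v to the increment of [f] over h w, then along w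
    to ['D_v f]. *)
Let second_differenceE (U : set V) (f : V -> R) p v w (h : R) : open U ->
  smooth U f -> 0 < h ->
  (forall a b, 0 <= a <= h -> 0 <= b <= h -> U (a *: v + (b *: w + p))) ->
  exists c d, [/\ 0 <= c <= h, 0 <= d <= h &
    second_difference f p v w h =
    h * (h * 'D_w ('D_v f) (c *: v + (d *: w + p)))].
Proof.
move=> oU sf h0 Uab.
pose U' := U `&` [set q | U (h *: w + q)].
have oU' : open U'.
  apply: openI => //; apply: (@open_comp _ _ (fun q => h *: w + q)) => //.
  by move=> q _; apply: cvgD; [exact: cvg_cst|exact: cvg_id].
pose f1 (q : V) := f (h *: w + q).
have growthE q u : (fun s : R => s^-1 *: ((f1 \o shift q) (s *: u) - f1 q)) =
    (fun s => s^-1 *: ((f \o shift (h *: w + q)) (s *: u) - f (h *: w + q))).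
  by apply/funext => s /=; rewrite /f1 addrCA.
have shiftE q u : 'D_u f1 q = 'D_u f (h *: w + q) by rewrite /derive growthE.
have df1 q u : U (h *: w + q) -> derivable f1 q u.
  by move=> Uq; rewrite /derivable growthE; exact: smooth_derivable sf Uq.
pose g (a : R) := f1 (a *: v + p) - f (a *: v + p).
have h00 : (0 : R) <= 0 <= h by rewrite lexx ltW.
have hh : 0 <= h <= h by rewrite lexx ltW.
have gd a : 0 <= a <= h ->
    is_derive a 1 g ('D_v f1 (a *: v + p) - 'D_v f (a *: v + p)).
  move=> ah; apply: is_deriveB; apply: is_derive_line; apply: derivableP.
    by apply: df1; rewrite addrCA; exact: Uab.
  by apply: smooth_derivable sf _; have := Uab a 0 ah h00; rewrite scale0r add0r.
have [||c ch E] := @MVT R g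
    (fun a => 'D_v f1 (a *: v + p) - 'D_v f (a *: v + p)) 0 h h0.
- by move=> a; rewrite in_itv /= => /andP[a0 ah]; apply: gd; rewrite !ltW.
- apply: derivable_within_continuous => a; rewrite in_itv /= => ah.
  by have [] := gd a ah.
have {}ch : 0 <= c <= h.
  by move: ch; rewrite in_itv /= => /andP[c0 c1]; rewrite !ltW.
have [||d dh Ed] := @MVT_line U ('D_v f) (c *: v + p) w h _ h0.
- exact: smooth_derive.
- by move=> a ah; rewrite addrCA; exact: Uab.
have {}dh : 0 <= d <= h by case/andP: dh => d0 d1; rewrite !ltW.
exists c, d; split => //.
rewrite [in RHS]addrCA -Ed -shiftE mulrC -[X in _ * X]subr0 -E /g /f1.
by rewrite /second_difference !scale0r !add0r addrCA; ring.
Qed.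

Let common_approx (x y z z' e : R) : z = z' -> `|x - z| < e / 2 ->
  `|y - z'| < e / 2 -> `|x - y| <= e.
Proof.
move=> ->; rewrite !ltr_norml ler_norml.
by move=> /andP[A1 A2] /andP[B1 B2]; apply/andP; split; lra.
Qed.

(** The second difference is symmetric in v and w, and it is h^2 times either mixed derivative at
    points as close to p as desired. Continuity of both mixed derivatives then forces equality at
    p. *)
Lemma derive_comm (U : set V) (f : V -> R) p v w : open U -> smooth U f ->
  U p -> 'D_v ('D_w f) p = 'D_w ('D_v f) p.
Proof.
move=> oU sf Up; apply/eqP; rewrite -subr_eq0 -normr_le0; apply/ler_addgt0Pl.
move=> e e0; rewrite addr0.
have e2 : 0 < e / 2 by rewrite divr_gt0.
have c1 : {for p, continuous ('D_v ('D_w f))}.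
  by apply: (@smooth_continuous _ _ _ U) => //; do 2!apply: smooth_derive.
have c2 : {for p, continuous ('D_w ('D_v f))}.
  by apply: (@smooth_continuous _ _ _ U) => //; do 2!apply: smooth_derive.
have near_p : \forall q \near p, U q /\
   (`|'D_v ('D_w f) p - 'D_v ('D_w f) q| < e / 2 /\
    `|'D_w ('D_v f) p - 'D_w ('D_v f) q| < e / 2).
  have nU : \forall q \near p, U q by exact: open_nbhs_nbhs.
  have /cvgrPdist_lt/(_ _ e2) n1 := c1.
  have /cvgrPdist_lt/(_ _ e2) n2 := c2.
  exact: (filterI nU (filterI n1 n2)).
have [h h0 hP] := @near_plane _ p v w near_p.
have hP' a b : 0 <= a <= h -> 0 <= b <= h -> U (a *: w + (b *: v + p)).
  by move=> ah bh; rewrite addrCA; have [] := hP b a bh ah.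
have [|c [d [ch dh Ecd]]] := @second_differenceE U f p v w h oU sf h0.
  by move=> a b ah bh; have [] := hP a b ah bh.
have [c' [d' [ch' dh' Ecd']]] := @second_differenceE U f p w v h oU sf h0 hP'.
have E : 'D_v ('D_w f) (d' *: v + (c' *: w + p)) =
    'D_w ('D_v f) (c *: v + (d *: w + p)).
  have hn0 : h != 0 by rewrite gt_eqF.
  have sdC : second_difference f p w v h = second_difference f p v w h.
    by rewrite /second_difference (addrCA (h *: w)); ring.
  apply: (mulfI hn0); apply: (mulfI hn0); rewrite (addrCA (d' *: v)).
  exact: (etrans (esym Ecd') (etrans sdC Ecd)).
have [_ [A _]] := hP _ _ dh' ch'; have [_ [_ B]] := hP _ _ ch dh.
exact: common_approx E A B.
Qed.

(** A derivative above k would stay above k near q, and the mean value theorem would contradict the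
    bound. Only s > 0 is tested, because the lemma also serves in the direction (0, -1), towards the
    past. *)
Lemma derive_le (U : set V) (f : V -> R) q v k (r : R) : open U -> smooth U f ->
  U q -> 0 < r -> (forall s, 0 < s < r -> f (s *: v + q) <= f q + k * s) ->
  'D_v f q <= k.
Proof.
move=> oU sf Uq r0 fk; rewrite leNgt; apply/negP => kD.
have cD : {for q, continuous ('D_v f)}.
  exact: smooth_continuous (smooth_derive v sf) Uq.
have nq : \forall x \near q, U x /\ k < 'D_v f x.
  have nU : \forall x \near q, U x by exact: open_nbhs_nbhs.
  have nD : \forall x \near q, k < 'D_v f x.
    by move/cvgr_gt: cD; apply.
  exact: (filterI nU nD).
have [h h0 hP] := near_line v nq.
pose m := Num.min h (r / 2).
have m0 : 0 < m by rewrite lt_min h0 divr_gt0.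
have mh : m <= h by rewrite ge_min lexx.
have mr : m < r by rewrite gt_min [X in _ || X](_ : _ = true) ?orbT//; lra.
have [|c /andP[c0 cm] E] := @MVT_line U f q v m sf m0.
  by move=> a /andP[a0 am]; have [] := hP a; rewrite ?a0 ?(le_trans am).
have [|_ kDc] := hP c; first by rewrite (ltW c0) (le_trans (ltW cm)).
have := fk m; rewrite m0 mr => /(_ isT); rewrite -lerBlDl E mulrC ler_pM2r//.
by rewrite leNgt kDc.
Qed.

(** The first derivative is at most 0 along both v and -v. Were the second one positive, the mean
    value theorem would make the first positive just after q, and [f] would exceed its maximum. *)
Lemma local_max_derive (U : set V) (f : V -> R) q v (r : R) : open U ->
  smooth U f -> U q -> 0 < r ->
  (forall s, `|s| < r -> f (s *: v + q) <= f q) ->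
  'D_v f q = 0 /\ 'D_v ('D_v f) q <= 0.
Proof.
move=> oU sf Uq r0 fmax.
have df := smooth_differentiable sf Uq.
have D1 : 'D_v f q <= 0.
  apply: (derive_le oU sf Uq r0) => s /andP[s0 sr].
  by rewrite mul0r addr0 fmax// gtr0_norm.
have D2 : 'D_(- v) f q <= 0.
  apply: (derive_le oU sf Uq r0) => s /andP[s0 sr].
  by rewrite mul0r addr0 scalerN -scaleNr fmax// normrN gtr0_norm.
have D0 : 'D_v f q = 0.
  apply/eqP; rewrite eq_le D1 /=; move: D2.
  by rewrite (deriveE _ df) linearN/= -deriveE// oppr_le0.
split=> //; rewrite leNgt; apply/negP => DD.
have sDf := smooth_derive v sf.
have cD : {for q, continuous ('D_v ('D_v f))}.
  exact: smooth_continuous (smooth_derive v sDf) Uq.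
have nq : \forall x \near q, U x /\ 0 < 'D_v ('D_v f) x.
  have nU : \forall x \near q, U x by exact: open_nbhs_nbhs.
  have nD : \forall x \near q, 0 < 'D_v ('D_v f) x.
    by move/cvgr_gt: cD; apply.
  exact: (filterI nU nD).
have [h h0 hP] := near_line v nq.
pose m := Num.min h (r / 2).
have m0 : 0 < m by rewrite lt_min h0 divr_gt0.
have mh : m <= h by rewrite ge_min lexx.
have mr : m < r by rewrite gt_min [X in _ || X](_ : _ = true) ?orbT//; lra.
have [|c /andP[c0 cm] E] := @MVT_line U f q v m sf m0.
  by move=> a /andP[a0 am]; have [] := hP a; rewrite ?a0 ?(le_trans am).
have [|c' /andP[c'0 c'c] E'] := @MVT_line U _ q v c sDf c0.
  by move=> a /andP[a0 ac]; have [] := hP a; rewrite ?a0 ?(le_trans ac)// (le_trans (ltW cm)).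
have [|_ DDc] := hP c'.
  by rewrite (ltW c'0) (le_trans (ltW c'c))// (le_trans (ltW cm)).
rewrite D0 subr0 in E'.
have := fmax m; rewrite gtr0_norm// => /(_ mr); rewrite -subr_le0 E E'.
by rewrite leNgt !mulr_gt0.
Qed.

End directional_derivatives.

(** * Linear maps, compositions, space and time slices, rays *)

Section smooth_maps.
Context {R : realType}.

Lemma linear_diff (V W : normedModType R) (f : V -> W) p : linear f ->
  continuous f -> differentiable f p /\ forall v, 'D_v f p = f v.
Proof.
move=> flin fc.
pose fM := GRing.isLinear.Build _ _ _ _ _ flin.
pose fL : {linear _ -> _} := HB.pack f fM.
have df : differentiable f p by exact: (@linear_differentiable _ _ _ fL).
split=> // v; rewrite deriveE//.
by have /(congr1 (fun g => g v)) := @diff_lin _ _ _ fL p fc.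
Qed.

Lemma smooth_linear (V W : normedModType R) (U : set V) (f : V -> W) :
  linear f -> continuous f -> smooth U f.
Proof.
move=> flin fc [|k]; first by move=> p _; exact: fc.
split=> [p _|v]; first by have [] := linear_diff p flin fc.
rewrite (_ : 'D_v f = cst (f v)); first exact: cst_Ck.
by apply/funext => p; have [_ ->] := linear_diff p flin fc.
Qed.

Lemma smooth_entry (V : normedModType R) n (U : set V) (F : V -> 'rV[R]_n) i :
  open U -> smooth U F -> smooth U (fun q => F q ord0 i).
Proof.
move=> oU sF k; have := sF k; elim: k F {sF} => [|k IH] F /=.
  move=> cF p Up; have c1 := cF p Up.
  exact: (@continuous_comp _ _ _ F (fun M : 'rV[R]_n => M ord0 i) p c1
    (@coord_continuous _ _ _ _ _ _)).
move=> [dF DF]; split=> [p Up|v].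
  exact: (@differentiable_comp _ _ _ _ F (fun M : 'rV[R]_n => M ord0 i) p (dF p Up)
    (differentiable_coord _ _ _)).
apply: eq_on_Ck (IH _ (DF v)) => // p Up.
by rewrite derive_mx ?mxE//; exact/diff_derivable/dF.
Qed.

(* Giving the inner map by its coordinates in a finite family of vectors turns
   the chain rule into scalar products, which the induction on [k] can use. *)
Lemma smooth_comp (V W : normedModType R) (U : set V) (U' : set W) (f : W -> R)
    n (c : 'I_n -> V -> R) (b : 'I_n -> W) (c0 : V -> R) (b0 : W) (g : V -> W) :
  open U -> open U' -> smooth U' f -> (forall i, smooth U (c i)) ->
  smooth U c0 -> g = (fun q => \sum_(i < n) c i q *: b i + c0 q *: b0) ->
  (forall q, U q -> U' (g q)) ->
  smooth U (f \o g).
Proof.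
move=> oU oU' sf sc sc0 gE gU.
have dg q : U q -> differentiable g q.
  move=> Uq; have -> : g = \sum_(i < n) (fun q => c i q *: b i) + (fun q => c0 q *: b0).
    by rewrite gE; apply/funext => x; rewrite !fctE fct_sumE.
  apply: differentiableD.
    apply: differentiable_sum => i; apply: differentiableZl.
    exact: smooth_differentiable (sc i) Uq.
  by apply: differentiableZl; exact: smooth_differentiable sc0 Uq.
have Dg q v : U q -> 'd g q v = \sum_(i < n) 'D_v (c i) q *: b i + 'D_v c0 q *: b0.
  move=> Uq; have -> : g = \sum_(i < n) (fun q => c i q *: b i) + (fun q => c0 q *: b0).
    by rewrite gE; apply/funext => x; rewrite !fctE fct_sumE.
  have dc i := smooth_differentiable (sc i) Uq.
  have dc0 := smooth_differentiable sc0 Uq.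
  rewrite -deriveE; last first.
    apply: differentiableD; last exact: differentiableZl.
    by apply: differentiable_sum => i; exact: differentiableZl.
  rewrite deriveD; last first.
  - by apply: diff_derivable; exact: differentiableZl.
  - by apply: diff_derivable; apply: differentiable_sum => i; exact: differentiableZl.
  rewrite derive_sum; last by move=> i; apply: diff_derivable; exact: differentiableZl.
  congr (_ + _).
    apply: eq_bigr => i _; rewrite deriveE; last exact: differentiableZl.
    by rewrite diffZl//= -deriveE.
  by rewrite deriveE; [rewrite diffZl//= -deriveE|exact: differentiableZl].
move=> k; elim: k f sf => [|k IH] f sf.
  move=> p Up; apply: differentiable_continuous; apply: differentiable_comp.
    exact: dg.
  exact: smooth_differentiable sf (gU _ Up).
split=> [p Up|v].
  by apply: differentiable_comp; [exact: dg|exact: smooth_differentiable sf (gU _ Up)].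
apply: (@eq_on_Ck _ _ _ _ _ (\sum_(i < n) (('D_(b i) f \o g) * 'D_v (c i)) +
    ('D_b0 f \o g) * 'D_v c0)) => //.
  move=> p Up; have df := smooth_differentiable sf (gU _ Up).
  rewrite [RHS]deriveE; last exact: differentiable_comp (dg _ Up) _.
  rewrite diff_comp//=; last exact: dg.
  rewrite Dg// linearD linear_sum/= linearZ/= -deriveE// !fctE fct_sumE.
  congr (_ + _); last by rewrite mulrC.
  by apply: eq_bigr => i _; rewrite linearZ/= -deriveE// mulrC.
have IHb b' : Ck k U ('D_b' f \o g) by apply: IH; exact: smooth_derive.
apply: add_Ck => //; last by apply: mul_Ck => //; exact: smooth_derive sc0 k.
elim/big_ind: _ => [|F G sF sG|i _]; first exact: (cst_Ck _ _ 0).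
  exact: add_Ck.
by apply: mul_Ck => //; exact: smooth_derive (sc i) k.
Qed.

Lemma open_preimage_on (V W : topologicalType) (A : set V) (B : set W)
    (g : V -> W) : open A -> open B -> (forall q, A q -> {for q, continuous g}) ->
  open (A `&` g @^-1` B).
Proof.
rewrite !openE => oA oB cg q [Aq Bq]; apply: filterI; first exact: oA.
by apply: (cg q Aq); exact: oB.
Qed.

Section slices.
Variables (V W : normedModType R) (f : V * R -> W).

Let space_growth (y w : V) t :
  (fun h : R => h^-1 *: ((f \o shift (y, t)) (h *: (w, 0)) - f (y, t))) =
  (fun h : R => h^-1 *: (((fun y => f (y, t)) \o shift y) (h *: w) - f (y, t))).
Proof.
apply/funext => h /=; congr (_ *: (f _ - _)).
by apply/pair_equal_spec; rewrite /= scaler0 add0r.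
Qed.

Lemma derive_space y t (w : V) :
  'D_(w, 0) f (y, t) = 'D_w (fun y => f (y, t)) y.
Proof. by rewrite /derive space_growth. Qed.

Lemma derivable_space y t (w : V) :
  derivable f (y, t) (w, 0) = derivable (fun y => f (y, t)) y w.
Proof. by rewrite /derivable space_growth. Qed.

Lemma derive_time y t : 'D_(0, 1) f (y, t) = 'D_1 (fun s => f (y, s)) t.
Proof.
rewrite /derive (_ : (fun h : R => _) =
  (fun h : R => h^-1 *: (((fun s => f (y, s)) \o shift t) (h *: 1) - f (y, t))))//.
apply/funext => h /=; congr (_ *: (f _ - _)).
by apply/pair_equal_spec; rewrite /= scaler0 add0r.
Qed.

End slices.

(** The two difference quotients are the same function of [h], so differentiability and derivative
    are transported together. This carries data from a point of the sphere along its ray. *)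
Lemma derive_scaled (V W : normedModType R) (f : V -> W) c v x :
  0 < c -> (forall y, f (c *: y) = f y) ->
  (derivable f (c *: x) (c *: v) = derivable f x v) /\
  'D_(c *: v) f (c *: x) = 'D_v f x.
Proof.
move=> c0 fc.
have E : (fun h : R => h^-1 *: ((f \o shift (c *: x)) (h *: (c *: v)) - f (c *: x))) =
    (fun h : R => h^-1 *: ((f \o shift x) (h *: v) - f x)).
  by apply/funext => h /=; rewrite scalerA mulrC -scalerA -scalerDr !fc.
by rewrite /derivable /derive E.
Qed.

Lemma derive_near_cst (V W : normedModType R) (f : V -> W) q v :
  (\forall h \near (0 : R), f (h *: v + q) = f q) -> 'D_v f q = 0.
Proof.
move=> fq; apply/lim_near_cst => //; apply: cvg_within.
by apply: filterS fq => h /= ->; rewrite subrr scaler0.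
Qed.

Lemma near_ray (V : normedModType R) (U : set V) q v : open U -> U q ->
  \forall h \near (0 : R), U (h *: v + q).
Proof.
move=> oU Uq.
have c : {for (0 : R), continuous (fun h : R => h *: v + q)}.
  have cs : {for (0 : R), continuous (fun h : R => h *: v)}.
    exact: scalel_continuous.
  by apply: cvgD; [exact: cs|exact: cvg_cst].
by apply: c; rewrite scale0r add0r; exact: open_nbhs_nbhs.
Qed.

End smooth_maps.

(** * Derivations and second-order jets *)

Section derivations.
Context {R : realType} {V : normedModType R}.
Variables (U : set V) (oU : open U).
Implicit Types (f g : V -> R) (D : (V -> R) -> V -> R).

(** Covers both directional derivatives and frame fields with variable coefficients. Functions are
    total but only their values on [U] count, hence the locality axiom. The rule for exp is not an
    algebraic consequence of the Leibniz rule and is listed; the rules for ln and for inverses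
    follow from it and from Leibniz respectively. *)
Record derivation D : Prop := Derivation {
  der_smooth : forall f, smooth U f -> smooth U (D f);
  der_eq_on : forall f g, (forall q, U q -> f q = g q) ->
    forall q, U q -> D f q = D g q;
  der_cst : forall c q, U q -> D (cst c) q = 0;
  der_add : forall f g q, smooth U f -> smooth U g -> U q ->
    D (f + g) q = D f q + D g q;
  der_mul : forall f g q, smooth U f -> smooth U g -> U q ->
    D (f * g) q = f q * D g q + g q * D f q;
  der_exp : forall f q, smooth U f -> U q ->
    D (expR \o f) q = expR (f q) * D f q }.

Lemma derive_derivation v : derivation (fun f => 'D_v f).
Proof.
split=> [f|f g fg q Uq|c q _|f g q sf sg Uq|f g q sf sg Uq|f q sf Uq].
- exact: smooth_derive.
- exact: eq_on_derive fg.
- exact: derive_cst.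
- by rewrite deriveD//; [exact: smooth_derivable sf Uq|exact: smooth_derivable sg Uq].
- by rewrite deriveM//; [exact: smooth_derivable sf Uq|exact: smooth_derivable sg Uq].
- by rewrite (derive_comp1 _ (is_derive_expR _))//; exact: smooth_differentiable sf Uq.
Qed.

Lemma derivationD D D' (c c' : V -> R) : derivation D -> derivation D' ->
  smooth U c -> smooth U c' ->
  derivation (fun f => c * D f + c' * D' f).
Proof.
move=> dD dD' sc sc'.
split=> [f sf|f g fg q Uq|a q Uq|f g q sf sg Uq|f g q sf sg Uq|f q sf Uq].
- by apply: smoothD => //; apply: smoothM => //; exact: der_smooth.
- by rewrite !fctE (der_eq_on dD fg)// (der_eq_on dD' fg).
- by rewrite !fctE (der_cst dD)// (der_cst dD')// !mulr0 addr0.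
- by rewrite !fctE (der_add dD)// (der_add dD')//; ring.
- by rewrite !fctE (der_mul dD)// (der_mul dD')//; ring.
- by rewrite !fctE (der_exp dD)// (der_exp dD')//=; ring.
Qed.

Section one_derivation.
Variables (D : (V -> R) -> V -> R) (dD : derivation D).

Lemma der_ln f q : smooth U f -> (forall p, U p -> 0 < f p) -> U q ->
  D (@ln R \o f) q = D f q / f q.
Proof.
move=> sf f0 Uq; have sl : smooth U (@ln R \o f) by exact: smooth_ln.
have f0q := f0 q Uq.
rewrite -(der_eq_on dD (f := expR \o (@ln R \o f)) (g := f))//; last first.
  by move=> p Up /=; rewrite lnK// posrE f0.
by rewrite (der_exp dD)//= lnK ?posrE// mulrAC mulfV ?mul1r// gt_eqF.
Qed.

Lemma der_inv f q : smooth U f -> (forall p, U p -> f p != 0) -> U q ->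
  D (fun p => (f p)^-1) q = - D f q / f q ^+ 2.
Proof.
move=> sf f0 Uq; have si := smoothV oU f0 sf.
have f0q := f0 q Uq.
have : D (f * (fun p => (f p)^-1)) q = 0.
  rewrite (der_eq_on dD (g := cst 1)) ?(der_cst dD)//.
  by move=> p Up; rewrite !fctE mulfV// f0.
rewrite (der_mul dD)// => /eqP; rewrite addr_eq0 => /eqP E.
by apply: (mulfI f0q); rewrite E; field.
Qed.

(** The 2-jet along one field, with its entries as arguments: the lemmas below then compute the jet
    of a long expression by mere application. *)
Definition jet q f (a b c : R) : Prop :=
  [/\ smooth U f, f q = a, D f q = b & D (D f) q = c].

Lemma jet_self q f : smooth U f -> jet q f (f q) (D f q) (D (D f) q).
Proof. by []. Qed.

Lemma jet_cst q c : U q -> jet q (cst c) c 0 0.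
Proof.
move=> Uq; split; [exact: smooth_cst|by []|exact: der_cst|].
rewrite (der_eq_on dD (g := cst 0)) ?(der_cst dD)//.
by move=> p Up; rewrite (der_cst dD).
Qed.

Lemma jetD q f g a b c a' b' c' : U q -> jet q f a b c -> jet q g a' b' c' ->
  jet q (f + g) (a + a') (b + b') (c + c').
Proof.
move=> Uq [sf <- <- <-] [sg <- <- <-]; split=> //; first exact: smoothD.
  by rewrite (der_add dD).
rewrite (der_eq_on dD (g := D f + D g))//.
  by rewrite (der_add dD)//; exact: der_smooth.
by move=> p Up; rewrite (der_add dD).
Qed.

Lemma jetM q f g a b c a' b' c' : U q -> jet q f a b c -> jet q g a' b' c' ->
  jet q (f * g) (a * a') (a * b' + a' * b) (a * c' + 2 * b * b' + a' * c).
Proof.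
move=> Uq [sf <- <- <-] [sg <- <- <-]; split=> //; first exact: smoothM.
  by rewrite (der_mul dD).
have [sDf sDg] := (der_smooth dD sf, der_smooth dD sg).
rewrite (der_eq_on dD (g := f * D g + g * D f))//.
  rewrite (der_add dD) ?(der_mul dD)//; try exact: smoothM.
  by ring.
by move=> p Up; rewrite (der_mul dD).
Qed.

Lemma jetN q f a b c : U q -> jet q f a b c -> jet q (- f) (- a) (- b) (- c).
Proof.
move=> Uq jf; have [sN aN bN cN] := jetM Uq (jet_cst (-1) Uq) jf.
have E : - f = cst (-1) * f by apply/funext => p; rewrite !fctE mulN1r.
by rewrite E; split=> //; rewrite ?aN ?bN ?cN; ring.
Qed.

Lemma jet_expR q f a b c : U q -> jet q f a b c ->
  jet q (expR \o f) (expR a) (expR a * b) (expR a * (c + b ^+ 2)).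
Proof.
move=> Uq [sf <- <- <-]; split=> //; first exact: smooth_expR.
  by rewrite (der_exp dD).
rewrite (der_eq_on dD (g := (expR \o f) * D f))//.
  rewrite (der_mul dD) ?(der_exp dD)//=;
    do ?[exact: smooth_expR|exact: der_smooth].
  by ring.
by move=> p Up; rewrite (der_exp dD).
Qed.

Lemma jet_ln q f a b c : (forall p, U p -> 0 < f p) -> U q -> jet q f a b c ->
  jet q (@ln R \o f) (ln a) (b / a) (c / a - (b / a) ^+ 2).
Proof.
move=> f0 Uq [sf <- <- <-]; split=> //; first exact: smooth_ln.
  by rewrite der_ln.
have fn0 p : U p -> f p != 0 by move=> Up; rewrite gt_eqF// f0.
have sDf := der_smooth dD sf; have si := smoothV oU fn0 sf.
rewrite (der_eq_on dD (g := D f * (fun p => (f p)^-1)))//.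
  by rewrite (der_mul dD)// der_inv//; field; exact: fn0.
by move=> p Up; rewrite der_ln.
Qed.

End one_derivation.

End derivations.

(** * The roundness in terms of the support function *)

Section support_pde.
Context {R : realType} {V : normedModType R}.
Variables (U : set V) (oU : open U) (beta : R).
Variables (p1 p2 : V -> R).

(* Write the normal as (p1, p2, 1) / sqrt mu and let sigma be the restriction of
   the 1-homogeneous support function to the plane of the (p1, p2, 1), with
   Hessian s11, s12, s22. Then r1 r2 = mu^2 det and (r1 + r2)^2 = mu tr^2, so
   that the roundness is exp(log_roundness), and the support function moves
   with speed - exp(log_speed). *)
Definition mu_fun : V -> R := cst 1 + p1 * p1 + p2 * p2.
Definition det_fun (s11 s12 s22 : V -> R) : V -> R := s11 * s22 + - (s12 * s12).
Definition tr_fun (s11 s12 s22 : V -> R) : V -> R :=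
  (cst 1 + p1 * p1) * s11 + cst 2 * p1 * p2 * s12 + (cst 1 + p2 * p2) * s22.
Definition gap_fun (s11 s12 s22 : V -> R) : V -> R :=
  tr_fun s11 s12 s22 * tr_fun s11 s12 s22 +
  - (cst 4 * mu_fun * det_fun s11 s12 s22).
Definition log_roundness (s11 s12 s22 : V -> R) : V -> R :=
  @ln R \o gap_fun s11 s12 s22 + cst (- 2 * beta) * (@ln R \o det_fun s11 s12 s22)
  + cst (1 - 4 * beta) * (@ln R \o mu_fun).
Definition log_speed (s11 s12 s22 : V -> R) : V -> R :=
  cst (- beta) * (@ln R \o det_fun s11 s12 s22) +
  cst (2^-1 - 2 * beta) * (@ln R \o mu_fun).

Lemma mu_funE q : mu_fun q = 1 + p1 q ^+ 2 + p2 q ^+ 2.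
Proof. by []. Qed.

Lemma det_funE s11 s12 s22 q :
  det_fun s11 s12 s22 q = s11 q * s22 q - s12 q * s12 q.
Proof. by []. Qed.

Lemma tr_funE s11 s12 s22 q : tr_fun s11 s12 s22 q =
  (1 + p1 q ^+ 2) * s11 q + 2 * p1 q * p2 q * s12 q + (1 + p2 q ^+ 2) * s22 q.
Proof. by []. Qed.

Lemma gap_funE s11 s12 s22 q : gap_fun s11 s12 s22 q =
  tr_fun s11 s12 s22 q ^+ 2 - 4 * mu_fun q * det_fun s11 s12 s22 q.
Proof. by []. Qed.

Lemma log_roundnessE s11 s12 s22 q : log_roundness s11 s12 s22 q =
  ln (gap_fun s11 s12 s22 q) - 2 * beta * ln (det_fun s11 s12 s22 q)
  + (1 - 4 * beta) * ln (mu_fun q).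
Proof. by rewrite -mulNr -mulrN mulrN -mulNr. Qed.

Lemma log_speedE s11 s12 s22 q : log_speed s11 s12 s22 q =
  - beta * ln (det_fun s11 s12 s22 q) + (2^-1 - 2 * beta) * ln (mu_fun q).
Proof. by []. Qed.

Lemma mu_fun_gt0 q : 0 < mu_fun q.
Proof.
rewrite /mu_fun !fctE; apply: ltr_wpDr; first by rewrite -expr2 sqr_ge0.
by rewrite ltr_wpDr// -expr2 sqr_ge0.
Qed.

Section jets.
Variables (D : (V -> R) -> V -> R) (dD : derivation U D).
Variables (s11 s12 s22 : V -> R).

Hypothesis gap0 : forall q, U q -> 0 < gap_fun s11 s12 s22 q.
Hypothesis det0 : forall q, U q -> 0 < det_fun s11 s12 s22 q.
Lemma jet_eq q f a b c a' b' c' : a = a' -> b = b' -> c = c' ->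
  jet U D q f a b c -> jet U D q f a' b' c'.
Proof. by move=> -> -> ->. Qed.

Variables (q : V) (a b e1 e2 e11 e22 x y z x' y' z' : R).
Hypotheses (Uq : U q) (j1 : jet U D q p1 0 e1 e11) (j2 : jet U D q p2 0 e2 e22).
Hypotheses (ja : jet U D q s11 a x x') (jb : jet U D q s12 0 y y')
  (jc : jet U D q s22 b z z').

Let jcst c : jet U D q (cst c) c 0 0 := jet_cst dD c Uq.

Let jet_mu : jet U D q mu_fun 1 0 (2 * e1 ^+ 2 + 2 * e2 ^+ 2).
Proof.
have J1 := jetM oU dD Uq j1 j1.
have J2 := jetM oU dD Uq j2 j2.
by apply: jet_eq (jetD oU dD Uq (jetD oU dD Uq (jcst 1) J1) J2); ring.
Qed.

Let jet_det : jet U D q (det_fun s11 s12 s22) (a * b) (a * z + b * x)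
  (a * z' + 2 * x * z + b * x' - 2 * y ^+ 2).
Proof.
apply: jet_eq (jetD oU dD Uq (jetM oU dD Uq ja jc)
  (jetN oU dD Uq (jetM oU dD Uq jb jb))); ring.
Qed.

Let jet_tr : jet U D q (tr_fun s11 s12 s22) (a + b) (x + z)
  (x' + z' + 2 * a * e1 ^+ 2 + 2 * b * e2 ^+ 2).
Proof.
have J1 := jetM oU dD Uq j1 j1.
have J2 := jetM oU dD Uq j2 j2.
apply: jet_eq (jetD oU dD Uq (jetD oU dD Uq
  (jetM oU dD Uq (jetD oU dD Uq (jcst 1) J1) ja)
  (jetM oU dD Uq (jetM oU dD Uq (jetM oU dD Uq (jcst 2) j1) j2) jb))
  (jetM oU dD Uq (jetD oU dD Uq (jcst 1) J2) jc)); ring.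
Qed.

Let jet_gap : jet U D q (gap_fun s11 s12 s22) ((a - b) ^+ 2)
  (2 * (a - b) * (x - z))
  (2 * (x - z) ^+ 2 + 8 * y ^+ 2 + 2 * (a - b) * (x' - z')
   + 4 * (a - b) * (a * e1 ^+ 2 - b * e2 ^+ 2)).
Proof.
apply: jet_eq (jetD oU dD Uq (jetM oU dD Uq jet_tr jet_tr) (jetN oU dD Uq
 (jetM oU dD Uq (jetM oU dD Uq (jcst 4) jet_mu) jet_det))); ring.
Qed.

(** The point q has p = 0 and Hessian diag(a, b). The rates e1, e2 of p1, p2 along D are left free,
    so that one computation serves the two space directions, with rates (1, 0) and (0, 1), and the
    time direction, with rates (0, 0). *)
Lemma jet_log_roundness : exists v, jet U D q (log_roundness s11 s12 s22) v
  (2 * (a - b) * (x - z) / (a - b) ^+ 2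
   - 2 * beta * ((a * z + b * x) / (a * b)))
  ((2 * (x - z) ^+ 2 + 8 * y ^+ 2 + 2 * (a - b) * (x' - z')
     + 4 * (a - b) * (a * e1 ^+ 2 - b * e2 ^+ 2)) / (a - b) ^+ 2
   - (2 * (a - b) * (x - z) / (a - b) ^+ 2) ^+ 2
   - 2 * beta * ((a * z' + 2 * x * z + b * x' - 2 * y ^+ 2) / (a * b)
                 - ((a * z + b * x) / (a * b)) ^+ 2)
   + (1 - 4 * beta) * (2 * e1 ^+ 2 + 2 * e2 ^+ 2)).
Proof.
have J := jetD oU dD Uq (jetD oU dD Uq (jet_ln oU dD gap0 Uq jet_gap)
   (jetM oU dD Uq (jcst (- 2 * beta)) (jet_ln oU dD det0 Uq jet_det)))
   (jetM oU dD Uq (jcst (1 - 4 * beta)) (jet_ln oU dD (fun p _ => mu_fun_gt0 p) Uq jet_mu)).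
eexists; apply: jet_eq J; first by [].
  by rewrite ?(mul0r, mulr0, divr1); ring.
by rewrite ?(mul0r, mulr0, divr1); ring.
Qed.

Lemma jet_log_speed : exists v, jet U D q (log_speed s11 s12 s22) v
  (- beta * ((a * z + b * x) / (a * b)))
  (- beta * ((a * z' + 2 * x * z + b * x' - 2 * y ^+ 2) / (a * b)
                 - ((a * z + b * x) / (a * b)) ^+ 2)
   + (1 - 4 * beta) * (e1 ^+ 2 + e2 ^+ 2)).
Proof.
have J := jetD oU dD Uq
   (jetM oU dD Uq (jcst (- beta)) (jet_ln oU dD det0 Uq jet_det))
   (jetM oU dD Uq (jcst (2^-1 - 2 * beta)) (jet_ln oU dD (fun p _ => mu_fun_gt0 p) Uq jet_mu)).
eexists; apply: jet_eq J; first by [].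
  by rewrite ?(mul0r, mulr0, divr1); ring.
rewrite ?(mul0r, mulr0, divr1).
by move: (_ / (a * b)) ((a * z + b * x) / (a * b)) => X Y; field.
Qed.

End jets.

Section smoothness.
Variables s11 s12 s22 : V -> R.
Hypotheses (sp1 : smooth U p1) (sp2 : smooth U p2)
  (ss11 : smooth U s11) (ss12 : smooth U s12) (ss22 : smooth U s22).
Let sc c : smooth U (cst c : V -> R). Proof. exact: smooth_cst. Qed.
Let sp11 := smoothM oU sp1 sp1.
Let sp22 := smoothM oU sp2 sp2.

Lemma smooth_mu : smooth U mu_fun.
Proof. by do 2?apply: smoothD. Qed.

Lemma smooth_det : smooth U (det_fun s11 s12 s22).
Proof.
by apply: smoothD => //; [|apply: smoothN => //]; exact: smoothM.
Qed.

Lemma smooth_tr : smooth U (tr_fun s11 s12 s22).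
Proof. by do ?[apply: smoothD => //|apply: smoothM => //]. Qed.

Lemma smooth_gap : smooth U (gap_fun s11 s12 s22).
Proof.
have [smu sdet str] := And3 smooth_mu smooth_det smooth_tr.
apply: smoothD => //; first exact: smoothM.
by apply: smoothN => //; do 2?apply: smoothM.
Qed.

Lemma smooth_log_roundness : (forall q, U q -> 0 < gap_fun s11 s12 s22 q) ->
  (forall q, U q -> 0 < det_fun s11 s12 s22 q) ->
  smooth U (log_roundness s11 s12 s22).
Proof.
move=> gap0 det0; have [smu sdet sgap] := And3 smooth_mu smooth_det smooth_gap.
have sl := smooth_ln oU (fun p _ => mu_fun_gt0 p) smu.
have [sld slg] := (smooth_ln oU det0 sdet, smooth_ln oU gap0 sgap).
by apply: smoothD => //; [apply: smoothD => //|]; exact: smoothM.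
Qed.

End smoothness.

End support_pde.

(* The form is quadratic in beta with leading coefficient 4 a b (a - b)^2, so it
   suffices that it is negative at beta = 1/2 and beta = 1. *)
Lemma gradient_form_le0 (R : realFieldType) (a b beta : R) : 0 < a -> 0 < b ->
  1 <= 2 * beta <= 2 ->
  2 * (a - b) * (a - beta * (a - b)) * (2 * a * b + beta * (a - b) ^+ 2)
  - (1 + beta) * a * (a - b) * (a + b) ^+ 2
  + 2 * beta ^+ 2 * (a - b) ^+ 2 * (a + b) ^+ 2
  - 4 * a * b * (a - beta * (a - b)) ^+ 2 <= 0.
Proof.
move=> a0 b0 /andP[b1 b2].
have -> : 2 * (a - b) * (a - beta * (a - b)) * (2 * a * b + beta * (a - b) ^+ 2)
  - (1 + beta) * a * (a - b) * (a + b) ^+ 2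
  + 2 * beta ^+ 2 * (a - b) ^+ 2 * (a + b) ^+ 2
  - 4 * a * b * (a - beta * (a - b)) ^+ 2 =
  - ((1 - beta) * (a * (a + b) ^+ 3) + (2 * beta - 1) * (4 * (a * b) ^+ 2)
  + a * b * (a - b) ^+ 2 * ((2 * beta - 1) * (2 - 2 * beta))) by field.
rewrite oppr_le0; apply: addr_ge0; first apply: addr_ge0.
- by apply: mulr_ge0; [lra|rewrite mulr_ge0 ?exprn_ge0 ?addr_ge0// ltW].
- by apply: mulr_ge0; [lra|rewrite mulr_ge0 ?sqr_ge0].
- apply: mulr_ge0; first by rewrite mulr_ge0 ?sqr_ge0// mulr_ge0 // ltW.
  by apply: mulr_ge0; lra.
Qed.

(** Clearing denominators, the critical equation is the single linear relation x b (a - beta (a -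
    b)) = z a (b + beta (a - b)), whose solutions form a line. The factor b + beta (a - b) = (1 -
    beta) b + beta a is positive for beta in [1/2, 1], so x determines the parameter t. *)
Lemma critical_third_derivatives (R : realFieldType) (a b beta x z : R) :
  0 < a -> 0 < b -> a != b -> 1 <= 2 * beta <= 2 ->
  2 * (a - b) * (x - z) / (a - b) ^+ 2
   - 2 * beta * ((a * z + b * x) / (a * b)) = 0 ->
  exists t, x = t * a * (b + beta * (a - b)) /\ z = t * b * (a - beta * (a - b)).
Proof.
move=> a0 b0 ab /andP[b1 b2] E.
have [an0 bn0] : a != 0 /\ b != 0 by rewrite !gt_eqF.
have ab0 : a - b != 0 by rewrite subr_eq0.
have m0 : 0 < b + beta * (a - b).
  rewrite (_ : _ + _ = (1 - beta) * b + beta * a); last by ring.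
  by apply: ltr_wpDl; [apply: mulr_ge0; lra|apply: mulr_gt0; lra].
have mn0 := lt0r_neq0 m0.
exists (x / (a * (b + beta * (a - b)))); split; first by field; rewrite an0 mn0.
have : x * b * (a - beta * (a - b)) - z * a * (b + beta * (a - b)) =
    (2 * (a - b) * (x - z) / (a - b) ^+ 2
   - 2 * beta * ((a * z + b * x) / (a * b))) * (a * b * (a - b)) / 2.
  by field; rewrite an0 bn0 ab0.
rewrite E !mul0r => /eqP; rewrite subr_eq0 => /eqP E'.
have -> : z = z * a * (b + beta * (a - b)) / (a * (b + beta * (a - b))).
  by field; rewrite an0 mn0.
by rewrite -E'; field; rewrite an0 mn0.
Qed.

(* The zeroth-order and fourth-order terms of the evolution equation cancel
   against beta (G11 / a + G22 / b), the linearization of the speed; what is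
   left is a quadratic form in the third derivatives, which
   [critical_third_derivatives] reduces to two free parameters. *)
Lemma roundness_rate_le0 (R : realFieldType) (a b beta x y z w s1 s2 s3 P : R) :
  0 < a -> 0 < b -> a != b -> 1 <= 2 * beta <= 2 -> 0 < P ->
  2 * (a - b) * (x - z) / (a - b) ^+ 2
   - 2 * beta * ((a * z + b * x) / (a * b)) = 0 ->
  2 * (a - b) * (y - w) / (a - b) ^+ 2
   - 2 * beta * ((a * w + b * y) / (a * b)) = 0 ->
  (2 * (x - z) ^+ 2 + 8 * y ^+ 2 + 2 * (a - b) * (s1 - s2)
     + 4 * (a - b) * (a * 1 ^+ 2 - b * 0 ^+ 2)) / (a - b) ^+ 2
   - (2 * (a - b) * (x - z) / (a - b) ^+ 2) ^+ 2
   - 2 * beta * ((a * s2 + 2 * x * z + b * s1 - 2 * y ^+ 2) / (a * b)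
                 - ((a * z + b * x) / (a * b)) ^+ 2)
   + (1 - 4 * beta) * (2 * 1 ^+ 2 + 2 * 0 ^+ 2) <= 0 ->
  (2 * (y - w) ^+ 2 + 8 * z ^+ 2 + 2 * (a - b) * (s2 - s3)
     + 4 * (a - b) * (a * 0 ^+ 2 - b * 1 ^+ 2)) / (a - b) ^+ 2
   - (2 * (a - b) * (y - w) / (a - b) ^+ 2) ^+ 2
   - 2 * beta * ((a * s3 + 2 * y * w + b * s2 - 2 * z ^+ 2) / (a * b)
                 - ((a * w + b * y) / (a * b)) ^+ 2)
   + (1 - 4 * beta) * (2 * 0 ^+ 2 + 2 * 1 ^+ 2) <= 0 ->
  let P11 := P *
   (- beta * ((a * s2 + 2 * x * z + b * s1 - 2 * y ^+ 2) / (a * b)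
                 - ((a * z + b * x) / (a * b)) ^+ 2)
   + (1 - 4 * beta) * (1 ^+ 2 + 0 ^+ 2)
   + (- beta * ((a * z + b * x) / (a * b))) ^+ 2) in
  let P22 := P *
   (- beta * ((a * s3 + 2 * y * w + b * s2 - 2 * z ^+ 2) / (a * b)
                 - ((a * w + b * y) / (a * b)) ^+ 2)
   + (1 - 4 * beta) * (0 ^+ 2 + 1 ^+ 2)
   + (- beta * ((a * w + b * y) / (a * b))) ^+ 2) in
  2 * (a - b) * (- P11 - - P22) / (a - b) ^+ 2
   - 2 * beta * ((a * (- P22) + b * (- P11)) / (a * b)) <= 0.
Proof.
move=> a0 b0 ab beta12 P0 G1 G2.
have [t [xE zE]] := critical_third_derivatives a0 b0 ab beta12 G1.
have [u [yE wE]] := critical_third_derivatives a0 b0 ab beta12 G2.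
set G11 := (X in X <= 0 -> _); set G22 := (X in _ -> X <= 0 -> _) => G11le G22le /=.
(* Coefficient of t^2; that of u^2 is obtained by exchanging a and b, and no mixed term t u
   occurs. *)
set N := fun a b : R =>
  2 * (a - b) * (a - beta * (a - b)) * (2 * a * b + beta * (a - b) ^+ 2)
  - (1 + beta) * a * (a - b) * (a + b) ^+ 2
  + 2 * beta ^+ 2 * (a - b) ^+ 2 * (a + b) ^+ 2
  - 4 * a * b * (a - beta * (a - b)) ^+ 2.
have N1 : N a b <= 0 by exact: gradient_form_le0.
have N2 : N b a <= 0 by exact: gradient_form_le0.
have [an0 bn0] : a != 0 /\ b != 0 by rewrite !gt_eqF.
have ab0 : a - b != 0 by rewrite subr_eq0.
set lhs := (X in X <= 0).
have -> : lhs = P * (beta * (G11 / a + G22 / b) +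
    2 * beta * t ^+ 2 * N a b / (a * (a - b) ^+ 2) +
    2 * beta * u ^+ 2 * N b a / (b * (a - b) ^+ 2)).
  rewrite /lhs /G11 /G22 /N xE zE yE wE; field.
  by rewrite an0 bn0 ab0.
have beta0 : 0 <= beta by move: beta12 => /andP[]; lra.
have d0 : 0 < (a - b) ^+ 2 by rewrite lt0r sqr_ge0 sqrf_eq0 ab0.
rewrite pmulr_rle0//.
have frac_le0 (r c n : R) : 0 <= c -> n <= 0 -> 0 < r -> c * n / r <= 0.
  by move=> c0 n0 r0; rewrite ler_pdivrMr// mul0r mulr_ge0_le0.
have c0 (v : R) : 0 <= 2 * beta * v ^+ 2 by rewrite mulr_ge0 ?sqr_ge0// mulr_ge0.
have := frac_le0 _ _ _ (c0 t) N1 (mulr_gt0 a0 d0).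
have := frac_le0 _ _ _ (c0 u) N2 (mulr_gt0 b0 d0).
have : beta * (G11 / a + G22 / b) <= 0.
  rewrite mulr_ge0_le0//; have := frac_le0 a 1 _ ler01 G11le a0.
  by have := frac_le0 b 1 _ ler01 G22le b0; rewrite !mul1r; lra.
by lra.
Qed.

(** * Evolution of the roundness in the coordinates (p1, p2, t) *)

Section support_flow.
Context {R : realType} {V : normedModType R}.
Variables (U : set V) (oU : open U) (beta : R) (p1 p2 sigma : V -> R).
Variables (D1 D2 Dt : (V -> R) -> V -> R).
Hypotheses (dD1 : derivation U D1) (dD2 : derivation U D2)
  (dDt : derivation U Dt).
Hypothesis comm12 : forall f q, smooth U f -> U q -> D1 (D2 f) q = D2 (D1 f) q.
Hypothesis commt1 : forall f q, smooth U f -> U q -> Dt (D1 f) q = D1 (Dt f) q.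
Hypothesis commt2 : forall f q, smooth U f -> U q -> Dt (D2 f) q = D2 (Dt f) q.
Hypotheses (sp1 : smooth U p1) (sp2 : smooth U p2) (ssigma : smooth U sigma).
Hypotheses (D1p1 : forall q, U q -> D1 p1 q = 1)
  (D1p2 : forall q, U q -> D1 p2 q = 0)
  (D2p1 : forall q, U q -> D2 p1 q = 0)
  (D2p2 : forall q, U q -> D2 p2 q = 1)
  (Dtp1 : forall q, U q -> Dt p1 q = 0)
  (Dtp2 : forall q, U q -> Dt p2 q = 0).

Let s11 := D1 (D1 sigma).
Let s12 := D1 (D2 sigma).
Let s22 := D2 (D2 sigma).
Hypothesis gap_gt0 : forall q, U q -> 0 < gap_fun p1 p2 s11 s12 s22 q.
Hypothesis det_gt0 : forall q, U q -> 0 < det_fun s11 s12 s22 q.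
Hypothesis flow : forall q, U q ->
  Dt sigma q = - expR (log_speed beta p1 p2 s11 s12 s22 q).
Let G := log_roundness beta p1 p2 s11 s12 s22.

Let der_const D f c q : derivation U D -> (forall q, U q -> f q = c) -> U q ->
  D f q = 0.
Proof.
by move=> dD fc Uq; rewrite (der_eq_on dD (g := cst c))// (der_cst dD).
Qed.

(** Commutation makes the derivatives of the Hessian totally symmetric: the third derivatives reduce
    to four numbers x, y, z, w, and D1 D1 s22 = D2 D2 s11 is shared by the two spatial second
    derivatives of [G]. Differentiating the flow twice gives the rates of s11 and s22 as minus
    second derivatives of exp(log_speed), after which [roundness_rate_le0] applies. *)
Lemma support_flow_max_point q : U q -> 1 <= 2 * beta <= 2 ->
  p1 q = 0 -> p2 q = 0 -> 0 < s11 q -> 0 < s22 q -> s12 q = 0 ->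
  s11 q != s22 q -> D1 G q = 0 -> D2 G q = 0 ->
  D1 (D1 G) q <= 0 -> D2 (D2 G) q <= 0 -> Dt G q <= 0.
Proof.
move=> Uq beta12 p1q p2q a0 b0 s12q ab G1 G2 G11 G22.
have sD1 := der_smooth dD1; have sD2 := der_smooth dD2.
have sDt := der_smooth dDt.
have ss11 : smooth U s11 := sD1 _ (sD1 _ ssigma).
have ss12 : smooth U s12 := sD1 _ (sD2 _ ssigma).
have ss22 : smooth U s22 := sD2 _ (sD2 _ ssigma).
have E2s11 r : U r -> D2 s11 r = D1 s12 r.
  move=> Ur; rewrite -comm12//; last exact: sD1.
  apply: (der_eq_on dD1) Ur => r' Ur'.
  by rewrite -comm12.
have E2s12 r : U r -> D2 s12 r = D1 s22 r.
  by move=> Ur; rewrite -comm12//; exact: sD2.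
have E22s11 : D2 (D2 s11) q = D1 (D1 s22) q.
  rewrite (der_eq_on dD2 E2s11)// -comm12//.
  exact: (der_eq_on dD1).
have j1p1 : jet U D1 q p1 0 1 0.
  by split=> //; [exact: D1p1|exact: der_const D1p1 _].
have j1p2 : jet U D1 q p2 0 0 0.
  by split=> //; [exact: D1p2|exact: der_const D1p2 _].
have j2p1 : jet U D2 q p1 0 0 0.
  by split=> //; [exact: D2p1|exact: der_const D2p1 _].
have j2p2 : jet U D2 q p2 0 1 0.
  by split=> //; [exact: D2p2|exact: der_const D2p2 _].
have jtp1 : jet U Dt q p1 0 0 0.
  by split=> //; [exact: Dtp1|exact: der_const Dtp1 _].
have jtp2 : jet U Dt q p2 0 0 0.
  by split=> //; [exact: Dtp2|exact: der_const Dtp2 _].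
have ja1 := jet_self D1 q ss11.
have jb1 : jet U D1 q s12 0 (D1 s12 q) (D1 (D1 s12) q) by [].
have jc1 := jet_self D1 q ss22.
have ja2 : jet U D2 q s11 (s11 q) (D1 s12 q) (D1 (D1 s22) q).
  by split=> //; exact: E2s11.
have jb2 : jet U D2 q s12 0 (D1 s22 q) (D2 (D2 s12) q).
  by split=> //; exact: E2s12.
have jc2 := jet_self D2 q ss22.
have [lv1 [slv _ dl1 ddl1]] :=
  jet_log_speed oU beta dD1 det_gt0 Uq j1p1 j1p2 ja1 jb1 jc1.
have [lv2 [_ _ dl2 ddl2]] :=
  jet_log_speed oU beta dD2 det_gt0 Uq j2p1 j2p2 ja2 jb2 jc2.
have [gv1 [_ _ dg1 ddg1]] :=
  jet_log_roundness oU beta dD1 gap_gt0 det_gt0 Uq j1p1 j1p2 ja1 jb1 jc1.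
have [gv2 [_ _ dg2 ddg2]] :=
  jet_log_roundness oU beta dD2 gap_gt0 det_gt0 Uq j2p1 j2p2 ja2 jb2 jc2.
pose L := log_speed beta p1 p2 s11 s12 s22.
have sexp : smooth U (expR \o L) by exact: smooth_expR.
have flow' D (dD : derivation U D) r : U r ->
    D (Dt sigma) r = - D (expR \o L) r.
  move=> Ur; rewrite (der_eq_on dD (g := cst (-1) * (expR \o L)))//.
    by rewrite (der_mul dD) ?(der_cst dD)//= ?mulr0 ?addr0 ?mulN1r//;
      exact: smooth_cst.
  by move=> r' Ur'; rewrite flow// !fctE/= mulN1r.
have flow'' D (dD : derivation U D) : D (D (Dt sigma)) q = - D (D (expR \o L)) q.
  have sDL := der_smooth dD sexp.
  rewrite (der_eq_on dD (g := cst (-1) * D (expR \o L)))//.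
    by rewrite (der_mul dD) ?(der_cst dD)//= ?mulr0 ?addr0 ?mulN1r//;
      exact: smooth_cst.
  by move=> r Ur; rewrite flow'// !fctE/= mulN1r.
have ts11 : Dt s11 q = - D1 (D1 (expR \o L)) q.
  rewrite commt1//; last exact: sD1.
  rewrite (der_eq_on dD1 (g := D1 (Dt sigma)))//; first exact: flow''.
  by move=> r Ur; exact: commt1.
have ts22 : Dt s22 q = - D2 (D2 (expR \o L)) q.
  rewrite commt2//; last exact: sD2.
  rewrite (der_eq_on dD2 (g := D2 (Dt sigma)))//; first exact: flow''.
  by move=> r Ur; exact: commt2.
have jL1 := jet_expR oU dD1 Uq (And4 slv erefl dl1 ddl1).
have jL2 := jet_expR oU dD2 Uq (And4 slv erefl dl2 ddl2).
have [_ _ _ ddL1] := jL1; have [_ _ _ ddL2] := jL2.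
(* Only the first-order part of these time jets is used; the rate of s12 drops out of it because s12
   vanishes at q. *)
have jta : jet U Dt q s11 (s11 q) (- D1 (D1 (expR \o L)) q) (Dt (Dt s11) q).
  by [].
have jtb : jet U Dt q s12 0 (Dt s12 q) (Dt (Dt s12) q) by [].
have jtc : jet U Dt q s22 (s22 q) (- D2 (D2 (expR \o L)) q) (Dt (Dt s22) q).
  by [].
have [gvt [_ _ dgt _]] :=
  jet_log_roundness oU beta dDt gap_gt0 det_gt0 Uq jtp1 jtp2 jta jtb jtc.
rewrite /G dgt ddL1 ddL2.
apply: (@roundness_rate_le0 R _ _ beta _ _ _ _ (D1 (D1 s11) q) (D1 (D1 s22) q)
  (D2 (D2 s22) q) (expR (L q)) a0 b0 ab beta12 (expR_gt0 _)).
- by rewrite -dg1.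
- by rewrite -dg2.
- by rewrite -ddg1.
- by rewrite -ddg2.
Qed.

End support_flow.

(** * The frame dual to the Gauss map coordinates *)

Section gauss_map_frame.
Context {R : realType} {V : normedModType R}.
Variables (U : set V) (oU : open U) (p1 p2 : V -> R).
Variables (dt d1 d2 : (V -> R) -> V -> R).
Hypotheses (ddt : derivation U dt) (dd1 : derivation U d1)
  (dd2 : derivation U d2).
Hypotheses
  (comm12 : forall f q, smooth U f -> U q -> d1 (d2 f) q = d2 (d1 f) q)
  (commt1 : forall f q, smooth U f -> U q -> dt (d1 f) q = d1 (dt f) q)
  (commt2 : forall f q, smooth U f -> U q -> dt (d2 f) q = d2 (dt f) q).

(** The coefficient of [dt] is a constant and thus never gets differentiated. The factor [cst 1]
    gives the sum the shape of [derivationD]. *)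
Definition frame_field (c0 : R) (c1 c2 : V -> R) (f : V -> R) : V -> R :=
  cst c0 * dt f + cst 1 * (c1 * d1 f + c2 * d2 f).

Lemma frame_fieldE c0 c1 c2 f q : frame_field c0 c1 c2 f q =
  c0 * dt f q + (c1 q * d1 f q + c2 q * d2 f q).
Proof. by rewrite /frame_field !fctE mul1r. Qed.

Lemma frame_field_derivation c0 c1 c2 : smooth U c1 -> smooth U c2 ->
  derivation U (frame_field c0 c1 c2).
Proof.
move=> s1 s2; apply: (@derivationD _ _ _ oU dt
  (fun f => c1 * d1 f + c2 * d2 f)); do ?exact: smooth_cst.
  by [].
exact: (@derivationD _ _ _ oU d1 d2).
Qed.

Let frame_field_comp c0 c1 c2 c0' c1' c2' f q : smooth U c1 -> smooth U c2 ->
  smooth U c1' -> smooth U c2' -> smooth U f -> U q ->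
  let D := frame_field c0 c1 c2 in
  D (frame_field c0' c1' c2' f) q =
  c0' * (c0 * dt (dt f) q +
         (c1 q * d1 (dt f) q + c2 q * d2 (dt f) q))
  + c1' q * (c0 * dt (d1 f) q +
         (c1 q * d1 (d1 f) q + c2 q * d2 (d1 f) q))
  + c2' q * (c0 * dt (d2 f) q +
         (c1 q * d1 (d2 f) q + c2 q * d2 (d2 f) q))
  + (D c1' q * d1 f q + D c2' q * d2 f q).
Proof.
move=> s1 s2 s1' s2' sf Uq D.
have dD := frame_field_derivation c0 s1 s2; rewrite -/D in dD.
have st := der_smooth ddt sf.
have sf1 := der_smooth dd1 sf; have sf2 := der_smooth dd2 sf.
have sc0 c : smooth U (cst c : V -> R) by exact: smooth_cst.
have sm1 := smoothM oU s1' sf1; have sm2 := smoothM oU s2' sf2.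
have sm := smoothD oU sm1 sm2.
have -> : D (frame_field c0' c1' c2' f) q =
    c0' * D (dt f) q + c1' q * D (d1 f) q + c2' q * D (d2 f) q
    + (D c1' q * d1 f q + D c2' q * d2 f q).
  rewrite (der_add dD (smoothM oU (sc0 c0') st) (smoothM oU (sc0 1) sm) Uq).
  rewrite (der_mul dD (sc0 c0') st Uq) (der_mul dD (sc0 1) sm Uq).
  rewrite (der_add dD sm1 sm2 Uq).
  rewrite (der_mul dD s1' sf1 Uq) (der_mul dD s2' sf2 Uq) !(der_cst dD)//=.
  move: (D (dt f) q) (D (d1 f) q) (D (d2 f) q) (D c1' q) (D c2' q).
  move: (d1 f q) (d2 f q) (dt f q) ((c1' * d1 f + c2' * d2 f) q).
  by move=> *; ring.
have E g : D g q = c0 * dt g q + (c1 q * d1 g q + c2 q * d2 g q).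
  exact: frame_fieldE.
by rewrite (E (dt f)) (E (d1 f)) (E (d2 f)).
Qed.

Definition jacobian_fun : V -> R := d1 p1 * d2 p2 + - (d1 p2 * d2 p1).
Hypotheses (sp1 : smooth U p1) (sp2 : smooth U p2)
  (jac0 : forall q, U q -> jacobian_fun q != 0).

Let bracket_identity (c0 c1 c2 c0' c1' c2' h1 h2 h1' h2' g1 g2 gtt g11 g22
    g12 g21 gt1 g1t gt2 g2t : R) : g12 = g21 -> gt1 = g1t -> gt2 = g2t ->
  c0' * (c0 * gtt + (c1 * g1t + c2 * g2t))
  + c1' * (c0 * gt1 + (c1 * g11 + c2 * g21))
  + c2' * (c0 * gt2 + (c1 * g12 + c2 * g22)) + (h1 * g1 + h2 * g2) -
  (c0 * (c0' * gtt + (c1' * g1t + c2' * g2t))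
  + c1 * (c0' * gt1 + (c1' * g11 + c2' * g21))
  + c2 * (c0' * gt2 + (c1' * g12 + c2' * g22)) + (h1' * g1 + h2' * g2)) =
  (h1 - h1') * g1 + (h2 - h2') * g2.
Proof. by move=> -> -> ->; ring. Qed.

(* Two fields on which (p1, p2) have constant rates commute: their bracket has
   no [dt] component and kills the coordinates p1, p2. *)
Lemma frame_field_comm c0 c1 c2 c0' c1' c2' k1 k2 k1' k2' f q :
  smooth U c1 -> smooth U c2 -> smooth U c1' -> smooth U c2' ->
  (forall q, U q -> frame_field c0 c1 c2 p1 q = k1) ->
  (forall q, U q -> frame_field c0 c1 c2 p2 q = k2) ->
  (forall q, U q -> frame_field c0' c1' c2' p1 q = k1') ->
  (forall q, U q -> frame_field c0' c1' c2' p2 q = k2') ->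
  smooth U f -> U q ->
  frame_field c0 c1 c2 (frame_field c0' c1' c2' f) q =
  frame_field c0' c1' c2' (frame_field c0 c1 c2 f) q.
Proof.
move=> s1 s2 s1' s2' E1 E2 E1' E2' sf Uq.
set D := frame_field c0 c1 c2; set D' := frame_field c0' c1' c2'.
have dD := frame_field_derivation c0 s1 s2; rewrite -/D in dD.
have dD' := frame_field_derivation c0' s1' s2'; rewrite -/D' in dD'.
have bracketE g : smooth U g -> D (D' g) q - D' (D g) q =
    (D c1' q - D' c1 q) * d1 g q + (D c2' q - D' c2 q) * d2 g q.
  move=> sg; rewrite /D /D' !frame_field_comp// -/D -/D'.
  have C12 := comm12 sg Uq.
  have Ct1 := commt1 sg Uq.
  have Ct2 := commt2 sg Uq.
  exact: (bracket_identity c0 (c1 q) (c2 q) c0' (c1' q) (c2' q) (D c1' q)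
    (D c2' q) (D' c1 q) (D' c2 q) (d1 g q) (d2 g q) (dt (dt g) q)
    (d1 (d1 g) q) (d2 (d2 g) q) C12 Ct1 Ct2).
have zero g k k' : smooth U g -> (forall q, U q -> D g q = k) ->
    (forall q, U q -> D' g q = k') ->
    (D c1' q - D' c1 q) * d1 g q + (D c2' q - D' c2 q) * d2 g q = 0.
  move=> sg Dg D'g; rewrite -bracketE//.
  rewrite (der_eq_on dD (g := cst k'))// (der_eq_on dD' (g := cst k))//.
  by rewrite (der_cst dD)// (der_cst dD')// subrr.
have Z1 := zero _ _ _ sp1 E1 E1'; have Z2 := zero _ _ _ sp2 E2 E2'.
have := jac0 Uq; have := bracketE f sf; rewrite /jacobian_fun !fctE.
move: Z1 Z2; move: (D c1' q - D' c1 q) (D c2' q - D' c2 q) => A B.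
move: (d1 p1 q) (d2 p1 q) (d1 p2 q) (d2 p2 q) => a b c d Z1 Z2 BE J0.
(* The pair (A, B) is in the kernel of the Jacobian matrix of (p1, p2), so Cramer's rule kills
   it. *)
have A0 : A = 0.
  apply: (mulIf J0); rewrite mul0r.
  rewrite (_ : A * _ = (A * a + B * b) * d - (A * c + B * d) * b); last by ring.
  by rewrite Z1 Z2 !mul0r subrr.
have B0 : B = 0.
  apply: (mulIf J0); rewrite mul0r.
  rewrite (_ : B * _ = (A * c + B * d) * a - (A * a + B * b) * c); last by ring.
  by rewrite Z1 Z2 !mul0r subrr.
by apply/eqP; rewrite -subr_eq0 BE A0 B0 !mul0r addr0.
Qed.

Lemma jacobian_funE q :
  jacobian_fun q = d1 p1 q * d2 p2 q - d1 p2 q * d2 p1 q.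
Proof. by []. Qed.

Lemma smooth_jacobian : smooth U jacobian_fun.
Proof.
by apply: smoothD => //; [|apply: smoothN => //]; apply: smoothM => //;
  exact: der_smooth.
Qed.

(* The partial derivatives in the coordinates (p1, p2, t), obtained without
   inverting the Gauss map. *)
Definition inv_jacobian : V -> R := fun q => (jacobian_fun q)^-1.
Definition frame1 : (V -> R) -> V -> R :=
  frame_field 0 (d2 p2 * inv_jacobian) (- (d1 p2 * inv_jacobian)).
Definition frame2 : (V -> R) -> V -> R :=
  frame_field 0 (- (d2 p1 * inv_jacobian)) (d1 p1 * inv_jacobian).
Definition framet : (V -> R) -> V -> R :=
  frame_field 1
    ((dt p2 * d2 p1 + - (dt p1 * d2 p2)) * inv_jacobian)
    ((dt p1 * d1 p2 + - (dt p2 * d1 p1)) * inv_jacobian).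

Lemma frame1E f q : frame1 f q =
  (d2 p2 q * d1 f q - d1 p2 q * d2 f q) / jacobian_fun q.
Proof.
by rewrite /frame1 frame_fieldE !fctE /inv_jacobian; ring.
Qed.

Lemma frame2E f q : frame2 f q =
  (d1 p1 q * d2 f q - d2 p1 q * d1 f q) / jacobian_fun q.
Proof.
by rewrite /frame2 frame_fieldE !fctE /inv_jacobian; ring.
Qed.

(** Subtracting the motion of the slopes turns the time derivative at a fixed label into the one at
    a fixed normal direction. *)
Lemma frametE f q : framet f q =
  dt f q - dt p1 q * frame1 f q - dt p2 q * frame2 f q.
Proof.
rewrite /framet frame_fieldE frame1E frame2E !fctE /inv_jacobian.
by ring.
Qed.

Lemma frame_expansion f q : U q ->
  d1 f q = d1 p1 q * frame1 f q + d1 p2 q * frame2 f q /\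
  d2 f q = d2 p1 q * frame1 f q + d2 p2 q * frame2 f q.
Proof.
move=> /jac0; rewrite !frame1E !frame2E /jacobian_fun !fctE.
move: (d1 p1 q) (d2 p1 q) (d1 p2 q) (d2 p2 q) => a b c d J0.
by split; field.
Qed.

Lemma frame_coordinates q : U q ->
  [/\ frame1 p1 q = 1, frame1 p2 q = 0, frame2 p1 q = 0 & frame2 p2 q = 1].
Proof.
move=> /jac0; rewrite !frame1E !frame2E /jacobian_fun !fctE.
move: (d1 p1 q) (d2 p1 q) (d1 p2 q) (d2 p2 q) => a b c d J0.
by split; field.
Qed.

Lemma framet_coordinates q : U q -> framet p1 q = 0 /\ framet p2 q = 0.
Proof.
move=> Uq; have [E11 E12 E21 E22] := frame_coordinates Uq.
by rewrite !frametE// E11 E12 E21 E22; split; ring.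
Qed.

Let sinv : smooth U inv_jacobian.
Proof. by apply: smoothV => //; exact: smooth_jacobian. Qed.

Let sd D p : derivation U D -> smooth U p -> smooth U (D p * inv_jacobian).
Proof. by move=> dD sp; apply: smoothM => //; exact: der_smooth. Qed.

Let sdd D D' p p' : derivation U D -> derivation U D' -> smooth U p ->
  smooth U p' -> smooth U (D p * D' p').
Proof. by move=> *; apply: smoothM => //; exact: der_smooth. Qed.

Let s1 : smooth U (- (d1 p2 * inv_jacobian)).
Proof. by apply: smoothN => //; exact: sd. Qed.
Let s2 : smooth U (- (d2 p1 * inv_jacobian)).
Proof. by apply: smoothN => //; exact: sd. Qed.
Let st1 : smooth U ((dt p2 * d2 p1 + - (dt p1 * d2 p2)) * inv_jacobian).
Proof.
by apply: smoothM => //; apply: smoothD => //; [|apply: smoothN => //]; exact: sdd.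
Qed.
Let st2 : smooth U ((dt p1 * d1 p2 + - (dt p2 * d1 p1)) * inv_jacobian).
Proof.
by apply: smoothM => //; apply: smoothD => //; [|apply: smoothN => //]; exact: sdd.
Qed.

Lemma frame1_derivation : derivation U frame1.
Proof. by apply: frame_field_derivation => //; exact: sd. Qed.

Lemma frame2_derivation : derivation U frame2.
Proof. by apply: frame_field_derivation => //; exact: sd. Qed.

Lemma framet_derivation : derivation U framet.
Proof. exact: frame_field_derivation. Qed.

Lemma frame12_comm f q : smooth U f -> U q ->
  frame1 (frame2 f) q = frame2 (frame1 f) q.
Proof.
move=> sf Uq; apply: (@frame_field_comm _ _ _ _ _ _ 1 0 0 1) => //;
  by [exact: sd|move=> r /frame_coordinates[]].
Qed.

Lemma framet1_comm f q : smooth U f -> U q ->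
  framet (frame1 f) q = frame1 (framet f) q.
Proof.
move=> sf Uq; apply: (@frame_field_comm _ _ _ _ _ _ 0 0 1 0) => //;
  by [exact: sd|move=> r /frame_coordinates[]|move=> r /framet_coordinates[]].
Qed.

Lemma framet2_comm f q : smooth U f -> U q ->
  framet (frame2 f) q = frame2 (framet f) q.
Proof.
move=> sf Uq; apply: (@frame_field_comm _ _ _ _ _ _ 0 0 0 1) => //;
  by [exact: sd|move=> r /frame_coordinates[]|move=> r /framet_coordinates[]].
Qed.

End gauss_map_frame.

(** * The support function of the parametrized surface *)

Section parametrized_flow.
Context {R : realType} {V : normedModType R}.
Variables (U : set V) (oU : open U) (beta : R) (p1 p2 Y1 Y2 Y3 : V -> R).
Variables (dt d1 d2 : (V -> R) -> V -> R).
Hypotheses (ddt : derivation U dt) (dd1 : derivation U d1)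
  (dd2 : derivation U d2).
Hypotheses
  (comm12 : forall f q, smooth U f -> U q -> d1 (d2 f) q = d2 (d1 f) q)
  (commt1 : forall f q, smooth U f -> U q -> dt (d1 f) q = d1 (dt f) q)
  (commt2 : forall f q, smooth U f -> U q -> dt (d2 f) q = d2 (dt f) q).
Hypotheses (sp1 : smooth U p1) (sp2 : smooth U p2)
  (sY1 : smooth U Y1) (sY2 : smooth U Y2) (sY3 : smooth U Y3)
  (jac0 : forall q, U q -> jacobian_fun p1 p2 d1 d2 q != 0).
Hypotheses
  (tan1 : forall q, U q -> p1 q * d1 Y1 q + p2 q * d1 Y2 q + d1 Y3 q = 0)
  (tan2 : forall q, U q -> p1 q * d2 Y1 q + p2 q * d2 Y2 q + d2 Y3 q = 0).

Let D1 := frame1 p1 p2 dt d1 d2.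
Let D2 := frame2 p1 p2 dt d1 d2.
Let Dt := framet p1 p2 dt d1 d2.
Let dD1 : derivation U D1 := frame1_derivation oU ddt dd1 dd2 sp1 sp2 jac0.
Let dD2 : derivation U D2 := frame2_derivation oU ddt dd1 dd2 sp1 sp2 jac0.
Let dDt : derivation U Dt := framet_derivation oU ddt dd1 dd2 sp1 sp2 jac0.

(* The support function restricted to the plane of normals (p1, p2, 1). *)
Let sigma : V -> R := p1 * Y1 + p2 * Y2 + Y3.

Let ssigma : smooth U sigma.
Proof. by apply: smoothD => //; apply: smoothD => //; exact: smoothM. Qed.

Let der_sigma D q : derivation U D -> U q -> D sigma q =
  Y1 q * D p1 q + Y2 q * D p2 q + (p1 q * D Y1 q + p2 q * D Y2 q + D Y3 q).
Proof.
move=> dD Uq; rewrite /sigma (der_add dD)//; last first.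
  by apply: smoothD => //; exact: smoothM.
rewrite (der_add dD); do ?exact: smoothM; last by [].
by rewrite (der_mul dD)// (der_mul dD)//; ring.
Qed.

Let tangent_frame q : U q ->
  p1 q * D1 Y1 q + p2 q * D1 Y2 q + D1 Y3 q = 0 /\
  p1 q * D2 Y1 q + p2 q * D2 Y2 q + D2 Y3 q = 0.
Proof.
move=> Uq; rewrite /D1 /D2 !frame1E !frame2E; split.
  transitivity ((d2 p2 q * (p1 q * d1 Y1 q + p2 q * d1 Y2 q + d1 Y3 q)
    - d1 p2 q * (p1 q * d2 Y1 q + p2 q * d2 Y2 q + d2 Y3 q))
    / jacobian_fun p1 p2 d1 d2 q); first by ring.
  by rewrite tan1// tan2//; ring.
transitivity ((d1 p1 q * (p1 q * d2 Y1 q + p2 q * d2 Y2 q + d2 Y3 q)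
    - d2 p1 q * (p1 q * d1 Y1 q + p2 q * d1 Y2 q + d1 Y3 q))
    / jacobian_fun p1 p2 d1 d2 q); first by ring.
by rewrite tan1// tan2//; ring.
Qed.

(** The position is the gradient of the support function: the derivative of Y is tangent, hence
    orthogonal to (p1, p2, 1), and only the derivative of the slopes remains. *)
Let D1sigma q : U q -> D1 sigma q = Y1 q.
Proof.
move=> Uq; have [E11 E12 _ _] := frame_coordinates dt jac0 Uq.
rewrite (der_sigma dD1)// (tangent_frame Uq).1.
by rewrite /D1 E11 E12; ring.
Qed.

Let D2sigma q : U q -> D2 sigma q = Y2 q.
Proof.
move=> Uq; have [_ _ E21 E22] := frame_coordinates dt jac0 Uq.
rewrite (der_sigma dD2)// (tangent_frame Uq).2.
by rewrite /D2 E21 E22; ring.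
Qed.

(** At a fixed normal the support function moves with the normal velocity: the correction in
    [framet] displaces the point tangentially, which (p1, p2, 1) does not see. *)
Let Dtsigma q : U q ->
  Dt sigma q = p1 q * dt Y1 q + p2 q * dt Y2 q + dt Y3 q.
Proof.
move=> Uq; have [E1 E2] := framet_coordinates dt jac0 Uq.
rewrite (der_sigma dDt)// /Dt E1 E2 !frametE//.
have [T1 T2] := tangent_frame Uq.
rewrite !mulr0 !add0r -[RHS]subr0.
rewrite (_ : 0 = dt p1 q * (p1 q * D1 Y1 q + p2 q * D1 Y2 q + D1 Y3 q) +
  dt p2 q * (p1 q * D2 Y1 q + p2 q * D2 Y2 q + D2 Y3 q)); last by rewrite T1 T2 !mulr0 addr0.
by rewrite /D1 /D2; ring.
Qed.

Let s11 := D1 Y1.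
Let s12 := D1 Y2.
Let s22 := D2 Y2.

Lemma frame_hessian_sym q : U q -> frame2 p1 p2 dt d1 d2 Y1 q = s12 q.
Proof.
move=> Uq; rewrite -/D2 /s12 -(der_eq_on dD2 D1sigma)//.
rewrite -(der_eq_on dD1 D2sigma)//.
by apply/esym; apply: (@frame12_comm _ _ U).
Qed.

(** The evolution lemma speaks of second derivatives of [sigma], the geometry of first derivatives
    of the position. They agree only on [U], so the conclusions have to be transferred. *)
Let F11 := D1 (D1 sigma).
Let F12 := D1 (D2 sigma).
Let F22 := D2 (D2 sigma).
Let F11E q : U q -> F11 q = s11 q. Proof. exact: (der_eq_on dD1 D1sigma). Qed.
Let F12E q : U q -> F12 q = s12 q. Proof. exact: (der_eq_on dD1 D2sigma). Qed.
Let F22E q : U q -> F22 q = s22 q. Proof. exact: (der_eq_on dD2 D2sigma). Qed.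

Hypothesis gap_gt0 : forall q, U q -> 0 < gap_fun p1 p2 s11 s12 s22 q.
Hypothesis det_gt0 : forall q, U q -> 0 < det_fun s11 s12 s22 q.
Hypothesis flow : forall q, U q -> p1 q * dt Y1 q + p2 q * dt Y2 q + dt Y3 q =
  - expR (log_speed beta p1 p2 s11 s12 s22 q).
Let G := log_roundness beta p1 p2 s11 s12 s22.
Let G' := log_roundness beta p1 p2 F11 F12 F22.

Let detE q : U q -> det_fun F11 F12 F22 q = det_fun s11 s12 s22 q.
Proof. by move=> Uq; rewrite /det_fun !fctE F11E// F12E// F22E. Qed.
Let gapE q : U q -> gap_fun p1 p2 F11 F12 F22 q = gap_fun p1 p2 s11 s12 s22 q.
Proof.
by move=> Uq; rewrite /gap_fun /tr_fun /det_fun !fctE F11E// F12E// F22E.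
Qed.
Let GE q : U q -> G q = G' q.
Proof.
by move=> Uq; rewrite /G /G' /log_roundness !fctE /= gapE// detE.
Qed.

Let ss11 : smooth U s11. Proof. exact: (der_smooth dD1). Qed.
Let ss12 : smooth U s12. Proof. exact: (der_smooth dD1). Qed.
Let ss22 : smooth U s22. Proof. exact: (der_smooth dD2). Qed.

Let sG : smooth U G. Proof. exact: smooth_log_roundness. Qed.

(** At a critical point of [G] the derivatives of the frame coefficients multiply d1 G = d2 G = 0
    and disappear. Since moreover d1 p2 = d2 p1 = 0 at q, the frame is diagonal there: D1 D1 G and
    D2 D2 G are squares times d1 d1 G and d2 d2 G, and Dt G = dt G. *)
Lemma parametrized_flow_max_point q : U q -> 1 <= 2 * beta <= 2 ->
  p1 q = 0 -> p2 q = 0 -> d1 p2 q = 0 -> d2 p1 q = 0 ->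
  0 < s11 q -> 0 < s22 q -> s12 q = 0 -> s11 q != s22 q ->
  d1 G q = 0 -> d2 G q = 0 -> d1 (d1 G) q <= 0 -> d2 (d2 G) q <= 0 ->
  dt G q <= 0.
Proof.
move=> Uq beta12 p1q p2q d1p2 d2p1 a0 b0 s12q ab G1 G2 G11 G22.
have J0 := jac0 Uq.
have D1G : D1 G q = 0 by rewrite /D1 frame1E G1 G2 !mulr0 subrr mul0r.
have D2G : D2 G q = 0 by rewrite /D2 frame2E G1 G2 !mulr0 subrr mul0r.
have DtG : Dt G q = dt G q.
  by rewrite /Dt frametE// -/D1 -/D2 D1G D2G !mulr0 !subr0.
have sJ := smooth_jacobian oU dd1 dd2 sp1 sp2.
have si := smoothV oU jac0 sJ.
have sD d f : derivation U d -> smooth U f -> smooth U (d f).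
  by move=> dd; exact: der_smooth.
pose J := jacobian_fun p1 p2 d1 d2.
have D11G : D1 (D1 G) q = (d2 p2 q / J q) ^+ 2 * d1 (d1 G) q.
  rewrite {1}/D1 frame1E d1p2 mul0r subr0.
  pose c1 := d2 p2 * (fun q => (J q)^-1); pose c2 := - (d1 p2 * (fun q => (J q)^-1)).
  have sc1 : smooth U c1 by apply: smoothM => //; exact: sD.
  have sc2 : smooth U c2 by apply: smoothN => //; apply: smoothM => //; exact: sD.
  rewrite (der_eq_on dd1 (g := c1 * d1 G + c2 * d2 G))//; last first.
    by move=> r Ur; rewrite /D1 frame1E /c1 /c2 !fctE; ring.
  have [sdG1 sdG2] := (sD _ _ dd1 sG, sD _ _ dd2 sG).
  rewrite (der_add dd1); do ?exact: smoothM; last by [].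
  rewrite (der_mul dd1 sc1 sdG1 Uq) (der_mul dd1 sc2 sdG2 Uq) G1 G2 /c1 /c2 !fctE d1p2.
  by ring.
have D22G : D2 (D2 G) q = (d1 p1 q / J q) ^+ 2 * d2 (d2 G) q.
  rewrite {1}/D2 frame2E d2p1 mul0r subr0.
  pose c1 := - (d2 p1 * (fun q => (J q)^-1)); pose c2 := d1 p1 * (fun q => (J q)^-1).
  have sc1 : smooth U c1 by apply: smoothN => //; apply: smoothM => //; exact: sD.
  have sc2 : smooth U c2 by apply: smoothM => //; exact: sD.
  rewrite (der_eq_on dd2 (g := c1 * d1 G + c2 * d2 G))//; last first.
    by move=> r Ur; rewrite /D2 frame2E /c1 /c2 !fctE; ring.
  have [sdG1 sdG2] := (sD _ _ dd1 sG, sD _ _ dd2 sG).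
  rewrite (der_add dd2); do ?exact: smoothM; last by [].
  rewrite (der_mul dd2 sc1 sdG1 Uq) (der_mul dd2 sc2 sdG2 Uq) G1 G2 /c1 /c2 !fctE d2p1.
  by ring.
have coord r (Ur : U r) := frame_coordinates dt jac0 Ur.
have coordt r (Ur : U r) := framet_coordinates dt jac0 Ur.
have E11 := F11E Uq; have E12 := F12E Uq; have E22 := F22E Uq.
have E1 := der_eq_on dD1 GE; have E2 := der_eq_on dD2 GE.
have Et := der_eq_on dDt GE.
rewrite -DtG Et//.
apply: (@support_flow_max_point _ _ _ oU beta p1 p2 sigma D1 D2 Dt dD1 dD2 dDt
  _ _ _ sp1 sp2 ssigma) => //.
- by move=> *; apply: (@frame12_comm _ _ U).
- by move=> *; apply: (@framet1_comm _ _ U).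
- by move=> *; apply: (@framet2_comm _ _ U).
- by move=> r /coord[].
- by move=> r /coord[].
- by move=> r /coord[].
- by move=> r /coord[].
- by move=> r /coordt[].
- by move=> r /coordt[].
- by move=> r Ur; rewrite gapE// gap_gt0.
- by move=> r Ur; rewrite detE// det_gt0.
- move=> r Ur; rewrite Dtsigma// flow// /log_speed !fctE /=.
  by rewrite detE.
- by rewrite -/F11 E11.
- by rewrite -/F22 E22.
- by rewrite -/F12 E12.
- by rewrite -/F11 -/F22 E11 E22.
- by rewrite -/G' -E1.
- by rewrite -/G' -E2.
- by rewrite -/G' -(der_eq_on dD1 E1)// D11G mulr_ge0_le0// sqr_ge0.
- by rewrite -/G' -(der_eq_on dD2 E2)// D22G mulr_ge0_le0// sqr_ge0.
Qed.

End parametrized_flow.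

(** * Curvature radii in a chart of the sphere *)

Section tangent_plane_algebra.
Context {R : realFieldType}.
Variables (p1 p2 N1 N2 N3 a1 a2 a3 b1 b2 b3 : R).
Hypotheses (aa : a1 ^+ 2 + a2 ^+ 2 + a3 ^+ 2 = 1)
  (bb : b1 ^+ 2 + b2 ^+ 2 + b3 ^+ 2 = 1) (ab : a1 * b1 + a2 * b2 + a3 * b3 = 0).
Hypotheses (pa : p1 * a1 + p2 * a2 + a3 = 0) (pb : p1 * b1 + p2 * b2 + b3 = 0).

(* The third component of the unit vector a x b, which is parallel to
   (p1, p2, 1). *)
Lemma projected_area : (a1 * b2 - a2 * b1) ^+ 2 * (1 + p1 ^+ 2 + p2 ^+ 2) = 1.
Proof.
have a3E : a3 = - (p1 * a1 + p2 * a2) by apply/eqP; rewrite -addr_eq0 addrC pa.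
have b3E : b3 = - (p1 * b1 + p2 * b2) by apply/eqP; rewrite -addr_eq0 addrC pb.
transitivity ((a1 ^+ 2 + a2 ^+ 2 + a3 ^+ 2) * (b1 ^+ 2 + b2 ^+ 2 + b3 ^+ 2)
  - (a1 * b1 + a2 * b2 + a3 * b3) ^+ 2); first by rewrite a3E b3E; ring.
by rewrite aa bb ab; ring.
Qed.

Let area0 : a1 * b2 - a2 * b1 != 0.
Proof.
apply/eqP => E; have := projected_area.
by rewrite E expr0n /= mul0r => /esym/eqP; rewrite oner_eq0.
Qed.

(** The vector N - N3 (p1, p2, 1) has no third component and is orthogonal to a and b, whose first
    two components are independent because the projected area is nonzero. *)
Lemma normal_slopes : N1 ^+ 2 + N2 ^+ 2 + N3 ^+ 2 = 1 ->
  N1 * a1 + N2 * a2 + N3 * a3 = 0 -> N1 * b1 + N2 * b2 + N3 * b3 = 0 ->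
  [/\ N1 = N3 * p1, N2 = N3 * p2 & N3 ^+ 2 * (1 + p1 ^+ 2 + p2 ^+ 2) = 1].
Proof.
move=> NN Na Nb.
have E1 : N1 = N3 * p1.
  apply/eqP; rewrite -subr_eq0; apply/eqP; apply: (mulIf area0); rewrite mul0r.
  transitivity ((N1 * a1 + N2 * a2 + N3 * a3 - N3 * (p1 * a1 + p2 * a2 + a3)) * b2
    - (N1 * b1 + N2 * b2 + N3 * b3 - N3 * (p1 * b1 + p2 * b2 + b3)) * a2).
    by ring.
  by rewrite Na Nb pa pb; ring.
have E2 : N2 = N3 * p2.
  apply/eqP; rewrite -subr_eq0; apply/eqP; apply: (mulIf area0); rewrite mul0r.
  transitivity ((N1 * b1 + N2 * b2 + N3 * b3 - N3 * (p1 * b1 + p2 * b2 + b3)) * a1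
    - (N1 * a1 + N2 * a2 + N3 * a3 - N3 * (p1 * a1 + p2 * a2 + a3)) * b1).
    by ring.
  by rewrite Na Nb pa pb; ring.
by split=> //; rewrite -[RHS]NN E1 E2; ring.
Qed.

Variables (k1 k2 h11 h12 h21 h22 A11 A12 A21 A22 : R).
Hypotheses (k10 : k1 != 0) (k20 : k2 != 0).
Hypotheses (NN : N3 ^+ 2 * (1 + p1 ^+ 2 + p2 ^+ 2) = 1).
Hypotheses (h11E : N3 * h11 = k1 * (a1 - p1 * a3))
  (h12E : N3 * h12 = k1 * (a2 - p2 * a3))
  (h21E : N3 * h21 = k2 * (b1 - p1 * b3))
  (h22E : N3 * h22 = k2 * (b2 - p2 * b3)).
Hypotheses (a1E : a1 = h11 * A11 + h12 * A21) (a2E : a2 = h11 * A12 + h12 * A22)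
  (b1E : b1 = h21 * A11 + h22 * A21) (b2E : b2 = h21 * A12 + h22 * A22).

(** Here a, b are unit principal tangent vectors, the rows of h are the rates of the slopes along
    them, and A = h^(-1) (a; b) is the derivative of the position in the slopes. Determinants give
    r1 r2. For r1 + r2, multiplication by det h turns the traces into 2 x 2 minors. *)
Lemma curvature_radii :
  k1^-1 * k2^-1 = (1 + p1 ^+ 2 + p2 ^+ 2) ^+ 2 * (A11 * A22 - A12 * A21) /\
  (k1^-1 + k2^-1) * N3 =
    (1 + p1 ^+ 2) * A11 + p1 * p2 * (A12 + A21) + (1 + p2 ^+ 2) * A22.
Proof.
have a3E : a3 = - (p1 * a1 + p2 * a2) by apply/eqP; rewrite -addr_eq0 addrC pa.
have b3E : b3 = - (p1 * b1 + p2 * b2) by apply/eqP; rewrite -addr_eq0 addrC pb.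
have areaE : a1 * b2 - a2 * b1 =
    (h11 * h22 - h12 * h21) * (A11 * A22 - A12 * A21).
  by rewrite a1E a2E b1E b2E; ring.
have h0 : h11 * h22 - h12 * h21 != 0.
  by apply/eqP => E; have := area0; rewrite areaE E mul0r eqxx.
have detE : N3 ^+ 2 =
    k1 * k2 * (1 + p1 ^+ 2 + p2 ^+ 2) * (A11 * A22 - A12 * A21).
  apply: (mulIf h0).
  transitivity (N3 * h11 * (N3 * h22) - N3 * h12 * (N3 * h21)); first by ring.
  rewrite h11E h12E h21E h22E.
  transitivity (k1 * k2 * (1 + p1 ^+ 2 + p2 ^+ 2) * (a1 * b2 - a2 * b1)).
    by rewrite a3E b3E; ring.
  by rewrite areaE; ring.
split.
  apply: (mulIf (mulf_neq0 k10 k20)); rewrite mulrACA !mulVf// mul1r.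
  by rewrite -[LHS]NN detE; ring.
apply: (mulIf h0).
transitivity ((k1^-1 * (N3 * h11)) * h22 - (k1^-1 * (N3 * h12)) * h21
  + (h11 * (k2^-1 * (N3 * h22)) - h12 * (k2^-1 * (N3 * h21)))); first by ring.
rewrite h11E h12E h21E h22E !mulKf// a3E b3E.
transitivity ((a1 + p1 * (p1 * a1 + p2 * a2)) * h22 - (a2 + p2 * (p1 * a1 + p2 * a2)) * h21
 + (h11 * (b2 + p2 * (p1 * b1 + p2 * b2)) - h12 * (b1 + p1 * (p1 * b1 + p2 * b2)))).
  by ring.
by rewrite a1E a2E b1E b2E; ring.
Qed.

End tangent_plane_algebra.

(** * Euclidean algebra and radial projection *)

Section euclidean_space.
Context {R : realType}.
Implicit Types (u v w x y : 'rV[R]_3).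

Definition i0 : 'I_3 := ord0.
Definition i1 : 'I_3 := lift ord0 ord0.
Definition i2 : 'I_3 := lift ord0 (lift ord0 ord0).

Lemma ord3_ind (P : 'I_3 -> Prop) : P i0 -> P i1 -> P i2 -> forall i, P i.
Proof.
move=> P0 P1 P2 i; case: (unliftP ord0 i) => [j|] ->; last exact: P0.
case: (unliftP ord0 j) => [k|] ->; last exact: P1.
by rewrite (ord1 k).
Qed.

Lemma dot3E u v : dot u v =
  u ord0 i0 * v ord0 i0 + u ord0 i1 * v ord0 i1 + u ord0 i2 * v ord0 i2.
Proof. by rewrite /dot !big_ord_recl big_ord0 addr0 addrA. Qed.

Lemma dotC u v : dot u v = dot v u.
Proof. by rewrite !dot3E; ring. Qed.

Lemma dotZr u c v : dot u (c *: v) = c * dot u v.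
Proof. by rewrite !dot3E !mxE; ring. Qed.

Lemma dotNr u v : dot u (- v) = - dot u v.
Proof. by rewrite !dot3E !mxE; ring. Qed.

Lemma dot0r u : dot u 0 = 0.
Proof. by rewrite !dot3E !mxE; ring. Qed.

Lemma dot_ge0 u : 0 <= dot u u.
Proof. by rewrite dot3E -!expr2 !addr_ge0 ?sqr_ge0. Qed.

Lemma dot_eq0 u : dot u u = 0 -> u = 0.
Proof.
rewrite dot3E -!expr2 => /eqP.
rewrite paddr_eq0 ?addr_ge0 ?sqr_ge0// paddr_eq0 ?sqr_ge0// !sqrf_eq0.
case/andP => /andP[/eqP u0 /eqP u1] /eqP u2.
by apply/rowP; apply: ord3_ind; rewrite mxE.
Qed.

Definition sph y : 'rV[R]_3 := (enorm y)^-1 *: y.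

Lemma enormZ c y : 0 < c -> enorm (c *: y) = c * enorm y.
Proof.
move=> c0; rewrite /enorm dotZr dotC dotZr mulrA -expr2.
by rewrite sqrtrM ?sqr_ge0// sqrtr_sqr gtr0_norm.
Qed.

Lemma sphZ c y : 0 < c -> sph (c *: y) = sph y.
Proof.
move=> c0; rewrite /sph enormZ// invfM scalerA mulrAC mulVf ?mul1r//.
exact: lt0r_neq0.
Qed.

Lemma enorm_gt0 y : 0 < dot y y -> 0 < enorm y.
Proof. by rewrite sqrtr_gt0. Qed.

Lemma enorm_sphE y : 0 < dot y y -> enorm y *: sph y = y.
Proof.
move=> /enorm_gt0 y0; rewrite /sph scalerA mulfV ?scale1r//.
exact: lt0r_neq0.
Qed.

Lemma sph_sphere2 y : 0 < dot y y -> sphere2 (sph y).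
Proof.
move=> y0; rewrite /sphere2 /= /sph dotZr dotC dotZr.
rewrite -[dot y y]sqr_sqrtr ?dot_ge0// -/(enorm y).
by have := lt0r_neq0 (enorm_gt0 y0) => ?; field.
Qed.

Lemma sphere2_gt0 x : sphere2 x -> 0 < dot x x.
Proof. by rewrite /sphere2 /= => ->. Qed.

Lemma sph_id x : sphere2 x -> sph x = x.
Proof.
by rewrite /sphere2 /= /sph /enorm => ->; rewrite sqrtr1 invr1 scale1r.
Qed.

Definition det3 u v w : R :=
  u ord0 i0 * (v ord0 i1 * w ord0 i2 - v ord0 i2 * w ord0 i1)
  - u ord0 i1 * (v ord0 i0 * w ord0 i2 - v ord0 i2 * w ord0 i0)
  + u ord0 i2 * (v ord0 i0 * w ord0 i1 - v ord0 i1 * w ord0 i0).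

Lemma det3_cramer u v y w :
  det3 u v y *: w = det3 w v y *: u + det3 u w y *: v + det3 u v w *: y.
Proof. by apply/rowP; apply: ord3_ind; rewrite !mxE /det3; ring. Qed.

(** The square of a determinant is the Gram determinant of its three vectors; with x a unit vector
    orthogonal to u and v, it reduces to that of u and v. *)
Lemma det3_gram u v x : dot x x = 1 -> dot x u = 0 -> dot x v = 0 ->
  det3 u v x ^+ 2 = dot u u * dot v v - dot u v ^+ 2.
Proof.
move=> xx xu xv.
transitivity (dot x x * (dot u u * dot v v - dot u v ^+ 2)
  - dot x u * (dot x u * dot v v - dot u v * dot x v)
  + dot x v * (dot x u * dot u v - dot u u * dot x v)).
  by rewrite /det3 !dot3E; ring.
by rewrite xx xu xv; ring.
Qed.

Section orthonormal_frame.
Variables (e1 e2 e3 : 'rV[R]_3).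
Hypotheses (e11 : dot e1 e1 = 1) (e22 : dot e2 e2 = 1) (e33 : dot e3 e3 = 1)
  (e12 : dot e1 e2 = 0) (e31 : dot e3 e1 = 0) (e32 : dot e3 e2 = 0).

(** The matrix M with rows e1, e2, e3 satisfies M M^T = 1, hence M^T M = 1 as it is square, which is
    the expansion. *)
Lemma parseval u v :
  dot u v = dot e1 u * dot e1 v + dot e2 u * dot e2 v + dot e3 u * dot e3 v.
Proof.
pose M : 'M[R]_3 := \matrix_(i, j) (if i == i0 then e1 else
  if i == i1 then e2 else e3) ord0 j.
have ME (i : 'I_3) w : (M *m w^T) i ord0 = dot
    (if i == i0 then e1 else if i == i1 then e2 else e3) w.
  by rewrite mxE /dot; apply: eq_bigr => j _; rewrite !mxE.
have MM : M *m M^T = 1%:M.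
  apply/matrixP => i j; rewrite !mxE.
  under eq_bigr do rewrite !mxE.
  rewrite -/(dot _ _).
  by elim/ord3_ind: i; elim/ord3_ind: j => //=; rewrite dotC.
have uvE : dot u v = (u *m v^T) ord0 ord0.
  by rewrite mxE /dot; apply: eq_bigr => j _; rewrite mxE.
have -> : dot u v = ((M *m u^T)^T *m (M *m v^T)) ord0 ord0.
  rewrite uvE trmx_mul trmxK mulmxA -(mulmxA u) (mulmx1C MM) mulmx1.
  by [].
by rewrite mxE !big_ord_recl big_ord0 addr0 addrA ![(_^T) _ _]mxE !ME.
Qed.

End orthonormal_frame.

End euclidean_space.

(** * Smooth functions on space-time, constant along rays *)

Section space_time.
Context {R : realType}.
Local Notation E := ('rV[R]_3 * R)%type.
Implicit Types (U : set E).

Lemma smooth_space_entry U i : smooth U (fun q : E => q.1 ord0 i).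
Proof.
apply: smooth_linear; first by move=> a p q; rewrite !mxE.
move=> q; apply: (@continuous_comp _ _ _ (fun q : E => q.1)
  (fun M : 'rV[R]_3 => M ord0 i)); first exact: cvg_fst.
exact: coord_continuous.
Qed.

Lemma smooth_time U : smooth U (fun q : E => q.2).
Proof. by apply: smooth_linear => // q; exact: cvg_snd. Qed.

Lemma smooth_sqnorm U : open U -> smooth U (fun q : E => dot q.1 q.1).
Proof.
move=> oU; apply: (smooth_sum oU) => i.
by apply: (smoothM oU); exact: smooth_space_entry.
Qed.

Definition off_axis : set E := [set q | 0 < dot q.1 q.1].

Lemma open_off_axis : open off_axis.
Proof.
rewrite (_ : off_axis =
  setT `&` (fun q : E => dot q.1 q.1) @^-1` [set r | 0 < r]); last first.
  by rewrite setTI.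
apply: open_preimage_on; [exact: openT|exact: open_gt|move=> q _].
exact: smooth_continuous (smooth_sqnorm openT) (I : setT q).
Qed.

(** The inverse norm is exp(- ln(|y|^2) / 2), a composition of maps already known to be smooth. *)
Lemma smooth_inv_norm : smooth off_axis (fun q : E => (enorm q.1)^-1).
Proof.
have sdot := smooth_sqnorm open_off_axis.
have sl : smooth off_axis (@ln R \o (fun q : E => dot q.1 q.1)).
  by apply: smooth_ln => //; exact: open_off_axis.
have sh := smoothM open_off_axis (smooth_cst (W := R) off_axis (- 2^-1)) sl.
apply: eq_on_smooth open_off_axis _ (smooth_expR open_off_axis sh) => q q0.
rewrite /enorm -powR12_sqrt ?dot_ge0// /powR gt_eqF// -expRN.
by rewrite /= !fctE /= mulNr.
Qed.

Definition sphere_proj (q : E) : E := (sph q.1, q.2).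

Lemma continuous_sphere_proj q : off_axis q -> {for q, continuous sphere_proj}.
Proof.
move=> q0.
have c1 : {for q, continuous (fun q : E => sph q.1)}.
  rewrite /prop_for /continuous_at /sph; apply: cvgZ; last exact: cvg_fst.
  exact: (smooth_continuous smooth_inv_norm q0).
have c2 : {for q, continuous (fun q : E => q.2)} by exact: cvg_snd.
exact: (cvg_pair c1 c2).
Qed.

Let sphere_projE : sphere_proj = (fun q : E =>
  \sum_(i < 3) ((enorm q.1)^-1 * q.1 ord0 i) *: ((delta_mx ord0 i, 0) : E)
  + q.2 *: ((0, 1) : E)).
Proof.
apply/funext => q; rewrite !big_ord_recl big_ord0 addr0.
apply/pair_equal_spec; split => /=; last first.
  by rewrite !scaler0 !add0r [_ *: _]mulr1.
rewrite scaler0 addr0; apply/rowP; apply: ord3_ind; rewrite /sph !mxE /=; ring.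
Qed.

(** A local extension [F] of the solution is uncontrolled off the sphere; composed with
    [sphere_proj] it becomes constant along rays. The projection is smooth in the form asked by
    [smooth_comp]: smooth coefficients times fixed vectors. *)
Lemma smooth_pullback (U0 : set E) (F : E -> 'rV[R]_3) (e : 'rV[R]_3) :
  open U0 -> smooth U0 F ->
  open (off_axis `&` sphere_proj @^-1` U0) /\
  smooth (off_axis `&` sphere_proj @^-1` U0) (fun q => dot e (F (sphere_proj q))).
Proof.
move=> oU0 sF.
have oU1 : open (off_axis `&` sphere_proj @^-1` U0).
  exact: open_preimage_on open_off_axis oU0 continuous_sphere_proj.
split=> //.
have sf : smooth U0 (fun q => dot e (F q)).
  apply: (smooth_sum oU0) => i.
  by apply: (smoothM oU0); [exact: smooth_cst|exact: smooth_entry].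
apply: (@smooth_comp _ _ _ _ U0 (fun q => dot e (F q)) 3
  (fun i q => (enorm q.1)^-1 * q.1 ord0 i) (fun i => (delta_mx ord0 i, 0))
  (fun q => q.2) (0, 1) sphere_proj) => //.
- move=> i; apply: (smoothM oU1); last exact: smooth_space_entry.
  by apply: smooth_subset smooth_inv_norm => q [].
- exact: smooth_time.
- by move=> q [].
Qed.

Lemma is_derive_dot (V : normedModType R) (g : V -> 'rV[R]_3) e y w :
  derivable g y w -> is_derive y w (fun y => dot e (g y)) (dot e ('D_w g y)).
Proof.
move=> dg; rewrite derive_mx//.
have dgi i := (derivable_mxP _ _ _).1 dg ord0 i.
rewrite (_ : (fun y => _) = \sum_(i < 3) (fun y => e ord0 i * g y ord0 i)).
  rewrite /dot; apply: is_derive_sum => i; rewrite mxE.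
  have := derivableP (dgi i) => di.
  apply: is_derive_eq (is_deriveZ (e ord0 i) di) _ => //.
by apply/funext => x; rewrite fct_sumE.
Qed.

(* The limit of a divergent difference quotient is the default point 0. *)
Lemma derive_neq0_derivable (V : normedModType R) (g : V -> 'rV[R]_3) y w :
  'D_w g y != 0 -> derivable g y w.
Proof.
apply: contra_neqP => ndg; rewrite /derive dvgP//.
by rewrite /point /=; apply/matrixP => i j; rewrite !mxE.
Qed.

End space_time.

(** * Coordinates of the position and slopes of the normal *)

Section sphere_chart.
Context {R : realType}.
Local Notation E := ('rV[R]_3 * R)%type.
Variables (I : set R) (X : 'rV[R]_3 -> R -> 'rV[R]_3).
Variables (U0 : set E) (F : E -> 'rV[R]_3).
Hypotheses (oU0 : open U0) (sF : smooth U0 F)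
  (XF : forall x t, sphere2 x -> I t -> U0 (x, t) -> X x t = F (x, t)).

Let U1 := off_axis `&` sphere_proj @^-1` U0.
Let oU1 : open U1 := (smooth_pullback 0 oU0 sF).1.

Definition coordinate (e : 'rV[R]_3) (q : E) : R := dot e (F (sphere_proj q)).

Lemma smooth_coordinate e : smooth U1 (coordinate e).
Proof. exact: (smooth_pullback e oU0 sF).2. Qed.

Lemma near_slice (U : set E) y t : open U -> U (y, t) -> \near y, U (y, t).
Proof.
move=> oU Uyt; have ct : {for y, continuous (fun y : 'rV[R]_3 => (y, t) : E)}.
  have c1 : {for y, continuous (fun y : 'rV[R]_3 => y)} by exact: cvg_id.
  have c2 : {for y, continuous (fun _ : 'rV[R]_3 => t)}.
    by apply: cvg_cst; exact: (nbhs_filter y).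
  exact: (cvg_pair c1 c2).
by apply: ct; exact: open_nbhs_nbhs.
Qed.

Lemma coordinateE e y t : U1 (y, t) -> I t ->
  coordinate e (y, t) = dot e (X (sph y) t).
Proof.
by move=> [y0 U0y] It; rewrite XF//; exact: sph_sphere2.
Qed.

Lemma derivable_sphere_slice y t w : U1 (y, t) -> I t ->
  derivable (fun y => X (sph y) t) y w.
Proof.
move=> U1q It; apply/derivable_mxP => i j; rewrite (ord1 i) {i}.
have : derivable (fun y => coordinate (delta_mx ord0 j) (y, t)) y w.
  rewrite -derivable_space; exact: smooth_derivable (smooth_coordinate _) U1q.
apply: near_eq_derivable; apply: filterS (near_slice oU1 U1q) => y' U1y'.
rewrite coordinateE//; move: (X _ _) => u.
rewrite dot3E !mxE /=; move: j; apply: ord3_ind => /=; ring.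
Qed.

Lemma derive_coordinate e y t w : U1 (y, t) -> I t ->
  'D_(w, 0) (coordinate e) (y, t) = dot e ('D_w (fun y => X (sph y) t) y).
Proof.
move=> U1q It; rewrite derive_space.
rewrite -(@derive_val _ _ _ _ _ _ _ (is_derive_dot e (@derivable_sphere_slice _ _ w U1q It))).
apply: near_eq_derive; apply: filterS (near_slice oU1 U1q) => y' U1y'.
exact: coordinateE.
Qed.

Lemma coordinate_radial e y t : U1 (y, t) -> 'D_(y, 0) (coordinate e) (y, t) = 0.
Proof.
move=> U1q; apply: derive_near_cst.
(* This keeps (1 + h) y on the ray of y. *)
have : \forall h \near (0 : R), -1 < h by apply: lt_nbhsr; rewrite oppr_lt0.
apply: filterS => h h1.
rewrite /coordinate /sphere_proj /= scaler0 add0r -[X in _ + X]scale1r -scalerDl.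
by rewrite sphZ// -ltrBlDr sub0r.
Qed.

Variables (v1 v2 e1 e2 e3 : 'rV[R]_3).
Let Y1 := coordinate e1.
Let Y2 := coordinate e2.
Let Y3 := coordinate e3.
Let d1 (f : E -> R) : E -> R := 'D_(v1, 0) f.
Let d2 (f : E -> R) : E -> R := 'D_(v2, 0) f.

(** Components, in the frame e1, e2, e3, of the cross product of d1 Y and d2 Y. The slopes are taken
    from it rather than from [nu], so that they are smooth by construction. *)
Definition normal1 : E -> R := d1 Y2 * d2 Y3 + - (d1 Y3 * d2 Y2).
Definition normal2 : E -> R := d1 Y3 * d2 Y1 + - (d1 Y1 * d2 Y3).
Definition normal3 : E -> R := d1 Y1 * d2 Y2 + - (d1 Y2 * d2 Y1).
Definition slope1 : E -> R := normal1 * (fun q => (normal3 q)^-1).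
Definition slope2 : E -> R := normal2 * (fun q => (normal3 q)^-1).
Definition base_det (q : E) : R := det3 v1 v2 q.1.

(** A nonzero [normal3] makes the slopes finite. A nonzero [base_det] makes v1, v2 and the radial
    vector y a basis of space. *)
Definition chart_domain : set E :=
  U1 `&` [set q | normal3 q != 0] `&` [set q | base_det q != 0].
Let U2 := chart_domain.

Let sd (U : set E) w e : U `<=` U1 -> smooth U ('D_(w, 0) (coordinate e)).
Proof.
by move=> sub; apply: (smooth_subset sub); apply: smooth_derive; exact: smooth_coordinate.
Qed.

Let smooth_minor (U : set E) w1 w2 w3 w4 a b c d : open U -> U `<=` U1 ->
  smooth U ('D_(w1, 0) (coordinate a) * 'D_(w2, 0) (coordinate b) +
    - ('D_(w3, 0) (coordinate c) * 'D_(w4, 0) (coordinate d))).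
Proof.
move=> oU sub; apply: (smoothD oU); last apply: (smoothN oU);
  by apply: (smoothM oU); exact: sd.
Qed.

Lemma smooth_base_det U : open U -> smooth U base_det.
Proof.
move=> oU.
have sm a b c d i j : smooth U (fun q : E => a * (b * q.1 ord0 i - c * q.1 ord0 j) + d).
  apply: (smoothD oU (f := fun q : E => a * (b * q.1 ord0 i - c * q.1 ord0 j))
    (g := cst d)); last exact: smooth_cst.
  apply: (smoothM oU (f := cst a)); first exact: smooth_cst.
  apply: (smoothD oU (f := fun q : E => b * q.1 ord0 i)
    (g := - (fun q : E => c * q.1 ord0 j))); last apply: (smoothN oU).
    by apply: (smoothM oU (f := cst b)); [exact: smooth_cst|exact: smooth_space_entry].
  by apply: (smoothM oU (f := cst c)); [exact: smooth_cst|exact: smooth_space_entry].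
have := smoothD oU (smoothD oU (sm (v1 ord0 i0) (v2 ord0 i1) (v2 ord0 i2) 0 i2 i1)
  (sm (- v1 ord0 i1) (v2 ord0 i0) (v2 ord0 i2) 0 i2 i0))
  (sm (v1 ord0 i2) (v2 ord0 i0) (v2 ord0 i1) 0 i1 i0).
apply: (eq_on_smooth oU) => q _; rewrite !fctE /base_det /det3; ring.
Qed.

Lemma open_neq0_on (U : set E) (f : E -> R) : open U -> smooth U f ->
  open (U `&` [set q | f q != 0]).
Proof.
move=> oU sf; apply: (@open_preimage_on _ _ U [set r : R | r != 0] f) => //.
by move=> q Uq; exact: smooth_continuous sf Uq.
Qed.

Lemma open_gt0_on (U : set E) (f : E -> R) : open U -> smooth U f ->
  open (U `&` [set q | 0 < f q]).
Proof.
move=> oU sf; apply: (@open_preimage_on _ _ U [set r : R | 0 < r] f) => //.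
by move=> q Uq; exact: smooth_continuous sf Uq.
Qed.

Let smooth_n3 : smooth U1 normal3.
Proof. by apply: smooth_minor => // q. Qed.

Lemma open_chart_domain : open chart_domain.
Proof.
apply: open_neq0_on; first exact: open_neq0_on oU1 smooth_n3.
exact/smooth_base_det/open_neq0_on.
Qed.
Let oU2 : open U2 := open_chart_domain.

Lemma smooth_slopes : smooth chart_domain slope1 /\ smooth chart_domain slope2.
Proof.
have sub : U2 `<=` U1 by move=> q [[]].
have si : smooth U2 (fun q => (normal3 q)^-1).
  apply: (smoothV oU2); first by move=> q [[_ n0] _].
  exact: smooth_subset smooth_n3.
by split; apply: (smoothM oU2) => //; exact: smooth_minor.
Qed.

Lemma slopes_tangent q : chart_domain q ->
  slope1 q * d1 Y1 q + slope2 q * d1 Y2 q + d1 Y3 q = 0 /\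
  slope1 q * d2 Y1 q + slope2 q * d2 Y2 q + d2 Y3 q = 0.
Proof.
move=> [[_ n0] _]; move: n0.
rewrite /= /slope1 /slope2 /normal1 /normal2 /normal3 !fctE.
move: (d1 Y1 q) (d1 Y2 q) (d1 Y3 q) (d2 Y1 q) (d2 Y2 q) (d2 Y3 q).
by move=> a b c d e f n0; split; field.
Qed.

(** By Cramer's rule w is a combination of v1, v2 and y, and the derivative along y vanishes. Thus
    v1 and v2 need not stay tangent away from the base point. *)
Lemma direction_span (U : set E) (f : E -> R) y t w : smooth U f -> U (y, t) ->
  base_det (y, t) != 0 -> 'D_(y, 0) f (y, t) = 0 ->
  'D_(w, 0) f (y, t) =
    det3 w v2 y / det3 v1 v2 y * d1 f (y, t) +
    det3 v1 w y / det3 v1 v2 y * d2 f (y, t).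
Proof.
move=> sf Uq b0 fy; have df := smooth_differentiable sf Uq.
rewrite /base_det /= in b0.
have wE : ((w, 0) : E) = (det3 w v2 y / det3 v1 v2 y) *: ((v1, 0) : E) +
    ((det3 v1 w y / det3 v1 v2 y) *: ((v2, 0) : E) +
     ((det3 v1 v2 w / det3 v1 v2 y) *: ((y, 0) : E) + 0)).
  apply/pair_equal_spec; split => /=; last by rewrite !scaler0 !addr0.
  apply: (scalerI b0); rewrite det3_cramer addr0 !scalerDr !scalerA addrA.
  by rewrite ![det3 v1 v2 y * _]mulrC !divfK.
have D v : 'D_v f (y, t) = 'd f (y, t) v by exact: deriveE.
have Dy : 'd f (y, t) (y, 0) = 0 := etrans (esym (D _)) fy.
rewrite /d1 /d2 (D (w, 0)) (D (v1, 0)) (D (v2, 0)) wE !linearP linear0 Dy /=.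
by rewrite /= scaler0 !addr0.
Qed.

End sphere_chart.

(** * Principal directions and the Weingarten relation *)

Section principal_directions.
Context {R : realType}.
Variables (X nu : 'rV[R]_3 -> R -> 'rV[R]_3).

(* Stated for the 0-homogeneous extensions of X and nu, so that [y] ranges over
   an open subset of the space. *)
Definition principal_directions y t (k1 k2 : R) (w1 w2 : 'rV[R]_3) : Prop :=
  let XS y := X (sph y) t in
  let NS y := nu (sph y) t in
  [/\ [/\ dot ('D_w1 XS y) ('D_w1 XS y) = 1, dot ('D_w2 XS y) ('D_w2 XS y) = 1
        & dot ('D_w1 XS y) ('D_w2 XS y) = 0],
      dot (NS y) (NS y) = 1,
      dot (NS y) ('D_w1 XS y) = 0 /\ dot (NS y) ('D_w2 XS y) = 0,
      derivable NS y w1 /\ 'D_w1 NS y = k1 *: 'D_w1 XS y &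
      derivable NS y w2 /\ 'D_w2 NS y = k2 *: 'D_w2 XS y].

Lemma dot1_neq0 (u : 'rV[R]_3) : dot u u = 1 -> u != 0.
Proof.
by move=> uu; apply/eqP => u0; move: uu; rewrite u0 dot0r => /esym/eqP;
  rewrite oner_eq0.
Qed.

(** The differential of [nu] along a principal direction is a nonzero multiple of a unit vector, so
    it cannot be the default value 0 of a divergent limit. Nonzero curvature thus supplies the
    differentiability of [nu] in these directions. *)
Lemma principal_directions_sphere x t k1 k2 v1 v2 : sphere2 x ->
  outer_unit_normal (X^~ t) (nu^~ t) -> k1 != 0 -> k2 != 0 ->
  tangent x v1 -> tangent x v2 ->
  let u1 := sphere_diff (X^~ t) x v1 in let u2 := sphere_diff (X^~ t) x v2 in
  dot u1 u1 = 1 -> dot u2 u2 = 1 -> dot u1 u2 = 0 ->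
  sphere_diff (nu^~ t) x v1 = k1 *: u1 -> sphere_diff (nu^~ t) x v2 = k2 *: u2 ->
  principal_directions x t k1 k2 v1 v2.
Proof.
move=> Sx /(_ x Sx)[NN Nt _] k10 k20 tv1 tv2 u1 u2 u11 u22 u12 D1 D2.
have dN v k : k != 0 -> let u := sphere_diff (X^~ t) x v in dot u u = 1 ->
    sphere_diff (nu^~ t) x v = k *: u -> derivable (fun y => nu (sph y) t) x v.
  move=> k0 u uu E; apply: derive_neq0_derivable.
  have : k *: u != 0 by rewrite scaler_eq0 negb_or k0 dot1_neq0.
  by rewrite -E.
have E : nu (sph x) t = nu x t by rewrite sph_id.
refine (And5 (And3 u11 u22 u12) _ (conj _ _) (conj (dN _ _ k10 u11 D1) D1)
  (conj (dN _ _ k20 u22 D2) D2)); rewrite E; first exact: NN.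
- exact: Nt tv1.
- exact: Nt tv2.
Qed.

Lemma principal_directions_scale c x t k1 k2 v1 v2 : 0 < c ->
  principal_directions x t k1 k2 v1 v2 ->
  principal_directions (c *: x) t k1 k2 (c *: v1) (c *: v2).
Proof.
move=> c0.
pose XS y := X (sph y) t; pose NS y := nu (sph y) t.
have XZ z : XS (c *: z) = XS z by rewrite /XS sphZ.
have NZ z : NS (c *: z) = NS z by rewrite /NS sphZ.
have DX v : 'D_(c *: v) XS (c *: x) = 'D_v XS x := (derive_scaled v x c0 XZ).2.
have DN v : 'D_(c *: v) NS (c *: x) = 'D_v NS x := (derive_scaled v x c0 NZ).2.
have dN v : derivable NS (c *: x) (c *: v) = derivable NS x v :=
  (derive_scaled v x c0 NZ).1.
rewrite /principal_directions -/XS -/NS -/(NS (c *: x)) -/(NS x).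
by rewrite (DX v1) (DX v2) (DN v1) (DN v2) (dN v1) (dN v2) NZ.
Qed.

End principal_directions.

Section weingarten.
Context {R : realType}.
Local Notation E := ('rV[R]_3 * R)%type.
Variables (I : set R) (X nu : 'rV[R]_3 -> R -> 'rV[R]_3).
Variables (U0 : set E) (F : E -> 'rV[R]_3).
Hypotheses (oU0 : open U0) (sF : smooth U0 F)
  (XF : forall x t, sphere2 x -> I t -> U0 (x, t) -> X x t = F (x, t)).
Variables (v1 v2 e1 e2 e3 : 'rV[R]_3).
Hypotheses (e11 : dot e1 e1 = 1) (e22 : dot e2 e2 = 1) (e33 : dot e3 e3 = 1)
  (e12 : dot e1 e2 = 0) (e31 : dot e3 e1 = 0) (e32 : dot e3 e2 = 0).
Variables (k1 k2 : 'rV[R]_3 -> R -> R).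
Hypothesis principal : forall y t, 0 < dot y y -> I t ->
  exists w1 w2, principal_directions X nu y t (k1 (sph y) t) (k2 (sph y) t) w1 w2.

Let dom := chart_domain U0 F v1 v2 e1 e2.
Let p1 := slope1 F v1 v2 e1 e2 e3.
Let p2 := slope2 F v1 v2 e1 e2 e3.
Let Y1 := coordinate F e1.
Let Y2 := coordinate F e2.
Let Y3 := coordinate F e3.
Let d1 (f : E -> R) : E -> R := 'D_(v1, 0) f.
Let d2 (f : E -> R) : E -> R := 'D_(v2, 0) f.
Let odom : open dom. Proof. exact: open_chart_domain. Qed.

Let tangent_combination (x y r1 r2 a1 a2 a3 b1 b2 b3 : R) :
  r1 * a1 + r2 * a2 + a3 = 0 -> r1 * b1 + r2 * b2 + b3 = 0 ->
  r1 * (x * a1 + y * b1) + r2 * (x * a2 + y * b2) + (x * a3 + y * b3) = 0.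
Proof.
move=> A B.
transitivity (x * (r1 * a1 + r2 * a2 + a3) + y * (r1 * b1 + r2 * b2 + b3)).
  by ring.
by rewrite A B !mulr0 addr0.
Qed.

Lemma tangent_direction y t w : dom (y, t) -> I t ->
  let l := 'D_w (fun y => X (sph y) t) y in
  p1 (y, t) * dot e1 l + p2 (y, t) * dot e2 l + dot e3 l = 0.
Proof.
move=> dq It l; have [[U1q _] b0] := dq.
have span e := direction_span w (smooth_coordinate oU0 sF e) U1q b0
   (coordinate_radial F e U1q).
have De e := derive_coordinate oU0 sF XF e w U1q It.
have [T1 T2] := slopes_tangent e3 dq.
have E1 := etrans (esym (De e1)) (span e1).
have E2 := etrans (esym (De e2)) (span e2).
have E3 := etrans (esym (De e3)) (span e3).
rewrite /l E1 E2 E3.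
exact: (tangent_combination _ _ T1 T2).
Qed.

Lemma normal_in_chart y t : dom (y, t) -> I t ->
  let N := nu (sph y) t in
  [/\ dot e1 N = dot e3 N * p1 (y, t), dot e2 N = dot e3 N * p2 (y, t) &
    dot e3 N ^+ 2 * (1 + p1 (y, t) ^+ 2 + p2 (y, t) ^+ 2) = 1].
Proof.
move=> dq It N; have [[[y0 _] _] _] := dq.
have [w1 [w2 [[l11 l22 l12] NN [Nl1 Nl2] _ _]]] := principal y0 It.
have T1 := tangent_direction w1 dq It; have T2 := tangent_direction w2 dq It.
have pars u v := parseval e11 e22 e33 e12 e31 e32 u v.
move: ('D_w1 _ y) ('D_w2 _ y) l11 l22 l12 Nl1 Nl2 T1 T2 => l1 l2 l11 l22 l12.
rewrite pars -!expr2 in l11; rewrite pars -!expr2 in l22; rewrite pars in l12.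
rewrite pars -!expr2 in NN => Nl1 Nl2 T1 T2.
rewrite pars in Nl1; rewrite pars in Nl2.
exact: (normal_slopes l11 l22 l12 T1 T2 NN Nl1 Nl2).
Qed.

Let normal3_neq0 y t : dom (y, t) -> I t -> dot e3 (nu (sph y) t) != 0.
Proof.
move=> dq It; have [_ _] := normal_in_chart dq It; apply: contra_eq_neq => ->.
by rewrite expr0n mul0r eq_sym oner_neq0.
Qed.

Section one_slope.
Variables (e : 'rV[R]_3) (p : E -> R).
Hypothesis (sp : smooth dom p) (pE : forall y t, dom (y, t) -> I t ->
  dot e (nu (sph y) t) = dot e3 (nu (sph y) t) * p (y, t)).

(** On the chart, p is a quotient of two components of [nu (sph y) t], which depends on y only
    through its ray. *)
Lemma slope_radial y t : dom (y, t) -> I t -> 'D_(y, 0) p (y, t) = 0.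
Proof.
move=> dq It; apply: derive_near_cst.
have h1 : \forall h \near (0 : R), -1 < h by apply: lt_nbhsr; rewrite oppr_lt0.
have hU := near_ray (y, 0) odom dq.
apply: filterS2 h1 hU => h h1.
have -> : h *: ((y, 0) : E) + (y, t) = ((1 + h) *: y, t).
  apply/pair_equal_spec; split => /=; last by rewrite scaler0 add0r.
  by rewrite scalerDl scale1r addrC.
move=> dq'; apply: (mulfI (normal3_neq0 dq It)).
by rewrite -(pE dq It) -[in RHS](sphZ y (c := 1 + h)) ?(pE dq')// ?sphZ//;
  rewrite -ltrBlDl sub0r.
Qed.

(** Leibniz rule in e.N = (e3.N) p, with the derivative of N replaced by k l. Differentiability of
    [nu] along the one vector w is enough. *)
Lemma slope_rate y t w k : dom (y, t) -> I t ->
  let NS y := nu (sph y) t in let l := 'D_w (fun y => X (sph y) t) y in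
  derivable NS y w -> 'D_w NS y = k *: l ->
  dot e3 (NS y) * 'D_(w, 0) p (y, t) = k * (dot e l - p (y, t) * dot e3 l).
Proof.
move=> dq It NS l dNS NSl.
have dp : derivable (fun y => p (y, t)) y w.
  by rewrite -derivable_space; exact: smooth_derivable sp dq.
have [d3 d3E] := is_derive_dot e3 dNS; have [de deE] := is_derive_dot e dNS.
have E1 : 'D_w (fun y => dot e (NS y)) y =
    'D_w ((fun y => dot e3 (NS y)) * (fun y => p (y, t))) y.
  apply: near_eq_derive; apply: filterS (near_slice odom dq) => y' dq'.
  exact: pE.
have E2 := etrans E1 (deriveM d3 dp).
rewrite derive_space.
move: E2; rewrite deE d3E NSl !dotZr.
move: ('D_w (fun y => p (y, t)) y) => P.
move: (dot e l) (dot e3 l) => a b; rewrite -[_ *: P]/(_ * P) -[_ *: (k * b)]/(_ * (k * b)).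
by move=> E2; rewrite mulrBr E2; ring.
Qed.

End one_slope.

End weingarten.

(** * Principal radii from derivatives in the slopes *)

Section radii.
Context {R : realType}.
Local Notation E := ('rV[R]_3 * R)%type.
Variables (I : set R) (X nu : 'rV[R]_3 -> R -> 'rV[R]_3).
Variables (U0 : set E) (F : E -> 'rV[R]_3).
Hypotheses (oU0 : open U0) (sF : smooth U0 F)
  (XF : forall x t, sphere2 x -> I t -> U0 (x, t) -> X x t = F (x, t)).
Variables (v1 v2 e1 e2 e3 : 'rV[R]_3).
Hypotheses (e11 : dot e1 e1 = 1) (e22 : dot e2 e2 = 1) (e33 : dot e3 e3 = 1)
  (e12 : dot e1 e2 = 0) (e31 : dot e3 e1 = 0) (e32 : dot e3 e2 = 0).
Variables (k1 k2 : 'rV[R]_3 -> R -> R).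
Hypothesis principal : forall y t, 0 < dot y y -> I t ->
  exists w1 w2, principal_directions X nu y t (k1 (sph y) t) (k2 (sph y) t) w1 w2.
Hypothesis k_gt0 : forall x t, sphere2 x -> I t -> 0 < k1 x t /\ 0 < k2 x t.

Let dom := chart_domain U0 F v1 v2 e1 e2.
Let p1 := slope1 F v1 v2 e1 e2 e3.
Let p2 := slope2 F v1 v2 e1 e2 e3.
Let Y1 := coordinate F e1.
Let Y2 := coordinate F e2.
Let Y3 := coordinate F e3.
Definition diff_dir (v : 'rV[R]_3) (f : E -> R) : E -> R := 'D_(v, 0) f.
Definition diff_time (f : E -> R) : E -> R := 'D_(0, 1) f.
Let d1 := diff_dir v1.
Let d2 := diff_dir v2.
Let dt := diff_time.

Let frame_combination (x y a1 a2 b1 b2 c1 c2 F1 F2 : R) :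
  c1 = a1 * F1 + a2 * F2 -> c2 = b1 * F1 + b2 * F2 ->
  x * c1 + y * c2 = (x * a1 + y * b1) * F1 + (x * a2 + y * b2) * F2.
Proof. by move=> -> ->; ring. Qed.

Definition regular_domain : set E :=
  dom `&` [set q | jacobian_fun p1 p2 d1 d2 q != 0].

Let A11 := frame1 p1 p2 dt d1 d2 Y1.
Let A12 := frame1 p1 p2 dt d1 d2 Y2.
Let A21 := frame2 p1 p2 dt d1 d2 Y1.
Let A22 := frame2 p1 p2 dt d1 d2 Y2.

Lemma radii_in_chart y t : regular_domain (y, t) -> I t ->
  let q := (y, t) in let r1 := (k1 (sph y) t)^-1 in let r2 := (k2 (sph y) t)^-1 in
  r1 * r2 = (1 + p1 q ^+ 2 + p2 q ^+ 2) ^+ 2 * (A11 q * A22 q - A12 q * A21 q) /\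
  (r1 + r2) * dot e3 (nu (sph y) t) =
    (1 + p1 q ^+ 2) * A11 q + p1 q * p2 q * (A12 q + A21 q)
    + (1 + p2 q ^+ 2) * A22 q.
Proof.
move=> [dq J0] It q r1 r2; have [[U1q _] b0] := dq; have [y0 _] := U1q.
have [k10 k20] := k_gt0 (sph_sphere2 y0) It.
have [w1 [w2 [[l11 l22 l12] NN [Nl1 Nl2] [dN1 DN1] [dN2 DN2]]]] :=
  principal y0 It.
have pars u v := parseval e11 e22 e33 e12 e31 e32 u v.
have nic y' t' (H : dom (y', t')) (H' : I t') :=
  normal_in_chart oU0 sF XF e11 e22 e33 e12 e31 e32 principal H H'.
have [sp1 sp2] := smooth_slopes oU0 sF v1 v2 e1 e2 e3.
have p1E y' t' (H : dom (y', t')) (H' : I t') : dot e1 (nu (sph y') t') =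
    dot e3 (nu (sph y') t') * p1 (y', t') by have [] := nic y' t' H H'.
have p2E y' t' (H : dom (y', t')) (H' : I t') : dot e2 (nu (sph y') t') =
    dot e3 (nu (sph y') t') * p2 (y', t') by have [] := nic y' t' H H'.
have [_ _ N3] := nic y t dq It.
have rad1 := slope_radial oU0 sF XF e11 e22 e33 e12 e31 e32 principal p1E dq It.
have rad2 := slope_radial oU0 sF XF e11 e22 e33 e12 e31 e32 principal p2E dq It.
have Dp1 w : 'D_(w, 0) p1 (y, t) = _ := direction_span w sp1 dq b0 rad1.
have Dp2 w : 'D_(w, 0) p2 (y, t) = _ := direction_span w sp2 dq b0 rad2.
have DY e w := etrans (esym (derive_coordinate oU0 sF XF e w U1q It))
  (direction_span w (smooth_coordinate oU0 sF e) U1q b0 (coordinate_radial F e U1q)).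
have rate1 w k := slope_rate (w := w) (k := k) oU0 sF sp1 p1E dq It.
have rate2 w k := slope_rate (w := w) (k := k) oU0 sF sp2 p2E dq It.
have Jr r : regular_domain r -> jacobian_fun p1 p2 d1 d2 r != 0 by case.
have regq : regular_domain (y, t) by [].
have Ex f := frame_expansion dt (p1 := p1) (p2 := p2) (d1 := d1) (d2 := d2) Jr f regq.
have h w e A B : A = frame1 p1 p2 dt d1 d2 (coordinate F e) (y, t) ->
    B = frame2 p1 p2 dt d1 d2 (coordinate F e) (y, t) ->
    dot e ('D_w (fun y => X (sph y) t) y) =
    'D_(w, 0) p1 (y, t) * A + 'D_(w, 0) p2 (y, t) * B.
  move=> -> ->; have [E1 E2] := Ex (coordinate F e).
  by rewrite (Dp1 w) (Dp2 w) (DY e w); exact: frame_combination E1 E2.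
have T1 := tangent_direction oU0 sF XF e3 w1 dq It.
have T2 := tangent_direction oU0 sF XF e3 w2 dq It.
have R11 := rate1 X w1 _ dN1 DN1; have R12 := rate2 X w1 _ dN1 DN1.
have R21 := rate1 X w2 _ dN2 DN2; have R22 := rate2 X w2 _ dN2 DN2.
have H11 := h w1 e1 _ _ erefl erefl; have H12 := h w1 e2 _ _ erefl erefl.
have H21 := h w2 e1 _ _ erefl erefl; have H22 := h w2 e2 _ _ erefl erefl.
have kn1 := lt0r_neq0 k10; have kn2 := lt0r_neq0 k20.
have L11 := etrans (esym (pars _ _)) l11; have L22 := etrans (esym (pars _ _)) l22.
have L12 := etrans (esym (pars _ _)) l12.
rewrite -!expr2 in L11; rewrite -!expr2 in L22.
exact: (curvature_radii L11 L22 L12 T1 T2 kn1 kn2 N3 R11 R12 R21 R22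
  H11 H12 H21 H22).
Qed.

End radii.

(** * Roundness and speed as exponentials *)

Section roundness_formulas.
Context {R : realType}.
Variables (beta m d s g r1 r2 : R).
Hypotheses (m0 : 0 < m) (d0 : 0 < d) (rr : r1 * r2 = m ^+ 2 * d)
  (rs : (r1 + r2) ^+ 2 = m * s ^+ 2) (gE : g = s ^+ 2 - 4 * m * d).

Let ln_rr : ln (r1 * r2) = 2 * ln m + ln d.
Proof.
rewrite rr lnM ?posrE ?exprn_gt0// lnXn//.
by rewrite mulr_natl.
Qed.

(** Here (r1 - r2)^2 = m g. No logarithm of g is taken, so this form holds at umbilics too and
    serves for continuity; the next one requires g > 0. *)
Lemma roundness_expR :
  roundness (2 * beta) r1 r2 = m * g * expR (- (2 * beta) * (2 * ln m + ln d)).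
Proof.
have rr0 : 0 < r1 * r2 by rewrite rr mulr_gt0 ?exprn_gt0.
rewrite /roundness /powR gt_eqF// ln_rr -expRN -mulNr; congr (_ * _).
transitivity ((r1 + r2) ^+ 2 - 4 * (r1 * r2)); first by ring.
by rewrite rs rr gE; ring.
Qed.

Lemma roundness_expR_ln : 0 < g -> roundness (2 * beta) r1 r2 =
  expR (ln g - 2 * beta * ln d + (1 - 4 * beta) * ln m).
Proof.
move=> g0; rewrite roundness_expR.
have [mE gE'] : m = expR (ln m) /\ g = expR (ln g) by rewrite !lnK.
rewrite [in LHS]gE' [X in X * _ * _]mE -!expRD; congr expR; ring.
Qed.

(** With n = mu^(-1/2), the factor n m = sqrt mu converts the speed along the unit normal into the
    speed measured against (p1, p2, 1). *)
Lemma speed_expR (k1 k2 n : R) : r1 = k1^-1 -> r2 = k2^-1 ->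
  0 < n -> n ^+ 2 * m = 1 ->
  (k1 * k2) `^ beta * (n * m) = expR (- beta * ln d + (2^-1 - 2 * beta) * ln m).
Proof.
move=> r1E r2E n0 nm.
have rr0 : 0 < r1 * r2 by rewrite rr mulr_gt0 ?exprn_gt0.
have kk : k1 * k2 = (r1 * r2)^-1 by rewrite r1E r2E invfM !invrK.
have lnn : ln n = - (2^-1 * ln m).
  have : ln (n ^+ 2 * m) = 0 by rewrite nm ln1.
  by rewrite lnM ?posrE ?exprn_gt0// lnXn// => E; lra.
rewrite kk /powR gt_eqF ?invr_gt0// lnV ?posrE// ln_rr.
rewrite -[n * m]lnK ?posrE ?mulr_gt0// -expRD lnM ?posrE// lnn.
by congr expR; field.
Qed.

End roundness_formulas.

(** * The chart adapted to the principal directions at one point *)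

Section chart_roundness.
Context {R : realType}.
Local Notation E := ('rV[R]_3 * R)%type.
Variables (I : set R) (X nu : 'rV[R]_3 -> R -> 'rV[R]_3).
Variables (U0 : set E) (F : E -> 'rV[R]_3).
Hypotheses (oU0 : open U0) (sF : smooth U0 F)
  (XF : forall x t, sphere2 x -> I t -> U0 (x, t) -> X x t = F (x, t)).
Variables (k1 k2 : 'rV[R]_3 -> R -> R).
Hypothesis principal : forall y t, 0 < dot y y -> I t ->
  exists w1 w2, principal_directions X nu y t (k1 (sph y) t) (k2 (sph y) t) w1 w2.
Hypothesis k_gt0 : forall x t, sphere2 x -> I t -> 0 < k1 x t /\ 0 < k2 x t.

Variables (x0 : 'rV[R]_3) (t0 : R) (v1 v2 e1 e2 e3 : 'rV[R]_3).
Hypotheses (Sx0 : sphere2 x0) (It0 : I t0) (U0q0 : U0 (x0, t0))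
  (tv1 : tangent x0 v1) (tv2 : tangent x0 v2).
Hypotheses (e11 : dot e1 e1 = 1) (e22 : dot e2 e2 = 1) (e33 : dot e3 e3 = 1)
  (e12 : dot e1 e2 = 0) (e31 : dot e3 e1 = 0) (e32 : dot e3 e2 = 0).
Let XS (y : 'rV[R]_3) := X (sph y) t0.
Let NS (y : 'rV[R]_3) := nu (sph y) t0.
Hypotheses (DX1 : 'D_v1 XS x0 = e1) (DX2 : 'D_v2 XS x0 = e2) (NS0 : NS x0 = e3).
Hypotheses (dN1 : derivable NS x0 v1) (dN2 : derivable NS x0 v2)
  (DN1 : 'D_v1 NS x0 = k1 x0 t0 *: 'D_v1 XS x0)
  (DN2 : 'D_v2 NS x0 = k2 x0 t0 *: 'D_v2 XS x0).

Let q0 : E := (x0, t0).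

Let dom := chart_domain U0 F v1 v2 e1 e2.
Let p1 := slope1 F v1 v2 e1 e2 e3.
Let p2 := slope2 F v1 v2 e1 e2 e3.
Let Y1 := coordinate F e1.
Let Y2 := coordinate F e2.
Let Y3 := coordinate F e3.
Let d1 := diff_dir v1.
Let d2 := diff_dir v2.
Let dt : (E -> R) -> E -> R := @diff_time R.
Let reg := regular_domain U0 F v1 v2 e1 e2 e3.

Let U1q0 : (off_axis `&` sphere_proj @^-1` U0) q0.
Proof.
split; first exact: sphere2_gt0.
by rewrite /sphere_proj /preimage /= sph_id.
Qed.

Let d1Y e : d1 (coordinate F e) q0 = dot e e1.
Proof. by rewrite -DX1; exact (derive_coordinate oU0 sF XF e v1 U1q0 It0). Qed.
Let d2Y e : d2 (coordinate F e) q0 = dot e e2.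
Proof. by rewrite -DX2; exact (derive_coordinate oU0 sF XF e v2 U1q0 It0). Qed.

(** Otherwise, by the Gram identity, the combination |v1|^2 v2 - (v1.v2) v1 vanishes. The
    differential of X sends it to |v1|^2 e2 - (v1.v2) e1, whose e2 component yields v1 = 0, against
    |e1| = 1. *)
Let base_det_neq0 : base_det v1 v2 q0 != 0.
Proof.
have := det3_gram Sx0 tv1 tv2; rewrite /base_det /= => gram.
apply/eqP => b0; move: gram; rewrite b0 expr0n /= => /esym/eqP.
rewrite subr_eq0 expr2 => /eqP gram.
pose u := dot v1 v1 *: v2 - dot v1 v2 *: v1.
have u0 : u = 0.
  apply: dot_eq0; rewrite /u.
  transitivity (dot v1 v1 * (dot v1 v1 * dot v2 v2 - dot v1 v2 * dot v1 v2)).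
    by rewrite !dot3E !mxE; ring.
  by rewrite gram subrr mulr0.
have D a b e : 'D_(a *: v2 + b *: v1, 0) (coordinate F e) q0 =
    a * dot e e2 + b * dot e e1.
  have df := smooth_differentiable (smooth_coordinate oU0 sF e) U1q0.
  rewrite -d1Y -d2Y /d1 /d2 /diff_dir !(deriveE _ df).
  have -> : ((a *: v2 + b *: v1, 0) : E) =
      a *: ((v2, 0) : E) + (b *: ((v1, 0) : E) + 0).
    by apply/pair_equal_spec; split => /=; rewrite ?addr0// !scaler0 !addr0.
  by rewrite !linearP linear0 addr0.
have uE : u = dot v1 v1 *: v2 + - dot v1 v2 *: v1 by rewrite scaleNr.
have := D (dot v1 v1) (- dot v1 v2) e2; rewrite -uE u0 -(dotC e1) e12 e22.
rewrite -[((0, 0) : E)]/(0 : E) derive0 mulr1 mulr0 addr0 => /esym/dot_eq0 v10.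
have := e11; rewrite -DX1 v10 derive0 dot0r => /esym/eqP.
by rewrite oner_eq0.
Qed.

Let n3q0 : normal3 F v1 v2 e1 e2 q0 = 1.
Proof.
transitivity (dot e1 e1 * dot e2 e2 - dot e2 e1 * dot e1 e2).
  exact (congr2 (fun a b => a - b) (congr2 *%R (d1Y e1) (d2Y e2))
    (congr2 *%R (d1Y e2) (d2Y e1))).
by rewrite e11 e22 e12; ring.
Qed.

Let dom_q0 : dom q0.
Proof. by split; [split=> //; rewrite /= n3q0 oner_neq0|exact: base_det_neq0]. Qed.

Let slope_q0 : p1 q0 = 0 /\ p2 q0 = 0.
Proof.
have [A B _] :=
  normal_in_chart oU0 sF XF e11 e22 e33 e12 e31 e32 principal dom_q0 It0.
have N0 : nu (sph x0) t0 = e3 := NS0.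
rewrite N0 e33 mul1r dotC e31 in A; rewrite N0 e33 mul1r dotC e32 in B.
by split; apply: esym; [exact: A|exact: B].
Qed.

Let kq0 := k_gt0 Sx0 It0.

Let slope_diff_q0 : [/\ d1 p1 q0 = k1 x0 t0, d1 p2 q0 = 0, d2 p1 q0 = 0 &
  d2 p2 q0 = k2 x0 t0].
Proof.
have [sp1 sp2] := smooth_slopes oU0 sF v1 v2 e1 e2 e3.
have nic y' t' (H : dom (y', t')) (H' : I t') :=
  normal_in_chart oU0 sF XF e11 e22 e33 e12 e31 e32 principal H H'.
have p1E y' t' (H : dom (y', t')) (H' : I t') : dot e1 (nu (sph y') t') =
    dot e3 (nu (sph y') t') * p1 (y', t') by have [] := nic y' t' H H'.
have p2E y' t' (H : dom (y', t')) (H' : I t') : dot e2 (nu (sph y') t') =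
    dot e3 (nu (sph y') t') * p2 (y', t') by have [] := nic y' t' H H'.
have [p10 p20] := slope_q0.
have N0 : nu (sph x0) t0 = e3 := NS0.
have D1 : 'D_v1 (fun y => X (sph y) t0) x0 = e1 := DX1.
have D2 : 'D_v2 (fun y => X (sph y) t0) x0 = e2 := DX2.
have R11 := slope_rate oU0 sF sp1 p1E dom_q0 It0 dN1 DN1.
have R12 := slope_rate oU0 sF sp2 p2E dom_q0 It0 dN1 DN1.
have R21 := slope_rate oU0 sF sp1 p1E dom_q0 It0 dN2 DN2.
have R22 := slope_rate oU0 sF sp2 p2E dom_q0 It0 dN2 DN2.
rewrite /= N0 D1 e33 in R11.
rewrite /= N0 D1 e33 in R12.
rewrite /= N0 D2 e33 in R21.
rewrite /= N0 D2 e33 in R22.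
have clean (d k u p v : R) : 1 * d = k * (u - p * v) -> p = 0 -> d = k * u.
  by move=> + p0; rewrite p0 mul1r mul0r subr0.
split.
- by apply: (etrans (clean _ _ _ _ _ R11 p10)); rewrite e11 mulr1.
- by apply: (etrans (clean _ _ _ _ _ R12 p20)); rewrite dotC e12 mulr0.
- by apply: (etrans (clean _ _ _ _ _ R21 p10)); rewrite e12 mulr0.
- by apply: (etrans (clean _ _ _ _ _ R22 p20)); rewrite e22 mulr1.
Qed.

Let reg_q0 : reg q0.
Proof.
split; first exact: dom_q0.
have [E11 E12 E21 E22] := slope_diff_q0; have [k10 k20] := kq0.
rewrite /= jacobian_funE -/p1 -/p2 -/d1 -/d2 E11 E22 E12 mul0r subr0.
by rewrite mulf_neq0 ?lt0r_neq0.
Qed.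

Let s11 := frame1 p1 p2 dt d1 d2 Y1.
Let s12 := frame1 p1 p2 dt d1 d2 Y2.
Let s22 := frame2 p1 p2 dt d1 d2 Y2.

Let hessian_q0 : [/\ s11 q0 = (k1 x0 t0)^-1, s12 q0 = 0 & s22 q0 = (k2 x0 t0)^-1].
Proof.
have [E11 E12 E21 E22] := slope_diff_q0; have [k10 k20] := kq0.
have [kn1 kn2] := (lt0r_neq0 k10, lt0r_neq0 k20).
have JE : jacobian_fun p1 p2 d1 d2 q0 = k1 x0 t0 * k2 x0 t0.
  by rewrite jacobian_funE E11 E22 E12 mul0r subr0.
have [Y11 Y12] := (d1Y e1, d1Y e2); have [Y21 Y22] := (d2Y e1, d2Y e2).
rewrite /s11 /s12 /s22 !frame1E !frame2E JE E11 E12 E21 E22.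
rewrite [d1 Y1 q0]Y11 [d1 Y2 q0]Y12 [d2 Y2 q0]Y22 e11 e22 (dotC e2) e12.
by split; field; rewrite ?kn1 ?kn2.
Qed.

Let odom : open dom. Proof. exact: open_chart_domain. Qed.
Let sp_dom : smooth dom p1 /\ smooth dom p2 := smooth_slopes oU0 sF v1 v2 e1 e2 e3.
Let oreg : open reg.
Proof.
have sJ : smooth dom (jacobian_fun p1 p2 d1 d2).
  exact (smooth_jacobian odom (derive_derivation odom (v1, 0))
    (derive_derivation odom (v2, 0)) sp_dom.1 sp_dom.2).
exact (open_neq0_on odom sJ).
Qed.
Let ddt : derivation reg dt := derive_derivation oreg (0, 1).
Let dd1 : derivation reg d1 := derive_derivation oreg (v1, 0).
Let dd2 : derivation reg d2 := derive_derivation oreg (v2, 0).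
Let reg_dom : reg `<=` dom. Proof. by move=> q []. Qed.
Let reg_U1 : reg `<=` off_axis `&` sphere_proj @^-1` U0.
Proof. by move=> q [[[]]]. Qed.
Let sp1 : smooth reg p1. Proof. exact: smooth_subset sp_dom.1. Qed.
Let sp2 : smooth reg p2. Proof. exact: smooth_subset sp_dom.2. Qed.
Let sY e : smooth reg (coordinate F e).
Proof. exact: (smooth_subset reg_U1 (smooth_coordinate oU0 sF e)). Qed.
Let jac0 q : reg q -> jacobian_fun p1 p2 d1 d2 q != 0. Proof. by case. Qed.
Let dD1 : derivation reg (frame1 p1 p2 dt d1 d2) :=
  frame1_derivation oreg ddt dd1 dd2 sp1 sp2 jac0.
Let dD2 : derivation reg (frame2 p1 p2 dt d1 d2) :=
  frame2_derivation oreg ddt dd1 dd2 sp1 sp2 jac0.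
Let ss11 : smooth reg s11 := der_smooth dD1 (sY e1).
Let ss12 : smooth reg s12 := der_smooth dD1 (sY e2).
Let ss22 : smooth reg s22 := der_smooth dD2 (sY e2).
Let comm12 f q (sf : smooth reg f) (Uq : reg q) : d1 (d2 f) q = d2 (d1 f) q :=
  derive_comm (v1, 0) (v2, 0) oreg sf Uq.
Let commt1 f q (sf : smooth reg f) (Uq : reg q) : dt (d1 f) q = d1 (dt f) q :=
  derive_comm ((0, 1) : E) ((v1, 0) : E) oreg sf Uq.
Let commt2 f q (sf : smooth reg f) (Uq : reg q) : dt (d2 f) q = d2 (dt f) q :=
  derive_comm ((0, 1) : E) ((v2, 0) : E) oreg sf Uq.
Let tan1 q (Uq : reg q) : p1 q * d1 Y1 q + p2 q * d1 Y2 q + d1 Y3 q = 0 :=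
  (slopes_tangent e3 (reg_dom Uq)).1.
Let tan2 q (Uq : reg q) : p1 q * d2 Y1 q + p2 q * d2 Y2 q + d2 Y3 q = 0 :=
  (slopes_tangent e3 (reg_dom Uq)).2.

Let hess_sym q : reg q -> frame2 p1 p2 dt d1 d2 Y1 q = s12 q.
Proof.
exact: (frame_hessian_sym oreg ddt dd1 dd2 comm12 commt1 commt2 sp1 sp2
  (sY e1) (sY e2) (sY e3) jac0 tan1 tan2).
Qed.

Let tr := tr_fun p1 p2 s11 s12 s22.
Let det := det_fun s11 s12 s22.
Let gap := gap_fun p1 p2 s11 s12 s22.
Let mu := mu_fun p1 p2.
Let good : set E := reg `&` [set q | 0 < tr q] `&` [set q | 0 < det q].

Let str : smooth reg tr. Proof. exact: smooth_tr. Qed.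
Let sdet : smooth reg det. Proof. exact: smooth_det. Qed.
Let sgap : smooth reg gap. Proof. exact: smooth_gap. Qed.
Let smu : smooth reg mu. Proof. exact: smooth_mu. Qed.

Let ogood : open good.
Proof.
apply: open_gt0_on; first exact: open_gt0_on.
by apply: smooth_subset sdet => q [].
Qed.

Let good_q0 : good q0.
Proof.
have [E11 E12 E22] := hessian_q0; have [k10 k20] := kq0.
have [P1 P2] := slope_q0.
have [r10 r20] : 0 < (k1 x0 t0)^-1 /\ 0 < (k2 x0 t0)^-1 by rewrite !invr_gt0.
split; first split; first exact: reg_q0.
  rewrite /= /tr tr_funE E11 E12 E22 P1 P2 expr0n !addr0 !mul1r mulr0 addr0.
  exact: addr_gt0.
by rewrite /= /det det_funE E11 E12 E22 mulr0 subr0 mulr_gt0.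
Qed.

(* [nu] is not assumed to be continuous: it agrees with the smooth normal
   (p1, p2, 1) / sqrt mu up to a sign, and the sign is fixed by convexity,
   since (r1 + r2) N3 = tr > 0. *)
Let chart_facts y t : good (y, t) -> I t ->
  let r1 := (k1 (sph y) t)^-1 in let r2 := (k2 (sph y) t)^-1 in
  let N := nu (sph y) t in let q := (y, t) in
  [/\ r1 * r2 = mu q ^+ 2 * det q, (r1 + r2) ^+ 2 = mu q * tr q ^+ 2,
      0 < dot e3 N, dot e3 N ^+ 2 * mu q = 1 &
      dot e1 N = dot e3 N * p1 q /\ dot e2 N = dot e3 N * p2 q].
Proof.
move=> [[regq tr0] det0] It r1 r2 N q; have [[y0 _]] := reg_U1 regq.
have [k10 k20] := k_gt0 (sph_sphere2 y0) It.
have [E1 E2] :=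
  radii_in_chart oU0 sF XF e11 e22 e33 e12 e31 e32 principal k_gt0 regq It.
have [N1 N2 N3] :=
  normal_in_chart oU0 sF XF e11 e22 e33 e12 e31 e32 principal (reg_dom regq) It.
have sym := hess_sym regq.
have {}E1 : r1 * r2 = mu q ^+ 2 * det q.
  by apply: (etrans E1); rewrite sym /mu mu_funE /det det_funE.
have {}E2 : (r1 + r2) * dot e3 N = tr q.
  rewrite /tr tr_funE; apply: (etrans E2); rewrite sym.
  by rewrite -/s12 -/s11 -/s22 -/p1 -/p2 -/q; ring.
have r0 : 0 < r1 + r2 by rewrite addr_gt0 ?invr_gt0.
have {}N3 : dot e3 N ^+ 2 * mu q = 1 by exact: N3.
split=> //; last by move: tr0; rewrite /= -/q -E2 pmulr_rgt0.
by rewrite -E2 exprMn mulrCA -[LHS]mulr1 -N3 (mulrC (mu q)).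
Qed.

Variable beta : R.
Let rho (x : 'rV[R]_3) t := roundness (2 * beta) (k1 x t)^-1 (k2 x t)^-1.

(** [Q] is smooth near q0 even if q0 is an umbilic or t0 = 0: it avoids the logarithm of [gap], and
    it reaches times outside [I] through the extension [F]. *)
Lemma chart_continuity : exists2 Q : E -> R, {for q0, continuous Q} &
  \forall q \near q0, sphere2 q.1 -> I q.2 -> rho q.1 q.2 = Q q.
Proof.
have sub : good `<=` reg by move=> q [[]].
have det0 q : good q -> 0 < det q by move=> [_].
have [smu' sgap' sdet'] := And3 (smooth_subset sub smu) (smooth_subset sub sgap)
  (smooth_subset sub sdet).
have sc c : smooth good (cst c : E -> R) by exact: smooth_cst.
have slm := smooth_ln ogood (fun p _ => mu_fun_gt0 p1 p2 p) smu'.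
have sld := smooth_ln ogood det0 sdet'.
pose Q := mu * gap *
  (expR \o (cst (- (2 * beta)) * (cst 2 * (@ln R \o mu) + (@ln R \o det)))).
have sQ : smooth good Q.
  apply: (smoothM ogood); first exact: (smoothM ogood).
  apply: (smooth_expR ogood); apply: (smoothM ogood) => //.
  by apply: (smoothD ogood) => //; apply: (smoothM ogood).
exists Q; first exact: smooth_continuous sQ good_q0.
have : \forall q \near q0, good q by exact: open_nbhs_nbhs.
apply: filterS => -[x t] gq /= Sx It.
have [E1 E2 _ _ _] := chart_facts gq It; rewrite sph_id// in E1 E2.
exact (roundness_expR beta (mu_fun_gt0 p1 p2 (x, t)) (det0 _ gq) E1 E2
  (gap_funE p1 p2 s11 s12 s22 (x, t))).
Qed.

Variable O : set R.
Hypotheses (oO : open O) (Ot0 : O t0) (OI : O `<=` I).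
Hypothesis flow : forall x t, sphere2 x -> O t ->
  is_derive t 1 (X x) (- ((k1 x t * k2 x t) `^ beta *: nu x t)).

(** Nearby non-umbilic points, at times where the flow holds as a two-sided derivative: there [G] is
    the logarithm of the roundness and satisfies the evolution equation. *)
Let peak : set E := good `&` [set q | 0 < gap q] `&` [set q | O q.2].

Let opeak : open peak.
Proof.
have sub : good `<=` reg by move=> q [[]].
have o1 : open (good `&` [set q | 0 < gap q]).
  exact: (open_gt0_on ogood (smooth_subset sub sgap)).
apply: (open_preimage_on (g := fun q : E => q.2) o1 oO) => q _.
exact: cvg_snd.
Qed.

Let G := log_roundness beta p1 p2 s11 s12 s22.

Let rhoE y t : peak (y, t) -> rho (sph y) t = expR (G (y, t)).
Proof.
move=> [[gq gap0] Ot]; have [E1 E2 _ _ _] := chart_facts gq (OI Ot).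
rewrite /G log_roundnessE.
exact (roundness_expR_ln beta (mu_fun_gt0 p1 p2 (y, t)) gq.2 E1 E2
  (gap_funE p1 p2 s11 s12 s22 (y, t)) gap0).
Qed.

Let dtY e y t : peak (y, t) -> dt (coordinate F e) (y, t) =
  - ((k1 (sph y) t * k2 (sph y) t) `^ beta * dot e (nu (sph y) t)).
Proof.
move=> pq; have [[[[regq _] _] _] Ot] := pq; have [[y0 _]] := reg_U1 regq.
have [dX DX] := flow (sph_sphere2 y0) Ot.
have [_ dotE] := is_derive_dot e dX.
rewrite -dotZr -dotNr -DX -dotE /dt /diff_time derive_time.
apply: near_eq_derive.
have ct : {for t, continuous (fun s : R => (y, s) : E)}.
  have c1 : {for t, continuous (fun s : R => s)} by exact: cvg_id.
  have c2 : {for t, continuous (fun _ : R => y)}.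
    by apply: cvg_cst; exact: (nbhs_filter t).
  exact: (cvg_pair c2 c1).
have : \forall s \near t, peak (y, s) by apply: ct; exact: open_nbhs_nbhs.
apply: filterS => s [[[[regs _] _] _] Os].
exact: (coordinateE XF e (reg_U1 regs) (OI Os)).
Qed.

Let support_speed q : peak q -> p1 q * dt Y1 q + p2 q * dt Y2 q + dt Y3 q =
  - expR (log_speed beta p1 p2 s11 s12 s22 q).
Proof.
case: q => y t pq; rewrite (dtY e1 pq) (dtY e2 pq) (dtY e3 pq).
have [[gq gap0] Ot] := pq; have [E1 E2 n0 nm [N1 N2]] := chart_facts gq (OI Ot).
have := speed_expR beta (mu_fun_gt0 p1 p2 (y, t)) gq.2 E1 erefl erefl n0 nm.
rewrite log_speedE -/det -/mu => <-; rewrite N1 N2 /mu mu_funE.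
move: (p1 (y, t)) (p2 (y, t)) (dot e3 _) (_ `^ beta) => a b c k; ring.
Qed.

(** At a positive spatial maximum the evolution equation gives dt G <= 0, whereas a backward
    decrease at rate eps would give dt G >= eps / rho > 0. *)
Lemma chart_max_point : 1 <= 2 * beta <= 2 -> 0 < rho x0 t0 ->
  (forall x, sphere2 x -> rho x t0 <= rho x0 t0) ->
  forall eps r, 0 < eps -> 0 < r ->
  ~ (forall s, 0 < s < r -> rho x0 (t0 - s) <= rho x0 t0 - eps * s).
Proof.
move=> beta12 rho0 rhomax eps r eps0 r0 decr.
have gap0 : 0 < gap q0.
  have [E1 E2 _ _ _] := chart_facts good_q0 It0; rewrite sph_id// in E1 E2.
  have := roundness_expR beta (mu_fun_gt0 p1 p2 q0) good_q0.2 E1 E2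
    (gap_funE p1 p2 s11 s12 s22 q0).
  move: rho0; rewrite /rho => + E; rewrite E.
  by rewrite pmulr_lgt0 ?expR_gt0// pmulr_rgt0 ?mu_fun_gt0.
have pq0 : peak q0 by split; first split.
have sub : peak `<=` reg by move=> q [[[[]]]].
have S (f : E -> R) : smooth reg f -> smooth peak f by exact: smooth_subset.
have gapP q : peak q -> 0 < gap q by move=> [[]].
have detP q : peak q -> 0 < det q by move=> [[[_]]].
have sG : smooth peak G.
  exact (smooth_log_roundness opeak beta (S _ sp1) (S _ sp2) (S _ ss11)
    (S _ ss12) (S _ ss22) gapP detP).
have rho_q0 : rho x0 t0 = expR (G q0) by rewrite -(rhoE pq0) sph_id.
(* As [G] at (y, t0) depends only on the ray of y, a maximum over the sphere is a local maximum in
   space. *)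
have space_max v : 'D_(v, 0) G q0 = 0 /\
    'D_(v, 0) ('D_(v, 0) G) q0 <= 0.
  have /nbhs_ballP[h /= h0 hP] := near_ray (v, 0) opeak pq0.
  apply: (local_max_derive opeak sG pq0 h0) => s sh.
  have : peak (s *: ((v, 0) : E) + q0).
    by apply: hP; rewrite /ball /= sub0r normrN.
  have -> : s *: ((v, 0) : E) + q0 = (s *: v + x0, t0).
    by apply/pair_equal_spec; split => //=; rewrite scaler0 add0r.
  move=> ps; rewrite -ler_expR -rho_q0 -(rhoE ps); apply: rhomax.
  by apply: sph_sphere2; have [[[[regs _] _] _] _] := ps; have [[]] := reg_U1 regs.
have [G1 G11] := space_max v1; have [G2 G22] := space_max v2.
have [P1 P2] := slope_q0; have [_ d1p2 d2p1 _] := slope_diff_q0.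
have [E11 E12 E22] := hessian_q0; have [k10 k20] := kq0.
have s110 : 0 < s11 q0 by rewrite E11 invr_gt0.
have s220 : 0 < s22 q0 by rewrite E22 invr_gt0.
have s1122 : s11 q0 != s22 q0.
  apply/eqP => E; move: rho0; rewrite /rho /roundness -E11 -E22 E.
  by rewrite subrr expr0n mul0r ltxx.
have Gt : dt G q0 <= 0.
  apply: (@parametrized_flow_max_point _ _ peak opeak beta p1 p2 Y1 Y2 Y3
    dt d1 d2 (derive_derivation opeak _) (derive_derivation opeak _)
    (derive_derivation opeak _) _ _ _ (S _ sp1) (S _ sp2) (S _ (sY e1))
    (S _ (sY e2)) (S _ (sY e3)) _ _ _ gapP detP support_speed q0 pq0 beta12
    P1 P2 d1p2 d2p1 s110 s220 E12 s1122 G1 G2 G11 G22).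
  - move=> f q sf Uq; exact (derive_comm ((v1, 0) : E) ((v2, 0) : E) opeak sf Uq).
  - move=> f q sf Uq; exact (derive_comm ((0, 1) : E) ((v1, 0) : E) opeak sf Uq).
  - move=> f q sf Uq; exact (derive_comm ((0, 1) : E) ((v2, 0) : E) opeak sf Uq).
  - by move=> q /sub /jac0.
  - by move=> q /sub /tan1.
  - by move=> q /sub /tan2.
have /nbhs_ballP[h /= h0 hP] := near_ray ((0, -1) : E) opeak pq0.
pose m := Num.min h r.
have m0 : 0 < m by rewrite lt_min h0.
have : 'D_((0, -1) : E) G q0 <= - (eps / rho x0 t0).
  apply: (derive_le opeak sG pq0 m0) => s /andP[s0]; rewrite lt_min => /andP[sh sr].
  have : peak (s *: ((0, -1) : E) + q0).
    by apply: hP; rewrite /ball /= sub0r normrN gtr0_norm.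
  have -> : s *: ((0, -1) : E) + q0 = (x0, t0 - s).
    apply/pair_equal_spec; split => /=; first by rewrite scaler0 add0r.
    by rewrite -[s *: -1]/(s * -1) mulrN1 addrC.
  move=> ps; rewrite -ler_expR -(rhoE ps) sph_id// expRD -rho_q0.
  have : rho x0 (t0 - s) <= rho x0 t0 - eps * s by apply: decr; rewrite s0.
  (* Dividing by rho leaves 1 - eps s / rho, which is at most exp(- eps s / rho). *)
  move/le_trans; apply; rewrite -ler_pdivrMl//.
  apply: le_trans (expR_ge1Dx _).
  by rewrite mulrBr mulVf ?lt0r_neq0// mulNr mulrA (mulrC (rho _ _)^-1).
have dG := smooth_differentiable sG pq0.
have -> : 'D_((0, -1) : E) G q0 = - dt G q0.
  have -> : ((0, -1) : E) = - ((0, 1) : E).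
    by apply/pair_equal_spec; split => //=; rewrite oppr0.
  by rewrite /dt /diff_time !(deriveE _ dG) linearN.
rewrite lerN2 => H.
have := lt_le_trans (divr_gt0 eps0 rho0) (le_trans H Gt).
by rewrite ltxx.
Qed.

End chart_roundness.

(** * The maximum principle *)

Section sphere_topology.
Context {R : realType}.

Lemma compact_sphere2 : compact (@sphere2 R).
Proof.
apply: bounded_closed_compact.
  exists 1; split=> // M M1 x Sx; rewrite /= [leLHS]mx_normrE.
  apply: bigmax_le; first exact: le_trans ler01 (ltW M1).
  move=> [i j] _ /=; rewrite (ord1 i) (le_trans _ (ltW M1))//.
  rewrite -[leRHS]normr1 -ler_sqr ?nnegrE// !real_normK ?num_real// expr1n.
  have := Sx; rewrite /sphere2 /= dot3E -!expr2 => <-.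
  have [s0 s1 s2] := And3 (sqr_ge0 (x ord0 i0)) (sqr_ge0 (x ord0 i1))
    (sqr_ge0 (x ord0 i2)).
  by move: j; apply: ord3_ind; lra.
have cdot : continuous (fun x : 'rV[R]_3 => dot x x).
  move=> x; apply: (@smooth_continuous _ _ _ setT) => //.
  have se i : smooth setT (fun x : 'rV[R]_3 => x ord0 i).
    apply: smooth_linear; first by move=> a u v; rewrite !mxE.
    exact: coord_continuous.
  by apply: (smooth_sum openT) => i; exact: smoothM openT (se i) (se i).
rewrite (_ : @sphere2 R = (fun x => dot x x) @^-1` [set 1])//.
by apply: (closed_comp _ (@closed_eq R 1)) => x _; exact: cdot.
Qed.

End sphere_topology.

Section open_time_interval.
Context {R : realType}.
Variable T : \bar R.

Definition open_time_interval : set R := [set t | 0 < t /\ (t%:E < T)%E].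

Lemma open_open_time_interval : open open_time_interval.
Proof.
rewrite (_ : open_time_interval = [set t | 0 < t] `&` [set t | (t%:E < T)%E])//.
apply: openI; first exact: open_gt.
case: T => [r| |].
- rewrite (_ : [set t | _] = [set t | t < r]); first exact: open_lt.
  by apply/seteqP; split=> t /=; rewrite lte_fin.
- rewrite (_ : [set t | _] = setT); first exact: openT.
  by apply/seteqP; split=> t //= _; rewrite ltry.
- rewrite (_ : [set t | _] = set0); first exact: open0.
  by apply/seteqP; split=> t //=; rewrite ltNge leNye.
Qed.

(** All times close to an interior time lie in [time_interval T], so the restricted limit is the
    full one. *)
Lemma has_time_derivative_interior (f : R -> 'rV[R]_3) t l :
  open_time_interval t -> has_time_derivative T f t l -> is_derive t 1 f l.
Proof.
move=> Ot fl.
have cvl : (fun h : R => h^-1 *: ((f \o shift t) (h *: 1) - f t)) @ 0^' --> l.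
  move=> A /fl /= H.
  have nI : \forall s \near t, time_interval T s.
    have : \forall s \near t, open_time_interval s.
      exact: open_nbhs_nbhs (conj open_open_time_interval Ot).
    by apply: filterS => s [s0 sT]; split=> //; exact: ltW.
  have H' : \forall s \near t, s != t -> A ((s - t)^-1 *: (f s - f t)).
    have {}H : \forall s \near t, s != t -> time_interval T s ->
        A ((s - t)^-1 *: (f s - f t)) by exact: H.
    by apply: filterS2 H nI => s Hs Is st; exact: Hs.
  rewrite (near_shift 0 t) /= subr0 in H'.
  apply: filterS H' => h /= Hh h0.
  have := Hh; rewrite addrK -[X in h + _ != X]add0r (inj_eq (addIr t)).
  by move=> /(_ h0); rewrite [h *: 1]mulr1.
by split; [apply/cvg_ex; exists l|exact: cvg_lim cvl].
Qed.

End open_time_interval.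

Section maximum_principle.
Context {R : realType}.
Local Notation E := ('rV[R]_3 * R)%type.

(* The maximum of [rho - eps t] over the sphere and [0, t1] is attained at a
   positive time, where [rho] would be a spatial maximum decreasing backwards
   in time at rate [eps]. *)
Lemma parabolic_maximum_principle (T : \bar R) (rho : 'rV[R]_3 -> R -> R) :
  (forall x t, sphere2 x -> time_interval T t ->
     exists2 Q : E -> R, {for (x, t), continuous Q} &
       \forall q \near (x, t), sphere2 q.1 -> time_interval T q.2 ->
         rho q.1 q.2 = Q q) ->
  (forall x t, sphere2 x -> open_time_interval T t -> 0 < rho x t ->
     (forall x', sphere2 x' -> rho x' t <= rho x t) ->
     forall eps r, 0 < eps -> 0 < r ->
       ~ (forall s, 0 < s < r -> rho x (t - s) <= rho x t - eps * s)) ->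
  forall m t1 x1, 0 <= m -> (forall x, sphere2 x -> rho x 0 <= m) ->
    sphere2 x1 -> time_interval T t1 -> rho x1 t1 <= m.
Proof.
move=> crho max_rho m t1 x1 m0 rho0 Sx1 [t10 t1T].
rewrite leNgt; apply/negP => m_lt.
have t1n0 : t1 != 0.
  by apply: contraTneq m_lt => ->; rewrite -leNgt rho0.
have t1_gt0 : 0 < t1 by rewrite lt0r t1n0.
(* With this choice eps t1 is half of the excess over m, so rho - eps t still exceeds m at (x1, t1),
   and hence at its maximum. This excludes t = 0 there and, as m >= 0, makes rho positive there. *)
pose eps := (rho x1 t1 - m) / (2 * t1).
have eps0 : 0 < eps by rewrite divr_gt0 ?subr_gt0// mulr_gt0.
have eps_t1 : eps * t1 = (rho x1 t1 - m) / 2 by rewrite /eps; field.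
pose M : set E := @sphere2 R `*` `[0, t1].
pose f (q : E) : R := rho q.1 q.2 - eps * q.2.
have MI q : M q -> time_interval T q.2.
  move=> [_]; rewrite /= in_itv /= => /andP[q0 q1]; split=> //.
  by apply: le_lt_trans t1T; rewrite lee_fin.
have M1 : M (x1, t1) by split=> //=; rewrite in_itv /= t10 lexx.
have cM : compact M by apply: compact_setX; [exact: compact_sphere2|exact: segment_compact].
have cf : {within M, continuous f}.
  apply/subspace_continuousP => -[x t] Mq.
  have [Q cQ rhoQ] := crho x t Mq.1 (MI _ Mq).
  have sq : smooth (setT : set E) (fun q : E => - eps * q.2).
    by apply: (smoothM openT (f := cst (- eps))); [exact: smooth_cst|exact: smooth_time].
  have cq := smooth_continuous sq (I : setT (x, t)).
  have cQt : {for (x, t), continuous (fun q => Q q + - eps * q.2)}.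
    exact: (cvgD cQ cq).
  have fE : \forall q \near (x, t), M q -> Q q + - eps * q.2 = f q.
    apply: filterS rhoQ => q rq Mq'; rewrite /f mulNr rq//; first exact: Mq'.1.
    exact: MI.
  have : f @ within M (nbhs (x, t)) --> Q (x, t) + - eps * (x, t).2.
    move=> A /cQt QA; have {}QA : \forall q \near (x, t), A (Q q + - eps * q.2).
      exact: QA.
    by apply: filterS2 QA fE => q Aq fq Mq' /=; rewrite -fq.
  by rewrite (nbhs_singleton fE Mq).
have [[x t] + fmax] := compact_EVT_max (ex_intro _ _ M1) cM cf.
rewrite inE => Mq.
have {}fmax q : M q -> f q <= f (x, t) by move=> ?; apply: fmax; rewrite inE.
have [Sx] := Mq; rewrite /= in_itv /= => /andP[t0 tt1].
have rho_gt : m + eps * t < rho x t.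
  have := fmax _ M1; rewrite /f /= eps_t1 => H.
  by have := m_lt; lra.
have tn0 : t != 0.
  apply: contraTneq rho_gt => ->; rewrite mulr0 addr0 -leNgt; exact: rho0.
have t_gt0 : 0 < t by rewrite lt0r tn0.
(* The range 0 < s < t keeps t - s inside [0, t1]. *)
apply: (max_rho x t Sx _ _ _ eps t eps0 t_gt0).
- by split=> //; apply: le_lt_trans t1T; rewrite lee_fin.
- by apply: le_lt_trans rho_gt; rewrite addr_ge0// mulr_ge0// ltW.
- move=> x' Sx'; have := fmax (x', t); rewrite /f /= lerD2r; apply.
  by split=> //=; rewrite in_itv /= t0.
- move=> s /andP[s0 st]; have : M (x, t - s).
    split=> //=; rewrite in_itv /= subr_ge0 (ltW st) /=.
    by rewrite (le_trans _ tt1)// gerBl ltW.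
  by move=> /fmax; rewrite /f /=; move: (rho x t) (rho _ _) => a b; lra.
Qed.

End maximum_principle.

(** * Monotonicity of the supremum along the flow *)

Theorem theorem2p2 (R : realType) (alpha : R) (T : \bar R)
    (X nu : 'rV[R]_3 -> R -> 'rV[R]_3) (k1 k2 r1 r2 : 'rV[R]_3 -> R -> R)
    (halpha : 1 <= alpha <= 2)
    (hsmooth : smooth_on (@sphere2 R `*` time_interval T)
                 (fun p : 'rV[R]_3 * R => X p.1 p.2))
    (hemb : forall t, time_interval T t -> sphere_embedding (X^~ t))
    (hnu : forall t, time_interval T t ->
       outer_unit_normal (X^~ t) (nu^~ t))
    (hk : forall x t, sphere2 x -> time_interval T t ->
       principal_curvatures (X^~ t) (nu^~ t) x (k1 x t) (k2 x t))
    (hconvex : forall x t, sphere2 x -> time_interval T t ->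
       0 < k1 x t /\ 0 < k2 x t)
    (hr : forall x t, sphere2 x -> time_interval T t ->
       r1 x t = (k1 x t)^-1 /\ r2 x t = (k2 x t)^-1)
    (hflow : forall x t, sphere2 x -> time_interval T t ->
       has_time_derivative T (X x) t
         (- (gauss_curvature (k1 x t) (k2 x t) `^ (alpha / 2) *: nu x t))) :
  forall t, time_interval T t ->
    (sup_roundness alpha (r1^~ t) (r2^~ t) <=
     sup_roundness alpha (r1^~ 0%R) (r2^~ 0%R))%E.
Proof.
pose E : normedModType R := ('rV[R]_3 * R)%type.
pose I := time_interval T; pose O := open_time_interval T.
pose beta := alpha / 2.
have alphaE : alpha = 2 * beta by rewrite /beta; field.
have beta12 : 1 <= 2 * beta <= 2 by rewrite -alphaE.
have OI : O `<=` I by move=> t [t0 tT]; split=> //; exact: ltW.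
have principal_at x t : sphere2 x -> I t -> exists v1 v2,
    [/\ tangent x v1, tangent x v2 &
      principal_directions X nu x t (k1 x t) (k2 x t) v1 v2].
  move=> Sx It; have [v1 [v2 [[tv1 tv2] [u11 u22 u12] D1 D2]]] := hk x t Sx It.
  have [k10 k20] := hconvex x t Sx It.
  exists v1, v2; split; [exact: tv1|exact: tv2|].
  exact (principal_directions_sphere Sx (hnu t It) (lt0r_neq0 k10)
    (lt0r_neq0 k20) tv1 tv2 u11 u22 u12 D1 D2).
have principal y t : 0 < dot y y -> I t -> exists w1 w2,
    principal_directions X nu y t (k1 (sph y) t) (k2 (sph y) t) w1 w2.
  move=> y0 It; have [v1 [v2 [_ _ pd]]] := principal_at _ _ (sph_sphere2 y0) It.
  (* Scaling by |y| carries the principal directions at [sph y] out to y. *)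
  exists (enorm y *: v1), (enorm y *: v2).
  have := principal_directions_scale (enorm_gt0 y0) pd.
  by rewrite enorm_sphE.
have flow x t : sphere2 x -> O t ->
    is_derive t 1 (X x) (- ((k1 x t * k2 x t) `^ beta *: nu x t)).
  move=> Sx Ot; apply: (has_time_derivative_interior Ot).
  exact: (hflow x t Sx (OI t Ot)).
pose rho x t := roundness (2 * beta) (k1 x t)^-1 (k2 x t)^-1.
have rhoE x t : sphere2 x -> I t -> roundness alpha (r1 x t) (r2 x t) = rho x t.
  by move=> Sx It; have [-> ->] := hr x t Sx It; rewrite alphaE.
have chart x0 t0 : sphere2 x0 -> I t0 ->
  (exists2 Q : E -> R, {for (x0, t0), continuous Q} &
     \forall q \near (x0, t0), sphere2 q.1 -> I q.2 -> rho q.1 q.2 = Q q) /\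
  (O t0 -> 0 < rho x0 t0 -> (forall x, sphere2 x -> rho x t0 <= rho x0 t0) ->
    forall eps r, 0 < eps -> 0 < r ->
      ~ (forall s, 0 < s < r -> rho x0 (t0 - s) <= rho x0 t0 - eps * s)).
  move=> Sx0 It0.
  have [v1 [v2 [tv1 tv2 [[e11 e22 e12] NN [Ne1 Ne2] [dN1 DN1] [dN2 DN2]]]]] :=
    principal_at x0 t0 Sx0 It0.
  have [U [F [oU Uq sF XF]]] := hsmooth (x0, t0) (conj Sx0 It0).
  have XF' x t : sphere2 x -> I t -> U (x, t) -> X x t = F (x, t).
    by move=> Sx It; apply: (XF (x, t)).
  split.
    (* The three [erefl] impose the frame: e1 and e2 are the images of v1 and v2 under the
       differential of X, and e3 is [nu], all at (x0, t0). *)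
    exact (chart_continuity oU sF XF' principal hconvex Sx0 It0 Uq tv1 tv2
      e11 e22 NN e12 Ne1 Ne2 erefl erefl erefl dN1 dN2 DN1 DN2 beta).
  have oO : open O by exact: open_open_time_interval.
  move=> Ot0.
  exact (chart_max_point oU sF XF' principal hconvex Sx0 It0 Uq tv1 tv2
    e11 e22 NN e12 Ne1 Ne2 erefl erefl erefl dN1 dN2 DN1 DN2
    oO Ot0 OI flow beta12).
have MP := parabolic_maximum_principle
  (fun x t Sx It => (chart x t Sx It).1)
  (fun x t Sx Ot => (chart x t Sx (OI t Ot)).2 Ot).
move=> t It; have I0 : I 0.
  by case: It => t0 tT; split=> //; apply: le_lt_trans tT; rewrite lee_fin.
have rho_ge0 x s : 0 <= rho x s.
  by rewrite /rho /roundness divr_ge0 ?sqr_ge0 ?powR_ge0.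
apply: ub_ereal_sup => _ [x Sx <-]; rewrite rhoE//.
rewrite leNgt; apply/negP => sup_lt.
have sup_ge s : sphere2 s ->
    ((rho s 0)%:E <= sup_roundness alpha (r1^~ 0%R) (r2^~ 0%R))%E.
  by move=> Ss; apply: ereal_sup_ubound; exists s => //; rewrite rhoE.
(* The supremum at time 0 lies below a real number and above [rho x 0], so it is itself real. *)
have {sup_lt} : exists2 m, (sup_roundness alpha (r1^~ 0%R) (r2^~ 0%R) = m%:E) & m < rho x t.
  move: sup_lt (sup_ge x Sx); case: (sup_roundness _ _ _) => [m| |] //.
  by rewrite lte_fin => ? _; exists m.
move=> [m supE m_lt].
have sup_le s : sphere2 s -> rho s 0 <= m.
  by move=> Ss; have := sup_ge s Ss; rewrite supE lee_fin.
have := MP m t x (le_trans (rho_ge0 x 0) (sup_le x Sx)) sup_le Sx It.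
by rewrite leNgt m_lt.
Qed.
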